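(* Let $(\pi,V)$ be a continuous representation of a Banach--Lie group $G$ on a Banach space $V$ and let $k\in\mathbb{N}$. Then the space $\mathcal D_{\mathfrak g}^k$ coincides with the space $V^k$ of $C^k$-vectors. This space is complete with respect to the norm $$\|v\|_k:=\|v\|+\sum_{j=1}^k\|\omega_v^j\|,$$ hence a Banach space, and the bilinear map $$\xi:\mathfrak g\times\mathcal D_{\mathfrak g}^{k+1}\to\mathcal D_{\mathfrak g}^k,\qquad (x,v)\mapsto\overline{\mathrm{d}\pi}(x)v,$$ is continuous with respect to the norms $\|\cdot\|_j$ on $\mathcal D_{\mathfrak g}^j$, $j=k,k+1$.
   Context: A Banach--Lie group is a Lie group modeled on a Banach space; $\mathfrak g$ is its Lie algebra with a norm defining its topology, and $\exp_G:\mathfrak g\to G$ its exponential function. A representation $\pi:G\to\mathrm{GL}(V)$ is continuous if the action $G\times V\to V$, $(g,v)\mapsto\pi(g)v$, is continuous. For $x\in\mathfrak g$ let $\mathcal D_x:=\{v\in V:\frac{d}{dt}|_{t=0}\pi(\exp_G(tx))v\text{ exists}\}$ and $\overline{\mathrm{d}\pi}(x)v:=\frac{d}{dt}|_{t=0}\pi(\exp_G(tx))v$ for $v\in\mathcal D_x$. Put $\mathcal D_{\mathfrak g}^1:=\mathcal D_{\mathfrak g}:=\bigcap_{x\in\mathfrak g}\mathcal D_x$ and inductively $$\mathcal D_{\mathfrak g}^n:=\{v\in\mathcal D_{\mathfrak g}:(\forall x\in\mathfrak g)\ \overline{\mathrm{d}\pi}(x)v\in\mathcal D_{\mathfrak g}^{n-1}\}\quad(n>1).$$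 For $v\in\mathcal D_{\mathfrak g}^n$ let $\omega_v^n:\mathfrak g^n\to V$, $\omega_v^n(x_1,\dots,x_n):=\overline{\mathrm{d}\pi}(x_1)\cdots\overline{\mathrm{d}\pi}(x_n)v$, and write $\|\omega_v^n\|:=\sup\{\|\omega_v^n(x_1,\dots,x_n)\|:\|x_1\|,\dots,\|x_n\|\le1\}$ for the norm of a continuous $n$-linear map (for $v \in V^k$ the maps $\omega_v^n$, $n\le k$, are continuous and $n$-linear). A vector $v\in V$ is a $C^k$-vector if $\pi^v:G\to V$, $g\mapsto\pi(g)v$, is a $C^k$-map. Here a map $f:U\to F$ ($U\subseteq E$ open, $E,F$ locally convex) is $C^k$ if it is continuous, the iterated directional derivatives $\mathrm{d}^jf(x)(h_1,\dots,h_j)=(\partial_{h_j}\cdots\partial_{h_1}f)(x)$ exist for all $j\le k$ and all maps $\mathrm{d}^jf:U\times E^j\to F$ are continuous (weaker than $C^k$ in the Fréchet sense). *)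

(* Defs.v *)
From HB Require Import structures.
From mathcomp Require Import all_boot all_order all_algebra.
From mathcomp Require Import all_classical all_reals all_analysis.

Set Implicit Arguments.
Unset Strict Implicit.
Unset Printing Implicit Defensive.

Import Order.TTheory GRing.Theory Num.Theory.
Import numFieldNormedType.Exports.

Local Open Scope classical_set_scope.
Local Open Scope ring_scope.

Section Calculus.
Variables (R : realType) (E F : normedModType R).

(* [iter_derive f [:: h_1; ...; h_j] x] is
   d^j f (x) (h_1, ..., h_j) = (\partial_{h_j} ... \partial_{h_1} f) (x):
   the first direction in the list is the first one differentiated along. *)
Fixpoint iter_derive (f : E -> F) (hs : seq E) : E -> F :=
  if hs is h :: hs' then iter_derive (fun x => 'D_h f x) hs' else f.

(* C^k in the Michal-Bastiani sense, for [f] on an open set [U]; the values of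
   [f] outside [U] are irrelevant. The second clause for [j = 0] is the
   continuity of [f]; [E^j] carries the product topology. *)
Definition Ck_on (k : nat) (U : set E) (f : E -> F) : Prop :=
  (forall (hs : seq E) (h x : E), (size hs < k)%N -> U x ->
     derivable (iter_derive f hs) x h) /\
  (forall j : nat, (j <= k)%N ->
     forall p : E * {ptws 'I_j -> E}, U p.1 ->
     {for p, continuous (fun q : E * {ptws 'I_j -> E} =>
        iter_derive f [seq q.2 i | i <- enum 'I_j] q.1)}).

Definition smooth_on (U : set E) (f : E -> F) : Prop :=
  forall k : nat, Ck_on k U f.

End Calculus.

Record chart (R : realType) (G : topologicalType) (E : normedModType R) :=
  Chart {
    chart_dom : set G;
    chart_map : G -> E;
    chart_inv : E -> G;
    chart_cod : set E := chart_map @` chart_dom;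
    chart_dom_open : open chart_dom;
    chart_cod_open : open chart_cod;
    chart_mapK : {in chart_dom, cancel chart_map chart_inv};
    chart_map_continuous : {within chart_dom, continuous chart_map};
    chart_inv_continuous : {within chart_cod, continuous chart_inv}
  }.

(* The atlas is not required to be maximal. *)
HB.mixin Record isBanachLieGroup (R : realType) (E : completeNormedModType R) G
    & Topological G & Group G := {
  atlas : set (chart G E);
  lie_hausdorff : hausdorff_space G;
  atlas_cover : forall x : G, exists2 c, atlas c & chart_dom c x;
  atlas_compatible : forall c d, atlas c -> atlas d ->
    smooth_on (chart_map c @` (chart_dom c `&` chart_dom d))
      (chart_map d \o chart_inv c);
  lie_mul_continuous : continuous (fun p : G * G => (p.1 * p.2)%g);
  lie_inv_continuous : continuous (fun x : G => (x^-1)%g);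
  lie_mul_smooth : forall c1 c2 c3, atlas c1 -> atlas c2 -> atlas c3 ->
    smooth_on
      [set p : E * E | [/\ chart_cod c1 p.1, chart_cod c2 p.2
         & chart_dom c3 (chart_inv c1 p.1 * chart_inv c2 p.2)%g]]
      (fun p : E * E =>
         chart_map c3 (chart_inv c1 p.1 * chart_inv c2 p.2)%g);
  lie_inv_smooth : forall c d, atlas c -> atlas d ->
    smooth_on
      [set a : E | chart_cod c a /\ chart_dom d ((chart_inv c a)^-1)%g]
      (fun a : E => chart_map d ((chart_inv c a)^-1)%g)
}.

#[short(type="banachLieGroupType")]
HB.structure Definition BanachLieGroup (R : realType)
    (E : completeNormedModType R) :=
  {G of Topological G & Group G & isBanachLieGroup R E G}.

Section LieGroup.
Variables (R : realType) (E : completeNormedModType R).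
Variable (G : banachLieGroupType E).

Definition Ck_map (F : normedModType R) (k : nat) (f : G -> F) : Prop :=
  forall c : chart G E, atlas c -> Ck_on k (chart_cod c) (f \o chart_inv c).

Definition smooth_curve (gamma : R -> G) : Prop :=
  continuous gamma /\
  forall c : chart G E, atlas c ->
    smooth_on (gamma @^-1` chart_dom c : set R^o) (chart_map c \o gamma).

(* The differential at 1 of a chart [c] around 1 identifies the Lie algebra
   T_1 G with [E]. Under this identification, [e] is the exponential function:
   [fun t => e (t *: x)] is the smooth one-parameter group with velocity [x]
   at [t = 0]. This determines [e] uniquely. *)
Definition is_exponential (c : chart G E) (e : E -> G) : Prop :=
  forall x : E,
  [/\ forall s t : R, e ((s + t) *: x) = (e (s *: x) * e (t *: x))%g,
      smooth_curve (fun t => e (t *: x))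
    & is_derive (0 : R^o) (1 : R^o) (fun t : R^o => chart_map c (e (t *: x))) x].

End LieGroup.

Section Representation.
Variables (R : realType) (E V : completeNormedModType R).
Variable (G : banachLieGroupType E).

Definition continuous_representation (pi : G -> {linear V -> V}) : Prop :=
  [/\ forall v, pi 1%g v = v,
      forall x y v, pi (x * y)%g v = pi x (pi y v)
    & continuous (fun p : G * V => pi p.1 p.2)].

Definition Ck_vectors (pi : G -> {linear V -> V}) (k : nat) : set V :=
  [set v | Ck_map k (fun x : G => pi x v)].

Variables (e : E -> G) (pi : G -> {linear V -> V}).

Definition orbit_curve (x : E) (v : V) : R^o -> V := fun t => pi (e (t *: x)) v.

Definition dpi_dom (x : E) : set V :=
  [set v | derivable (orbit_curve x v) 0 1].

Definition dpi (x : E) (v : V) : V := 'D_1 (orbit_curve x v) 0.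

Definition Dg : set V := \bigcap_(x in [set: E]) dpi_dom x.

(* [Dspace 0] is the whole space, hence [Dspace 1] is [Dg]. *)
Fixpoint Dspace (n : nat) : set V :=
  if n is n'.+1 then [set v | Dg v /\ forall x, Dspace n' (dpi x v)]
  else [set: V].

Definition omega (n : nat) (v : V) (xs : 'I_n -> E) : V :=
  foldr dpi v [seq xs i | i <- enum 'I_n].

Local Open Scope ereal_scope.

(* Norms are valued in [\bar R], so that an unbounded supremum is [+oo]. *)
Definition omega_norm (n : nat) (v : V) : \bar R :=
  ereal_sup [set `|omega v xs|%:E
            | xs in [set xs : 'I_n -> E | forall i, (`|xs i| <= 1)%R]].

Definition Dnorm (k : nat) (v : V) : \bar R :=
  `|v|%:E + \sum_(1 <= j < k.+1) omega_norm j v.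

End Representation.

Section Banach.
Variables (R : realType) (V : lmodType R) (D : set V) (N : V -> \bar R).
Local Open Scope ereal_scope.

Definition linear_subspace : Prop :=
  D 0%R /\ forall (a : R) u v, D u -> D v -> D (a *: u + v)%R.

Definition is_norm_on : Prop :=
  [/\ forall v, D v -> N v \is a fin_num,
      forall v, D v -> N v = 0 -> v = 0%R,
      forall (a : R) v, D v -> N (a *: v)%R = `|a|%:E * N v
    & forall u v, D u -> D v -> N (u + v)%R <= N u + N v].

Definition complete_on : Prop :=
  forall u : nat -> V, (forall n, D (u n)) ->
  (forall eps : R, (0 < eps)%R -> exists n0 : nat, forall m n : nat,
     (n0 <= m)%N -> (n0 <= n)%N -> N (u m - u n)%R < eps%:E) ->
  exists2 v, D v &
    forall eps : R, (0 < eps)%R -> exists n0 : nat, forall n : nat,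
      (n0 <= n)%N -> N (u n - v)%R < eps%:E.

Definition banach_subspace : Prop :=
  [/\ linear_subspace, is_norm_on & complete_on].

End Banach.

Section Bilinear.
Variables (R : realType) (E : normedModType R) (V : lmodType R).
Variables (D1 D2 : set V) (N1 N2 : V -> \bar R) (xi : E -> V -> V).
Local Open Scope ereal_scope.

Definition bilinear_map_on : Prop :=
  [/\ forall x v, D1 v -> D2 (xi x v),
      forall (a : R) x y v, D1 v -> xi (a *: x + y)%R v = (a *: xi x v + xi y v)%R
    & forall (a : R) x u v, D1 u -> D1 v ->
        xi x (a *: u + v)%R = (a *: xi x u + xi x v)%R].

(* Continuity of E x (D1, N1) -> (D2, N2) at every point. *)
Definition continuous_map_on : Prop :=
  forall x0 v0, D1 v0 -> forall eps : R, (0 < eps)%R ->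
  exists2 delta : R, (0 < delta)%R & forall x v, D1 v ->
    (`|x - x0| < delta)%R -> N1 (v - v0)%R < delta%:E ->
    N2 (xi x v - xi x0 v0)%R < eps%:E.

End Bilinear.

(* Main.v *)
Require Import Defs.
From HB Require Import structures.
From mathcomp Require Import all_boot all_order all_algebra.
From mathcomp Require Import ring lra.
From mathcomp Require Import all_classical all_reals all_analysis.
Import Order.TTheory GRing.Theory Num.Theory.
Import numFieldNormedType.Exports.
Local Open Scope classical_set_scope.
Local Open Scope ring_scope.

Set Implicit Arguments.
Unset Strict Implicit.
Unset Printing Implicit Defensive.

(** A C^1 map in the Michal-Bastiani sense has a directional derivative that is
strict along directions converging to the given one; this yields the chain rule,
and a C^k map is recognized by its total derivative (x, h) |-> 'D_h f x.

Comparing the deviations of exp from the identity at the scales 1, 1/2, 1/4, ...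
through the squaring map shows that, in a chart, exp is a Lipschitz perturbation
of the identity near 0, hence continuous and locally surjective. For v in D_g,
Baire's theorem then gives |pi(g) v - v| <= K |g - 1| near 1, so that the
derivative of pi(gamma(t)) v at t = 0 depends only on gamma'(0); this makes
x |-> dpi(x) v linear and bounded. The Banach-Steinhaus theorem bounds the
multilinear maps omega_v^n.

If v is in D_g^k, then the derivative of q |-> pi(q) dpi(z_1) ... dpi(z_n) v in
the direction u is pi(q) dpi(L(q, u)) dpi(z_1) ... dpi(z_n) v with L smooth, and
v is a C^k-vector by induction. Conversely pi(g) dpi(x) v is a partial derivative
of (g, h) |-> pi(gh) v. Completeness follows because each dpi(x) is closed. *)

(** * Calculus in normed modules *)

(** The hypothesis on the exponential function concerns one line through 0 at a time, and the action
    is only assumed jointly continuous; neither continuity of exp nor norm continuity of the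
    operators is given. Baire's theorem needs the former. It bounds difference quotients only on a
    ball around some point x1 of the Lie algebra, which cannot be moved to 0 by linearity, as
    linearity is still to be shown; the group law has to carry the bound back to 1. Once a
    derivative depends only on the velocity, additivity comes from multiplying two curves.

    Differentiability in the Michal-Bastiani sense gives no control in operator norm, so joint
    continuity in point and direction takes its place. Differentiating an orbit map repeatedly moves
    the base point and makes the directions themselves depend on it. The expressions Phi(a(z),
    s_1(z), ..., s_n(z)), multilinear in the slots, form a class closed under differentiation. One
    theorem on this class serves both for orbit maps and for the comparison of the two descriptions
    of C^k maps. *)

Section LinearForms.
Variables (R : nzRingType) (V : lmodType R).

(** Syntax for proving linear identities between vectors by reflection: two expressions over the
    same atoms agree as soon as the scalar coefficients of every atom do, and these equations are
    left to [ring] or [field]. *)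
Inductive lform :=
  LVar of nat | LAdd of lform & lform | LOpp of lform | LZero
| LScale of R & lform.

Fixpoint lform_eval (env : seq V) (f : lform) : V :=
  match f with
  | LVar i => nth 0 env i
  | LAdd f g => lform_eval env f + lform_eval env g
  | LOpp f => - lform_eval env f
  | LZero => 0
  | LScale a f => a *: lform_eval env f
  end.

Fixpoint lform_coef (f : lform) (i : nat) : R :=
  match f with
  | LVar j => if eqn i j then 1 else 0
  | LAdd f g => lform_coef f i + lform_coef g i
  | LOpp f => - lform_coef f i
  | LZero => 0
  | LScale a f => a * lform_coef f i
  end.

Fixpoint lform_agree (f g : lform) (n : nat) : Prop :=
  if n is n'.+1 then lform_coef f n' = lform_coef g n' /\ lform_agree f g n'
  else True.

Lemma lform_evalE env f n : (size env <= n)%N ->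
  lform_eval env f = \sum_(i < n) lform_coef f i *: nth 0 env i.
Proof.
move=> le_n; elim: f => [j|f IHf h IHh|f IHf||a f IHf] /=.
- have [ltj|gej] := ltnP j n; last first.
    rewrite nth_default ?(leq_trans le_n)//.
    rewrite big1 // => i _; case: eqnP => [e|_]; last by rewrite scale0r.
    by move: (ltn_ord i); rewrite e ltnNge gej.
  rewrite (bigD1 (Ordinal ltj)) //= big1 ?addr0 => [|i neq].
    by case: eqnP => // _; rewrite scale1r.
  case: eqnP => [e|_]; last by rewrite scale0r.
  by case/negP: neq; apply/eqP/val_inj.
- by rewrite IHf IHh -big_split; apply: eq_bigr => i _; rewrite scalerDl.
- by rewrite IHf -sumrN; apply: eq_bigr => i _; rewrite scaleNr.
- by rewrite big1 // => i _; rewrite scale0r.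
- by rewrite IHf scaler_sumr; apply: eq_bigr => i _; rewrite scalerA.
Qed.

Lemma lform_eval_eq env f g :
  lform_agree f g (size env) -> lform_eval env f = lform_eval env g.
Proof.
move=> H; rewrite !(@lform_evalE env _ (size env)) //; apply: eq_bigr => i _.
congr (_ *: _); move: (ltn_ord i); elim: (size env) H (nat_of_ord i) => // n IH.
move=> /= [e H] j; rewrite ltnS leq_eqVlt => /orP[/eqP->//|]; exact: IH.
Qed.

End LinearForms.

(* Atoms are compared up to unification: instances may differ syntactically. *)
Ltac lmod_same x y :=
  match constr:(Set) with
  | _ => let _ := match constr:(Set) with _ => constr_eq x y end in constr:(true)
  | _ => let _ := match constr:(Set) with _ => unify x y end in constr:(true)
  | _ => constr:(false)
  end.
Ltac lmod_index x l :=
  lazymatch l with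
  | cons ?y ?l' => lazymatch lmod_same x y with
    | true => constr:(O)
    | false => let n := lmod_index x l' in constr:(S n)
    end
  end.
Ltac lmod_mem x l :=
  lazymatch l with
  | cons ?y ?l' => lazymatch lmod_same x y with
    | true => constr:(true)
    | false => lmod_mem x l'
    end
  | _ => constr:(false)
  end.
Ltac lmod_atoms t l :=
  lazymatch t with
  | @GRing.add _ ?a ?b => let l' := lmod_atoms a l in lmod_atoms b l'
  | @GRing.opp _ ?a => lmod_atoms a l
  | @GRing.scale _ _ _ ?a => lmod_atoms a l
  | @GRing.zero _ => l
  | _ => lazymatch lmod_mem t l with true => l | false => constr:(cons t l) end
  end.
Ltac lmod_reify R t l :=
  lazymatch t with
  | @GRing.add _ ?a ?b => let a' := lmod_reify R a l in
      let b' := lmod_reify R b l in constr:(@LAdd R a' b')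
  | @GRing.opp _ ?a => let a' := lmod_reify R a l in constr:(@LOpp R a')
  | @GRing.scale _ _ ?c ?a => let a' := lmod_reify R a l in constr:(@LScale R c a')
  | @GRing.zero _ => constr:(@LZero R)
  | _ => let n := lmod_index t l in constr:(@LVar R n)
  end.
(* [tac] compares the coefficients of each atom. *)
Ltac lmod_with tac :=
  lazymatch goal with
  | R : realType |- @eq ?T ?a ?b =>
    let l0 := lmod_atoms a (@nil T) in
    let l := lmod_atoms b l0 in
    let fa := lmod_reify R a l in
    let fb := lmod_reify R b l in
    refine (@lform_eval_eq R _ l fa fb _);
    cbn [lform_agree lform_coef size eqn]; repeat split; tac
  end.
Ltac lmod := lmod_with ltac:(ring).

(** * Directional derivatives and the mean value inequality *)

Section MeanValue.
Variables (R : realType) (V : normedModType R).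

Lemma is_deriveP (X : normedModType R) (f : X -> V) x h l :
  is_derive x h f l <->
  (fun t : R => t^-1 *: (f (t *: h + x) - f x)) @ 0^' --> l.
Proof.
split=> [[+ <-]|H]; first by [].
by split; [apply/cvg_ex; exists l|exact/cvg_lim].
Qed.

(** Cleared of the division by [t], the estimate includes [t = 0] and can be used on a full
    neighbourhood. *)
Lemma is_derive_near (X : normedModType R) (f : X -> V) x h l :
  is_derive x h f l -> forall eps : R, 0 < eps ->
  \forall t \near (0 : R), `|f (t *: h + x) - f x - t *: l| <= eps * `|t|.
Proof.
move/is_deriveP/cvgrPdist_le => H eps e0.
have /nbhs_ballP[d /= d0 Hd] := H _ e0.
apply/nbhs_ballP; exists d => //= t td.
have [->|t0] := eqVneq t 0; first by rewrite !scale0r add0r subrr subr0 !normr0 mulr0.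
have := Hd t td t0; rewrite distrC.
rewrite (_ : _ - l = t^-1 *: (f (t *: h + x) - f x - t *: l)); last first.
  by lmod_with ltac:(by field).
by rewrite normrZ normfV mulrC ler_pdivrMr ?normr_gt0.
Qed.

Lemma near_is_derive (X : normedModType R) (f : X -> V) x h l :
  (forall eps : R, 0 < eps ->
  \forall t \near (0 : R), `|f (t *: h + x) - f x - t *: l| <= eps * `|t|) ->
  is_derive x h f l.
Proof.
move=> H; apply/is_deriveP/cvgrPdist_le => eps e0.
have /nbhs_ballP[d /= d0 Hd] := H _ e0.
apply/nbhs_ballP; exists d => //= t td t0.
rewrite distrC.
rewrite (_ : _ - l = t^-1 *: (f (t *: h + x) - f x - t *: l)); last first.
  by lmod_with ltac:(by field).
by rewrite normrZ normfV mulrC ler_pdivrMr ?normr_gt0 //; exact: Hd.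
Qed.

Lemma is_derive_cvg (X : normedModType R) (f : X -> V) x h l :
  is_derive x h f l -> (fun t : R => f (t *: h + x)) @ 0 --> f x.
Proof.
move=> /is_derive_near /(_ _ ltr01) H.
apply/cvgrPdist_le => eps e0; near=> t.
rewrite distrC (_ : _ - f x = (f (t *: h + x) - f x - t *: l) + t *: l); last by lmod.
rewrite (le_trans (ler_normD _ _)) // normrZ.
have t1 : `|t| <= eps / (1 + `|l|).
  near: t; apply: (@nbhs0_le R R^o); rewrite divr_gt0 // ltr_pwDl //.
apply: (@le_trans _ _ (1 * `|t| + `|t| * `|l|)).
  by rewrite lerD2r; near: t.
rewrite mulrC -mulrDr -ler_pdivlMr // ltr_pwDl //.
Unshelve. all: by end_near. Qed.

(* The largest [s] in [0, 1] up to which the estimate with constant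
   [C + eps] holds is [1]. *)
Lemma mean_value_le (f df : R -> V) (C : R) :
  (forall t, 0 <= t <= 1 -> is_derive (t : R^o) 1 f (df t)) ->
  (forall t, 0 <= t <= 1 -> `|df t| <= C) -> `|f 1 - f 0| <= C.
Proof.
move=> fd dfC; apply/ler_addgt0Pr => eps e0.
have fc : {within `[0, 1], continuous f}.
  apply: continuous_in_subspaceT => t; rewrite inE /= in_itv /= => t01.
  have /is_derive_cvg := fd t t01.
  move=> H; apply/cvgrPdist_le => e' e'0.
  have /cvgrPdist_le/(_ _ e'0)/nbhs_ballP[d /= d0 Hd] := H.
  apply/nbhs_ballP; exists d => //= s sd.
  have := Hd (s - t); rewrite /= /GRing.scale /= mulr1 subrK; apply.
  by move: sd; rewrite /ball /= sub0r normrN distrC.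
pose S := [set t : R | 0 <= t <= 1 /\ `|f t - f 0| <= (C + eps) * t].
have S0 : S 0 by rewrite /S /= lexx ler01 subrr normr0 mulr0.
have hS : has_sup S by split; [exists 0 | exists 1 => t [/andP[]]].
pose s := sup S.
have s0 : 0 <= s by apply: ub_le_sup => //; exact: (proj2 hS).
have s1 : s <= 1 by apply: ge_sup => //; [exists 0 | move=> t [/andP[]]].
have C0 : 0 <= C by apply: le_trans (dfC 0 _); rewrite ?lexx ?ler01.
have s01 : 0 <= s <= 1 by rewrite s0.
have near_s : exists2 d : R, 0 < d & forall t : R, `|t - s| < d ->
    `|f t - f s| <= (C + eps) * `|t - s|.
  have /is_derive_near/(_ _ e0)/nbhs_ballP[d /= d0 Hd] := fd s s01.
  exists d => // t td; have := Hd (t - s).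
  rewrite /= /GRing.scale /= mulr1 subrK.
  rewrite /ball /= sub0r normrN => /(_ td) {}Hd.
  rewrite (_ : f t - f s = (f t - f s - (t - s) *: df s) + (t - s) *: df s);
    last by lmod.
  rewrite (le_trans (ler_normD _ _)) // normrZ mulrDl addrC lerD //.
  by rewrite mulrC ler_wpM2r // dfC.
have [d d0 Hd] := near_s.
have Ss : S s.
  split=> //; have [t St st] := sup_adherent d0 hS.
  have ts : t <= s by apply: ub_le_sup => //; exact: (proj2 hS).
  have tsd : `|t - s| < d by rewrite ler0_norm ?subr_le0 // -/s in st *; lra.
  have := Hd t tsd; rewrite ler0_norm ?subr_le0 // => H1.
  case: St => _ H2.
  rewrite (_ : f s - f 0 = (f t - f 0) - (f t - f s)); last by lmod.
  by rewrite (le_trans (ler_normB _ _)) // (le_trans (lerD H2 H1)) //; lra.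
suff s_1 : s = 1 by case: Ss => _; rewrite s_1 mulr1.
apply/eqP; rewrite eq_le s1 leNgt; apply/negP => slt1.
pose t := Num.min 1 (s + d / 2).
have ts : s < t by rewrite /t lt_min slt1 /=; lra.
have t1 : t <= 1 by rewrite /t ge_min lexx.
have tsd : `|t - s| < d.
  rewrite gtr0_norm ?subr_gt0 //.
  have : t <= s + d / 2 by rewrite /t ge_min lexx orbT.
  by lra.
have St : S t.
  split; first by rewrite t1 (le_trans s0 (ltW ts)).
  have := Hd t tsd; rewrite gtr0_norm ?subr_gt0 // => H1.
  case: Ss => _ H2.
  rewrite (_ : f t - f 0 = (f t - f s) + (f s - f 0)); last by lmod.
  by rewrite (le_trans (ler_normD _ _)) // (le_trans (lerD H1 H2)) //; lra.
by have : t <= s by [apply: ub_le_sup => //; exact: (proj2 hS)]; rewrite leNgt ts.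
Qed.

End MeanValue.

Section LocalEstimates.
Variables (R : realType) (X Y Z : normedModType R).

Lemma continuous_for_delta (f : X -> Y) x : {for x, continuous f} ->
  forall e : R, 0 < e -> exists2 d : R, 0 < d &
    forall y, `|y - x| < d -> `|f y - f x| < e.
Proof.
move=> /cvgrPdist_lt H e e0; have /nbhs_normP[d d0 Hd] := H _ e0.
exists d => // y yd; rewrite distrC; apply: Hd.
by rewrite /ball_ /= distrC.
Qed.

Lemma continuous_for_delta2 (f : X * Z -> Y) x z :
  {for (x, z), continuous f} ->
  forall e : R, 0 < e -> exists2 d : R, 0 < d &
    forall y w, `|y - x| < d -> `|w - z| < d -> `|f (y, w) - f (x, z)| < e.
Proof.
move=> H e e0; move: H => /cvgrPdist_lt H.
have /nbhs_ballP[d /= d0 Hd] := H _ e0.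
exists d => // y w yd wd; rewrite distrC; apply: Hd.
by split; rewrite /= -ball_normE /ball_ /= distrC.
Qed.

Lemma open_delta (U : set X) x : open U -> U x ->
  exists2 d : R, 0 < d & forall y, `|y - x| < d -> U y.
Proof.
move=> oU Ux.
have /nbhs_normP[d d0 Hd] : nbhs x U by exact: open_nbhs_nbhs.
by exists d => // y yd; apply: Hd; rewrite /ball_ /= distrC.
Qed.

(** Rescaling [h] to norm [d / 2], inside the open ball, costs the factor [2]. Homogeneity alone
    suffices, so the bound applies to directional derivatives before their additivity is known. *)
Lemma homogeneous_bound (L : X -> Y) (M d : R) : 0 < d ->
  (forall a h, L (a *: h) = a *: L h) ->
  (forall h, `|h| < d -> `|L h| <= M) -> forall h, `|L h| <= 2 * M / d * `|h|.
Proof.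
move=> d0 LZ LM h; have [->|h0] := eqVneq h 0.
  by rewrite -(scale0r 0) LZ scale0r normr0 scale0r normr0 mulr0.
have hp : 0 < `|h| by rewrite normr_gt0.
have := LM ((d / (2 * `|h|)) *: h).
have dh0 : 0 < d / (2 * `|h|) by rewrite divr_gt0 // mulr_gt0.
rewrite LZ (normrZ _ h) (normrZ _ (L h)) (gtr0_norm dh0).
rewrite (_ : d / (2 * `|h|) * `|h| = d / 2); last by field; lra.
move=> /(_ ltac:(lra)); rewrite -ler_pdivlMl // => /le_trans; apply.
rewrite le_eqVlt; apply/orP; left; apply/eqP; field; lra.
Qed.

Lemma is_derive_dir (f : X -> Y) x h l (a : R) :
  is_derive x h f l -> is_derive x (a *: h) f (a *: l).
Proof.
move=> /is_derive_near H; apply: near_is_derive => e e0.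
have a1 : 0 < `|a| + 1 by rewrite ltr_wpDl.
have /(_ (e / (`|a| + 1)) (divr_gt0 e0 a1))/nbhs_normP[d d0 Hd] := H.
apply/nbhs_normP; exists (d / (`|a| + 1)); first exact: divr_gt0.
move=> t; rewrite /ball_ /= sub0r normrN => td.
have tad : `|t * a| < d.
  rewrite normrM; move: td; rewrite ltr_pdivlMr //.
  by apply: le_lt_trans; rewrite ler_wpM2l // lerDl.
have := Hd (t * a); rewrite /ball_ /= sub0r normrN -!scalerA => /(_ tad).
move=> /le_trans; apply; rewrite normrM (mulrC `|t|) mulrA ler_wpM2r //.
by rewrite mulrAC ler_pdivrMr // ler_wpM2l ?(ltW e0) // lerDl.
Qed.

Lemma deriveZdir (f : X -> Y) x h (a : R) :
  derivable f x h -> 'D_(a *: h) f x = a *: 'D_h f x.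
Proof. by move=> /derivableP /(is_derive_dir a)[_ ->]. Qed.

Lemma is_derive_line (f : X -> Y) (k y : X) (s : R) l :
  is_derive (s *: k + y) k f l ->
  is_derive (s : R^o) 1 (fun s : R => f (s *: k + y)) l.
Proof.
move=> /is_deriveP H; apply/is_deriveP; apply: cvg_trans H.
apply: near_eq_cvg; near=> t; congr (_ *: (f _ - _)).
by have -> : t *: (1 : R^o) = t :> R by [exact: mulr1]; lmod.
Unshelve. all: by end_near. Qed.

Lemma mean_value_ball (f df : X -> Y) (a b : X) (C : R) :
  (forall s, 0 <= s <= 1 ->
    is_derive (s *: (b - a) + a) (b - a) f (df (s *: (b - a) + a))) ->
  (forall s, 0 <= s <= 1 -> `|df (s *: (b - a) + a)| <= C) ->
  `|f b - f a| <= C.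
Proof.
move=> fd dfC.
have := @mean_value_le R Y (fun s => f (s *: (b - a) + a))
  (fun s => df (s *: (b - a) + a)) C.
rewrite scale1r scale0r subrK add0r; apply => t t01; last exact: dfC.
by apply: is_derive_line; exact: fd.
Qed.

Lemma segment_near (x : X) (a b : X) (d s : R) : 0 <= s <= 1 ->
  `|a - x| < d -> `|b - x| < d -> `|s *: (b - a) + a - x| < d.
Proof.
move=> /andP[s0 s1] ad bd.
rewrite (_ : _ - x = (1 - s) *: (a - x) + s *: (b - x)); last by lmod.
rewrite (le_lt_trans (ler_normD _ _)) // !normrZ ger0_norm ?subr_ge0 //.
rewrite (ger0_norm s0); move: s0; rewrite le_eqVlt => /orP[/eqP<-|s0].
  by rewrite subr0 mul1r mul0r addr0.
apply: (@lt_le_trans _ _ ((1 - s) * d + s * d)); last by lra.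
by apply: ler_ltD; rewrite ?ler_wpM2l ?subr_ge0 ?ltr_pM2l // ltW.
Qed.

End LocalEstimates.

Lemma near_eq_continuous (T T' : topologicalType) (f g : T -> T') x :
  {near x, f =1 g} -> {for x, continuous f} -> {for x, continuous g}.
Proof.
move=> fg H; change (g @ x --> g x); rewrite -(nbhs_singleton fg).
by apply: cvg_trans H; apply: near_eq_cvg; apply: filterS fg => y ->.
Qed.

(** * Maps of class C^r through iterated total derivatives *)

Section Cr.
Variables (R : realType) (Y : normedModType R).

(* Equivalent to [Ck_on]; the recursion on the total derivative
   [(x, h) |-> 'D_h f x] is the form that composes well. *)
Fixpoint Cr (r : nat) (X : normedModType R) (U : set X) (f : X -> Y) : Prop :=
  (forall x, U x -> {for x, continuous f}) /\
  if r is r'.+1 then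
    (forall x h, U x -> derivable f x h) /\
    @Cr r' (X * X)%type (U `*` setT) (fun p => 'D_(p.2) f p.1)
  else True.

Implicit Types (r s : nat) (X : normedModType R).

Lemma Cr_continuous r X (U : set X) f x :
  Cr r U f -> U x -> {for x, continuous f}.
Proof. by case: r => [|r] [+ _]; apply. Qed.

Lemma Cr_derivable r X (U : set X) f x h :
  Cr r.+1 U f -> U x -> derivable f x h.
Proof. by case=> _ [+ _]; apply. Qed.

Lemma Cr_derive r X (U : set X) f :
  Cr r.+1 U f -> Cr r (U `*` setT) (fun p : X * X => 'D_(p.2) f p.1).
Proof. by case=> _ []. Qed.

Lemma Cr_is_derive r X (U : set X) f x h :
  Cr r.+1 U f -> U x -> is_derive x h f ('D_h f x).
Proof. by move=> fC Ux; apply/derivableP; exact: Cr_derivable fC Ux. Qed.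

Lemma CrW r X (U : set X) f : Cr r.+1 U f -> Cr r U f.
Proof.
elim: r X U f => [|r IH] X U f; first by case=> ? [].
by case=> fc [fd]; split=> //; split=> //; exact: IH.
Qed.

Lemma Cr_le r s X (U : set X) f : (s <= r)%N -> Cr r U f -> Cr s U f.
Proof.
elim: r => [|r IH]; first by rewrite leqn0 => /eqP ->.
by rewrite leq_eqVlt ltnS => /orP[/eqP->//|/IH H /CrW].
Qed.

Lemma Cr_subset r X (U W : set X) f : W `<=` U -> Cr r U f -> Cr r W f.
Proof.
elim: r X U W f => [|r IH] X U W f WU [fc H]; split=> //.
- by move=> x /WU; exact: fc.
- by move=> x /WU; exact: fc.
- case: H => fd H; split; first by move=> x h /WU; exact: fd.
  by apply: IH H => -[x y] [/= /WU].
Qed.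

Lemma setXT_open (X X' : normedModType R) (U : set X) :
  open U -> open (U `*` (setT : set X')).
Proof.
move=> oU; rewrite (_ : _ `*` _ = fst @^-1` U); last first.
  by apply/seteqP; split=> [p []|p Up] //; split.
by apply: open_comp => // p _; exact: cvg_fst.
Qed.

(** Every clause of [Cr] is a condition at single points of the set, on [f] as a total function, so
    each point may bring its own set. *)
Lemma Cr_local r X (U : set X) f :
  (forall x, U x -> exists2 W, W x & Cr r W f) -> Cr r U f.
Proof.
elim: r X U f => [|r IH] X U f H.
  by split=> // x /H[W Wx [+ _]]; apply.
split; first by move=> x /H[W Wx /Cr_continuous]; apply.
split; first by move=> x h /H[W Wx /Cr_derivable]; apply.
apply: IH => -[x y] [/= Ux _]; have [W Wx HW] := H _ Ux.
by exists (W `*` setT) => //; exact: Cr_derive.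
Qed.

Lemma open_near_eq (X : topologicalType) (T : Type) (U : set X) (f g : X -> T) x :
  open U -> U x -> (forall y, U y -> f y = g y) -> {near x, f =1 g}.
Proof. by move=> oU Ux fg; near do apply: fg; apply: open_nbhs_nbhs.
Unshelve. all: by end_near. Qed.

Lemma is_derive_eq_open (X : normedModType R) (U : set X) (f g : X -> Y) x h l :
  open U -> U x -> (forall y, U y -> f y = g y) ->
  is_derive x h f l -> is_derive x h g l.
Proof.
move=> oU Ux fg /is_deriveP H; apply/is_deriveP; apply: cvg_trans H.
rewrite fg //; apply: near_eq_cvg; near=> t; congr (_ *: (_ - _)); apply: fg.
near: t; apply: cvg_within.
have : (fun t : R => t *: h + x) @ 0 --> 0 *: h + x.
  by apply: cvgD; [apply: cvgZr_tmp; exact: cvg_id|exact: cvg_cst].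
rewrite scale0r add0r; apply; exact: open_nbhs_nbhs.
Unshelve. all: by end_near. Qed.

(** The total derivatives may differ off [U]; on the open set [U] they agree because the difference
    quotients agree for small [t], and the product with the whole space is open again, so the
    induction continues. *)
Lemma eq_Cr r X (U : set X) f g :
  open U -> (forall x, U x -> f x = g x) -> Cr r U f -> Cr r U g.
Proof.
move=> oU fg; elim: r X U f g oU fg => [|r IH] X U f g oU fg fC.
  split=> // x Ux; apply: near_eq_continuous (Cr_continuous fC Ux).
  exact: open_near_eq oU Ux fg.
have gd x h : U x -> is_derive x h g ('D_h f x).
  by move=> Ux; exact: is_derive_eq_open oU Ux fg (Cr_is_derive h fC Ux).
split.
  move=> x Ux; apply: near_eq_continuous (Cr_continuous fC Ux).
  exact: open_near_eq oU Ux fg.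
split; first by move=> x h /(gd x h)[].
apply: IH (Cr_derive fC); first exact: setXT_open.
by move=> [x h] [/= Ux _]; have [] := gd x h Ux.
Qed.

Lemma Cr_cst r X (U : set X) y : Cr r U (fun=> y).
Proof.
elim: r X U y => [|r IH] X U y; split; do ?by move=> x _; exact: cvg_cst.
  by [].
split; first by move=> x h _; exact: derivable_cst.
have -> : (fun p : X * X => 'D_(p.2) (fun=> y) p.1) = fun=> 0.
  by apply/funext => p; exact: derive_cst.
exact: IH.
Qed.

End Cr.

(** * Strict differentiability of C^1 maps and its consequences *)

Section C1.
Variables (R : realType) (X Y : normedModType R).

(** The mean value inequality for [s |-> f (s *: k + y) - s *: z], whose derivative is
    [df s - z]. *)
Lemma mean_value_affine (f : X -> Y) (k y : X) (df : R -> Y) (z : Y) (C : R) :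
  (forall s, 0 <= s <= 1 -> is_derive (s *: k + y) k f (df s)) ->
  (forall s, 0 <= s <= 1 -> `|df s - z| <= C) ->
  `|f (k + y) - f y - z| <= C.
Proof.
move=> fd dfC.
have dz (s : R) : is_derive (s : R^o) (1 : R^o) (fun s : R => s *: z) z.
  apply: near_is_derive => e e0; near=> t.
  have -> : t *: (1 : R^o) = t :> R by exact: mulr1.
  rewrite (_ : _ - _ = 0); last by lmod.
  by rewrite normr0 mulr_ge0 // ltW.
have := @mean_value_le R Y (fun s => f (s *: k + y) - s *: z)
  (fun s => df s - z) C.
rewrite !scale1r !scale0r add0r subr0 addrAC; apply => t t01; last exact: dfC.
by apply: is_deriveB; apply: is_derive_line; exact: fd.
Unshelve. all: by end_near. Qed.

Variables (U : set X) (f : X -> Y).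
Hypotheses (oU : open U) (fC1 : Cr 1 U f).

Let D_continuous y h : U y ->
  {for (y, h), continuous (fun p : X * X => 'D_(p.2) f p.1)}.
Proof. by move=> Uy; apply: Cr_continuous (Cr_derive fC1) _. Qed.

(** Joint continuity of [(y, h) |-> 'D_h f y] keeps the derivative close to ['D_h0 f y0] along the
    whole segment from [y] to [t *: h + y], and the mean value inequality integrates this. The
    uniformity in [y] and [h] stands in for Frechet differentiability. *)
Lemma C1_strict y0 h0 (e : R) : U y0 -> 0 < e ->
  exists2 d : R, 0 < d & forall y h (t : R),
    `|y - y0| < d -> `|h - h0| < d -> `|t| < d ->
    `|f (t *: h + y) - f y - t *: 'D_h0 f y0| <= e * `|t|.
Proof.
move=> Uy0 e0.
have [d1 d10 H1] := continuous_for_delta2 (@D_continuous y0 h0 Uy0) e0.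
have [d2 d20 H2] := open_delta oU Uy0.
pose d := Num.min d1 d2.
have d0 : 0 < d by rewrite lt_min d10.
have N0 : 0 < `|h0| + d + 1 by rewrite ltr_wpDl ?addr_ge0 ?(ltW d0).
have dN0 : 0 < d / 2 / (`|h0| + d + 1) by rewrite !divr_gt0.
(* The first bound keeps [y] within [d / 2] of [y0]; the second keeps [t *: h] no longer than
   [d / 2], as the norm of [h] is at most that of [h0] plus [d]. *)
exists (Num.min (d / 2) (d / 2 / (`|h0| + d + 1))); first by rewrite lt_min dN0 divr_gt0.
move=> y h t; rewrite !lt_min => /andP[y1 _] /andP[h1 _] /andP[t1 t2].
have seg s : 0 <= s <= 1 -> `|s *: (t *: h) + y - y0| < d.
  move=> /andP[s0 s1]; rewrite -addrA (le_lt_trans (ler_normD _ _)) //.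
  rewrite (splitr d) ler_ltD // scalerA normrZ normrM (ger0_norm s0).
  have ht : `|t| * `|h| <= d / 2.
    move: t2; rewrite ltr_pdivlMr // => /ltW; apply: le_trans.
    rewrite ler_wpM2l //.
    rewrite (_ : h = (h - h0) + h0); last by lmod.
    by rewrite (le_trans (ler_normD _ _)) //; lra.
  by rewrite -mulrA (le_trans _ ht) // ler_piMl.
apply: (@mean_value_affine f (t *: h) y
  (fun s => t *: 'D_h f (s *: (t *: h) + y))) => s /seg.
  rewrite lt_min => /andP[_ /H2 Us]; apply: is_derive_dir.
  exact: Cr_is_derive fC1 Us.
rewrite lt_min => /andP[sd _].
rewrite -scalerBr normrZ mulrC ler_wpM2r // ltW //.
by apply: H1 => //; rewrite (lt_le_trans h1) // (@le_trans _ _ d) ?ge_min ?lexx //; lra.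
Qed.

Lemma C1_cvg (T : Type) (F : set_system T) {FF : ProperFilter F}
    (y h : T -> X) (t : T -> R) y0 h0 : U y0 ->
  y @ F --> y0 -> h @ F --> h0 -> t @ F --> 0 -> (\near F, t F != 0) ->
  (fun s => (t s)^-1 *: (f (t s *: h s + y s) - f (y s))) @ F --> 'D_h0 f y0.
Proof.
move=> Uy0 yF hF tF tn0; apply/cvgrPdist_le => e e0.
have [d d0 Hd] := C1_strict h0 Uy0 e0.
near=> s.
have ts0 : t s != 0 by near: s.
rewrite distrC.
rewrite (_ : _ - _ = (t s)^-1 *: (f (t s *: h s + y s) - f (y s) - t s *: 'D_h0 f y0));
  last by lmod_with ltac:(by field).
rewrite normrZ normfV mulrC ler_pdivrMr ?normr_gt0 //.
apply: Hd.
- by rewrite distrC; near: s; apply: cvgr_dist_lt.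
- by rewrite distrC; near: s; apply: cvgr_dist_lt.
- by near: s; apply: (@cvgr0_norm_lt R R^o).
Unshelve. all: by end_near. Qed.

Lemma dnbhs0_neq0 : \forall t \near (0 : R)^', t != 0.
Proof. exact: nbhs_dnbhs_neq. Qed.

Lemma dnbhs0_cvg0 : (fun t : R => t) @ (0 : R)^' --> (0 : R).
Proof. by apply: cvg_within_filter; exact: cvg_id. Qed.

(** For additivity, the increment along [t *: (h + k)] is split at the point [t *: k + y];
    strictness copes with the moving base point of the first piece. *)
Lemma C1_derive_linear y (a : R) h k : U y ->
  'D_(a *: h + k) f y = a *: 'D_h f y + 'D_k f y.
Proof.
move=> Uy; rewrite -deriveZdir; last exact: Cr_derivable fC1 Uy.
set h' := a *: h.
have tk : (fun t : R => t *: k + y) @ (0 : R)^' --> y.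
  rewrite -[X in _ --> X]add0r -[X in _ --> X + _](scale0r k).
  apply: cvgD; last exact: cvg_cst.
  by apply: cvgZr_tmp; exact: dnbhs0_cvg0.
have H1 : (fun t : R => t^-1 *: (f (t *: h' + (t *: k + y)) - f (t *: k + y)))
    @ (0 : R)^' --> 'D_h' f y.
  by apply: C1_cvg tk (cvg_cst _) dnbhs0_cvg0 dnbhs0_neq0.
have /is_deriveP H2 := Cr_is_derive k fC1 Uy.
have H3 : (fun t : R => t^-1 *: (f (t *: h' + (t *: k + y)) - f (t *: k + y)) +
    t^-1 *: (f (t *: k + y) - f y)) @ (0 : R)^' --> 'D_h' f y + 'D_k f y.
  exact: cvgD.
have [_ //] : is_derive y (h' + k) f ('D_h' f y + 'D_k f y).
apply/is_deriveP; apply: cvg_trans H3.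
apply: near_eq_cvg; near=> t.
rewrite -scalerDr; congr (_ *: _).
by rewrite addrA subrK scalerDr addrA.
Unshelve. all: by end_near. Qed.

(** The difference quotient of [g] is itself a direction converging to [l], and the increment of
    [f \o g] is exactly the increment of [f] along it. *)
Lemma C1_chain (Z : normedModType R) (g : Z -> X) z k l : U (g z) ->
  is_derive z k g l -> is_derive z k (f \o g) ('D_l f (g z)).
Proof.
move=> Ugz /is_deriveP gd; apply/is_deriveP.
have H : (fun t : R => t^-1 *: (f (t *: (t^-1 *: (g (t *: k + z) - g z)) + g z)
    - f (g z))) @ (0 : R)^' --> 'D_l f (g z).
  by apply: C1_cvg (cvg_cst _) gd dnbhs0_cvg0 dnbhs0_neq0.
apply: cvg_trans H; apply: near_eq_cvg; near=> t.
have t0 : t != 0 by near: t; exact: dnbhs0_neq0.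
congr (_ *: (f _ - _)).
by lmod_with ltac:(by field).
Unshelve. all: by end_near. Qed.

(** Continuity of the total derivative at [(y0, 0)], where it vanishes, gives by homogeneity a bound
    on ['D_h f x] linear in the norm of [h] and uniform in [x] near [y0]. *)
Lemma C1_lipschitz y0 : U y0 -> exists2 d : R, 0 < d & exists C : R,
  [/\ 0 <= C, forall y, `|y - y0| < d -> U y &
   forall y y', `|y - y0| < d -> `|y' - y0| < d -> `|f y - f y'| <= C * `|y - y'|].
Proof.
move=> Uy0.
have [d1 d10 H1] := continuous_for_delta2 (@D_continuous y0 0 Uy0) ltr01.
have [d2 d20 H2] := open_delta oU Uy0.
have d0 : 0 < Num.min d1 d2 by rewrite lt_min d10.
exists (Num.min d1 d2) => //; exists (2 * 1 / d1); split.
- by rewrite divr_ge0 // ltW.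
- by move=> y; rewrite lt_min => /andP[_ /H2].
move=> y y' yd y'd.
have DC x h : `|x - y0| < Num.min d1 d2 -> `|'D_h f x| <= 2 * 1 / d1 * `|h|.
  rewrite lt_min => /andP[x1 /H2 Ux].
  apply: (@homogeneous_bound R X Y (fun h => 'D_h f x) 1 d1) => // [a k|k kd].
    by rewrite deriveZdir //; exact: Cr_derivable fC1 Ux.
  have := H1 x k x1; rewrite subr0 => /(_ kd) /=.
  by rewrite derive0 subr0 => /ltW.
apply: (@mean_value_ball R X Y f (fun x => 'D_(y - y') f x)) => s s01.
  apply: Cr_is_derive fC1 _.
  by have := segment_near s01 y'd yd; rewrite lt_min => /andP[_ /H2].
by apply: DC; exact: segment_near.
Qed.

End C1.

(** * Linear maps, pairs, composites and sums of C^r maps *)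

Section CrComp.
Variable R : realType.
Implicit Types (r s : nat) (X Y Z : normedModType R).

(** The total derivative of [L] is [L \o snd], again linear and continuous but on the product space;
    hence an induction over all spaces at once. *)
Lemma Cr_linear r X Y (U : set X) (L : {linear X -> Y}) :
  continuous L -> Cr r U L.
Proof.
elim: r X U L => [|r IH] X U L Lc; first by split=> // x _; exact: Lc.
have Ld x h : is_derive x h L (L h).
  apply: near_is_derive => e e0; near=> t.
  by rewrite linearD linearZ addrK subrr normr0 mulr_ge0 // ltW.
split; first by move=> x _; exact: Lc.
split; first by move=> x h _; have [] := Ld x h.
have -> : (fun p : X * X => 'D_(p.2) L p.1) = (L \o snd : X * X -> Y).
  by apply/funext => p; have [_] := Ld p.1 p.2.
refine (IH (X * X)%type (U `*` setT) (L \o snd : {linear (X * X)%type -> Y}) _) => p.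
by apply: continuous_comp; [exact: cvg_snd|exact: Lc].
Unshelve. all: by end_near. Qed.

Lemma Cr_id r X (U : set X) : Cr r U (fun x : X => x).
Proof.
by apply: (@Cr_linear r X X U (@idfun X : {linear X -> X})) => p; exact: cvg_id.
Qed.

Lemma is_derive_pair X Y Z (f : X -> Y) (g : X -> Z) x h l m :
  is_derive x h f l -> is_derive x h g m ->
  is_derive x h (fun x => (f x, g x)) (l, m).
Proof.
move=> /is_deriveP fd /is_deriveP gd; apply/is_deriveP.
exact: cvg_pair fd gd.
Qed.

Lemma Cr_pair r X Y Z (U : set X) (f : X -> Y) (g : X -> Z) :
  open U -> Cr r U f -> Cr r U g -> Cr r U (fun x => (f x, g x)).
Proof.
elim: r X U f g => [|r IH] X U f g oU fC gC.
  by split=> // x Ux; apply: cvg_pair; [exact: Cr_continuous fC Ux|exact: Cr_continuous gC Ux].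
have D x h : U x -> is_derive x h (fun x => (f x, g x)) ('D_h f x, 'D_h g x).
  by move=> Ux; apply: is_derive_pair; [exact: Cr_is_derive fC Ux|exact: Cr_is_derive gC Ux].
split.
  by move=> x Ux; apply: cvg_pair; [exact: Cr_continuous fC Ux|exact: Cr_continuous gC Ux].
split; first by move=> x h /(D x h)[].
have oU' := setXT_open (X' := X) oU.
apply: eq_Cr (IH _ _ _ _ oU' (Cr_derive fC) (Cr_derive gC)) => //.
by move=> [x h] [/= Ux _]; have [_ ->] := D x h Ux.
Qed.

(** The total derivative of [f \o g] is the total derivative of [f] after
    [p |-> (g p.1, 'D_(p.2) g p.1)], a composite of maps of one order less. The induction hypothesis
    also covers the first component [g \o fst]. *)
Lemma Cr_comp r X Y Z (U : set X) (W : set Y) (f : Y -> Z) (g : X -> Y) :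
  open U -> open W -> (forall x, U x -> W (g x)) ->
  Cr r W f -> Cr r U g -> Cr r U (f \o g).
Proof.
elim: r X Y Z U W f g => [|r IH] X Y Z U W f g oU oW UW fC gC.
  split=> // x Ux; apply: continuous_comp; first exact: Cr_continuous gC Ux.
  by apply: Cr_continuous fC _; exact: UW.
have D x h : U x -> is_derive x h (f \o g) ('D_('D_h g x) f (g x)).
  move=> Ux; apply: (C1_chain oW) => //; first by apply: Cr_le fC.
    exact: UW.
  exact: Cr_is_derive gC Ux.
split.
  move=> x Ux; apply: continuous_comp; first exact: Cr_continuous gC Ux.
  by apply: Cr_continuous fC _; exact: UW.
split; first by move=> x h /(D x h)[].
have oU' := setXT_open (X' := X) oU.
have oW' := setXT_open (X' := Y) oW.
have gC' : Cr r (U `*` setT) (fun p : X * X => (g p.1, 'D_(p.2) g p.1)).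
  apply: Cr_pair => //; last exact: Cr_derive gC.
  apply: (IH _ _ _ _ U g fst) => //; [by move=> p []|exact: CrW|].
  by apply: Cr_linear => p; exact: cvg_fst.
apply: eq_Cr (IH _ _ _ _ _ _ _ oU' oW' _ (Cr_derive fC) gC') => //.
  by move=> [x h] [/= Ux _]; have [_ ->] := D x h Ux.
by move=> [x h] [/= Ux _]; split=> //; exact: UW.
Qed.

Lemma Cr_add r X Y (U : set X) (f g : X -> Y) :
  open U -> Cr r U f -> Cr r U g -> Cr r U (fun x => f x + g x).
Proof.
elim: r X U f g => [|r IH] X U f g oU fC gC.
  by split=> // x Ux; apply: cvgD; [exact: Cr_continuous fC Ux|exact: Cr_continuous gC Ux].
have D x h : U x -> is_derive x h (fun x => f x + g x) ('D_h f x + 'D_h g x).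
  by move=> Ux; apply: is_deriveD; [exact: Cr_is_derive fC Ux|exact: Cr_is_derive gC Ux].
split.
  by move=> x Ux; apply: cvgD; [exact: Cr_continuous fC Ux|exact: Cr_continuous gC Ux].
split; first by move=> x h /(D x h)[].
have oU' := setXT_open (X' := X) oU.
apply: eq_Cr (IH _ _ _ _ oU' (Cr_derive fC) (Cr_derive gC)) => //.
by move=> [x h] [/= Ux _]; have [_ ->] := D x h Ux.
Qed.

End CrComp.

Fixpoint all_prop (A : Type) (P : A -> Prop) (s : seq A) : Prop :=
  if s is x :: s' then P x /\ all_prop P s' else True.

Lemma all_prop_cat (A : Type) (P : A -> Prop) s1 s2 :
  all_prop P (s1 ++ s2) <-> all_prop P s1 /\ all_prop P s2.
Proof.
elim: s1 => [|x s IH] /=; first by split=> // -[].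
by rewrite IH; split=> [[? []]|[[]]].
Qed.

Lemma all_prop_impl (A : Type) (P Q : A -> Prop) s :
  (forall x, P x -> Q x) -> all_prop P s -> all_prop Q s.
Proof. by move=> PQ; elim: s => //= x s IH [/PQ ? /IH]. Qed.

Lemma all_prop_map (A B : Type) (f : A -> B) (P : B -> Prop) s :
  all_prop P (map f s) <-> all_prop (P \o f) s.
Proof. by elim: s => //= x s IH; rewrite IH. Qed.

Lemma all_prop_forall (A : Type) (P : A -> Prop) s :
  (forall x, P x) -> all_prop P s.
Proof. by move=> H; elim: s => //= x s IH. Qed.

(** * Leibniz rule and regularity for families of multilinear maps *)

Section MultilinearFamily.
Variables (R : realType) (X E Y : normedModType R).
(* Applied to [Phi x hs = d^j f (x) (hs)] with [L (x, u) = u], and to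
   [Phi q zs = pi (psi q) (dpi z_1 (... (dpi z_n v)))], where [L (q, u)] is the
   left translate to 1 of the tangent vector [u] at [q]. *)
Variables (Phi : X -> seq E -> Y) (O : set X) (k : nat) (L : X * X -> E).

Hypothesis O_open : open O.
(** Joint continuity in the base point and the slots, phrased through maps from a parameter space in
    place of a topology on [seq E]. *)
Hypothesis Phi_continuous : forall (T : topologicalType) (a : T -> X)
  (ss : seq (T -> E)) (t : T), O (a t) -> (size ss <= k)%N ->
  {for t, continuous a} -> all_prop (fun s => {for t, continuous s}) ss ->
  {for t, continuous (fun t => Phi (a t) [seq s t | s <- ss])}.
Hypothesis Phi_linear : forall x l1 l2 (b : R) z w, O x ->
  (size l1 + size l2 < k)%N ->
  Phi x (l1 ++ (b *: z + w) :: l2) =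
  b *: Phi x (l1 ++ z :: l2) + Phi x (l1 ++ w :: l2).
Hypothesis Phi_derive : forall x u zs, O x -> (size zs < k)%N ->
  is_derive x u (Phi^~ zs) (Phi x (L (x, u) :: zs)).
Hypothesis L_Cr : forall r, Cr r (O `*` setT) L.

Let Phi_linearB x l1 l2 (b : R) z w : O x -> (size l1 + size l2 < k)%N ->
  Phi x (l1 ++ (b *: (z - w)) :: l2) =
  b *: (Phi x (l1 ++ z :: l2) - Phi x (l1 ++ w :: l2)).
Proof.
move=> Ox szk; pose P v := Phi x (l1 ++ v :: l2).
have PL c u v : P (c *: u + v) = c *: P u + P v by exact: Phi_linear.
have P0 : P 0 = 0.
  by apply: (addrI (P 0)); rewrite -{1}(scale1r (P 0)) -PL scaler0 !addr0.
rewrite -/(P _) -/(P z) -/(P w).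
have -> : b *: (z - w) = b *: z + ((- b) *: w + 0) by lmod.
by rewrite !PL P0; lmod.
Qed.

Lemma family_C1 zs : (size zs < k)%N -> Cr 1 O (Phi^~ zs).
Proof.
move=> zsk; split.
  move=> x Ox; have := @Phi_continuous X id [seq fun=> z | z <- zs] x Ox.
  rewrite size_map => /(_ (ltnW zsk) (@cvg_id _ _)).
  rewrite all_prop_map => /(_ _)-H.
  have -> : (Phi^~ zs) = fun t => Phi t [seq s t | s <- [seq fun=> z | z <- zs]].
    by apply/funext => t; rewrite -map_comp map_id_in.
  by apply: H; apply: all_prop_forall => z /=; exact: cvg_cst.
split; first by move=> x h Ox; have [] := @Phi_derive x h zs Ox zsk.
split=> // -[x u] [/= Ox _].
pose ss := L :: [seq (fun=> z) : X * X -> E | z <- zs].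
apply: (@near_eq_continuous (X * X)%type Y
  (fun p => Phi p.1 [seq s p | s <- ss])); last first.
  apply: Phi_continuous => //=; first by rewrite size_map.
    exact: cvg_fst.
  split; first exact: Cr_continuous (L_Cr 0) _.
  by rewrite all_prop_map; apply: all_prop_forall => z /=; exact: cvg_cst.
apply: (@open_near_eq _ _ (O `*` setT)) => //; first exact: setXT_open.
move=> [x' u'] [/= Ox' _]; have [_ ->] := Phi_derive u' Ox' zsk.
by rewrite -map_comp map_id_in.
Qed.

Section Slots.
Variables (Z : normedModType R) (W : set Z).
Variables (a : Z -> X).

(** The Leibniz sum: one summand for each slot of [rest], with this slot differentiated; [pre] holds
    the slots already passed. *)
Fixpoint slot_sum (p : Z * Z) (pre rest : seq (Z -> E)) : Y :=
  if rest is s :: r then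
    Phi (a p.1) ([seq f p.1 | f <- pre] ++ 'D_(p.2) s p.1 :: [seq f p.1 | f <- r])
    + slot_sum p (rcons pre s) r
  else 0.

Lemma line_continuous (z h : Z) : {for 0, continuous (fun t : R => t *: h + z)}.
Proof.
by apply: cvgD; [apply: cvgZr_tmp; exact: cvg_id|exact: cvg_cst].
Qed.

Lemma comp_line_continuous (V : topologicalType) (f : Z -> V) (z h : Z) :
  {for z, continuous f} -> {for 0, continuous (fun t : R => f (t *: h + z))}.
Proof.
move=> fc; apply: (@continuous_comp _ _ _ (fun t : R => t *: h + z) f).
  exact: line_continuous.
by rewrite scale0r add0r.
Qed.

(** Telescoping over the slots, those in [pre] having moved already. All terms are taken at the
    moved base point, so [a] contributes only its continuity. *)
Lemma is_derive_slots pre rest z h :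
  O (a z) -> (size pre + size rest <= k)%N ->
  {for z, continuous a} -> all_prop (fun s => {for z, continuous s}) pre ->
  all_prop (fun s : Z -> E => derivable s z h /\ {for z, continuous s}) rest ->
  (fun t : R => t^-1 *:
     (Phi (a (t *: h + z)) ([seq s (t *: h + z) | s <- pre] ++
                            [seq s (t *: h + z) | s <- rest]) -
      Phi (a (t *: h + z)) ([seq s (t *: h + z) | s <- pre] ++
                            [seq s z | s <- rest]))) @ (0 : R)^' -->
  slot_sum (z, h) pre rest.
Proof.
move=> Oaz + ac; elim: rest pre => [|s r IH] pre /= szk pre_c.
  move=> _; apply: cvg_near_cst; near=> t.
  by rewrite subrr scaler0.
move=> [[sd sc] rd].
(* Completed by its limit at [t = 0], the difference quotient of [s] is a continuous slot, so
   continuity of [Phi] yields the limit of this summand. *)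
pose q (t : R) := if t == 0 then 'D_h s z else t^-1 *: (s (t *: h + z) - s z).
have qc : {for 0, continuous q}.
  rewrite /prop_for /continuous_at {2}/q eqxx.
  apply/cvgrPdist_le => e e0.
  have /derivableP/is_deriveP/cvgrPdist_le/(_ _ e0)/nbhs_ballP[d /= d0 Hd] := sd.
  apply/nbhs_ballP; exists d => //= t td; rewrite /q.
  case: eqVneq => [_|t0]; first by rewrite subrr normr0 ltW.
  exact: Hd.
have IH' := IH (rcons pre s); rewrite size_rcons addSnnS in IH'.
have {}IH' := IH' szk; rewrite -cats1 all_prop_cat /= in IH'.
have {IH'}H1 := IH' (conj pre_c (conj sc I)) rd.
have H2 : (fun t : R => Phi (a (t *: h + z))
    ([seq f (t *: h + z) | f <- pre] ++ q t :: [seq f z | f <- r])) @ (0 : R)^'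
    --> Phi (a z) ([seq f z | f <- pre] ++ 'D_h s z :: [seq f z | f <- r]).
  apply: cvg_within_filter.
  pose ss := [seq (fun t : R => f (t *: h + z)) | f <- pre] ++
    q :: [seq (fun=> f z) | f <- r].
  have := @Phi_continuous R (fun t : R => a (t *: h + z)) ss 0.
  rewrite scale0r add0r size_cat /= !size_map => /(_ Oaz szk).
  move=> /(_ (@comp_line_continuous _ _ z h ac)).
  rewrite /ss all_prop_cat /= !all_prop_map.
  have c1 : all_prop ((fun s0 : R -> E => {for 0, continuous s0}) \o
     (fun (f : Z -> E) (t : R) => f (t *: h + z))) pre.
    by apply: all_prop_impl pre_c => f fc; exact: comp_line_continuous.
  have c2 : all_prop ((fun s0 : R -> E => {for 0, continuous s0}) \o
     (fun (f : Z -> E) (_ : R) => f z)) r.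
    by apply: all_prop_forall => f /=; exact: cvg_cst.
  move=> /(_ (conj c1 (conj qc c2))).
  rewrite /prop_for /continuous_at map_cat /= -!map_comp scale0r add0r.
  rewrite {2}/q eqxx.
  rewrite (_ : map _ pre = [seq f z | f <- pre]); last first.
    by apply: eq_map => f /=; rewrite scale0r add0r.
  move=> H; apply: cvg_trans H; apply: near_eq_cvg; near=> t.
  by rewrite map_cat /= -!map_comp.
have Oat : \forall t \near (0 : R)^', O (a (t *: h + z)).
  apply: cvg_within_filter (@comp_line_continuous _ _ z h ac) _ _.
  by rewrite scale0r add0r; exact: open_nbhs_nbhs.
have H3 : (fun t : R => Phi (a (t *: h + z))
      ([seq f (t *: h + z) | f <- pre] ++ q t :: [seq f z | f <- r]) +
    t^-1 *: (Phi (a (t *: h + z)) ([seq f (t *: h + z) | f <- pre ++ [:: s]] ++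
                            [seq f (t *: h + z) | f <- r]) -
      Phi (a (t *: h + z)) ([seq f (t *: h + z) | f <- pre ++ [:: s]] ++
                            [seq f z | f <- r]))) @ (0 : R)^' -->
  slot_sum (z, h) pre (s :: r).
  by rewrite /= -cats1; exact: cvgD.
apply: cvg_trans H3; apply: near_eq_cvg; near=> t.
have t0 : t != 0 by near: t; exact: dnbhs0_neq0.
have Oth : O (a (t *: h + z)) by near: t; exact: Oat.
rewrite /q (negPf t0) Phi_linearB //; last by rewrite !size_map -addnS.
rewrite cats1 !map_rcons !cat_rcons.
by rewrite -scalerDr addrC subrKA.
Unshelve. all: by end_near. Qed.

End Slots.

(** The increment splits in two: the base point moves while the slots are frozen, which is the chain
    rule with [family_C1]; then the slots move at the moved base point, which is
    [is_derive_slots]. *)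
Lemma is_derive_family (Z : normedModType R) (a : Z -> X) (ss : seq (Z -> E))
    (W : set Z) z h : open W -> W z -> (forall z, W z -> O (a z)) ->
  Cr 1 W a -> all_prop (Cr 1 W) ss -> (size ss < k)%N ->
  is_derive z h (fun z => Phi (a z) [seq s z | s <- ss])
    (Phi (a z) (L (a z, 'D_h a z) :: [seq s z | s <- ss]) +
     slot_sum a (z, h) [::] ss).
Proof.
move=> oW Wz WO aC ssC szk; apply/is_deriveP.
have Oaz := WO z Wz.
have ac := Cr_continuous aC Wz.
have szk' : (size [seq s z | s <- ss] < k)%N by rewrite size_map.
have /is_deriveP H1 := C1_chain O_open (family_C1 szk') Oaz (Cr_is_derive h aC Wz).
have [_ D] := Phi_derive ('D_h a z) Oaz szk'.
rewrite D in H1.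
have ss' : all_prop (fun s : Z -> E => derivable s z h /\ {for z, continuous s}) ss.
  apply: all_prop_impl ssC => s sC; split; first exact: Cr_derivable sC Wz.
  exact: Cr_continuous sC Wz.
have H2 := @is_derive_slots Z a [::] ss z h Oaz (ltnW szk) ac I ss'.
have H3 : (fun t : R =>
    t^-1 *: (Phi (a (t *: h + z)) [seq s z | s <- ss] -
             Phi (a z) [seq s z | s <- ss]) +
    t^-1 *: (Phi (a (t *: h + z)) [seq s (t *: h + z) | s <- ss] -
             Phi (a (t *: h + z)) [seq s z | s <- ss])) @ (0 : R)^' -->
    Phi (a z) (L (a z, 'D_h a z) :: [seq s z | s <- ss]) + slot_sum a (z, h) [::] ss.
  exact: cvgD.
apply: cvg_trans H3; apply: near_eq_cvg; near=> t.
by rewrite -scalerDr addrC subrKA.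
Unshelve. all: by end_near. Qed.

(** The total derivative is a sum of expressions of the same kind over [Z * Z]. One has an
    additional slot, built from [L]; the others keep the number of slots. All ingredients lose one
    order of differentiability, so [r + size ss <= k] persists. *)
Theorem multilinear_family_Cr r (Z : normedModType R) (W : set Z)
    (a : Z -> X) (ss : seq (Z -> E)) :
  open W -> (forall z, W z -> O (a z)) -> Cr r W a -> all_prop (Cr r W) ss ->
  (r + size ss <= k)%N ->
  Cr r W (fun z => Phi (a z) [seq s z | s <- ss]).
Proof.
elim: r Z W a ss => [|r IH] Z W a ss oW WO aC ssC szk.
  split=> // z Wz; apply: Phi_continuous => //; first exact: WO.
    exact: Cr_continuous aC Wz.
  by apply: all_prop_impl ssC => s sC; exact: Cr_continuous sC Wz.
have D z h : W z -> is_derive z h (fun z => Phi (a z) [seq s z | s <- ss])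
    (Phi (a z) (L (a z, 'D_h a z) :: [seq s z | s <- ss]) +
     slot_sum a (z, h) [::] ss).
  move=> Wz; apply: (@is_derive_family _ _ _ W) => //; first exact: Cr_le aC.
    by apply: all_prop_impl ssC => s; exact: Cr_le.
  by rewrite (leq_trans _ szk) // addSn ltnS leq_addl.
split.
  move=> z Wz; apply: Phi_continuous => //; first exact: WO.
  - by rewrite (leq_trans _ szk) // leq_addl.
  - exact: Cr_continuous aC Wz.
  - by apply: all_prop_impl ssC => s sC; exact: Cr_continuous sC Wz.
split; first by move=> z h /(D z h)[].
have oW' := setXT_open (X' := Z) oW.
have fstC (V : normedModType R) (f : Z -> V) :
    Cr r.+1 W f -> Cr r (W `*` setT) (f \o (fst : Z * Z -> Z)).
  move=> /CrW fC; apply: (@Cr_comp _ _ _ _ _ _ W) => //; first by move=> p [].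
  by apply: Cr_linear => p; exact: cvg_fst.
have aC' := fstC _ _ aC.
pose G (p : Z * Z) := Phi (a p.1) (L (a p.1, 'D_(p.2) a p.1) :: [seq s p.1 | s <- ss])
  + slot_sum a p [::] ss.
apply: (@eq_Cr _ _ r _ _ G) => //.
  by move=> [z h] [/= Wz _]; have [_ ->] := D z h Wz.
apply: Cr_add => //.
  pose ss' := (fun p : Z * Z => L (a p.1, 'D_(p.2) a p.1)) ::
    [seq s \o (fst : Z * Z -> Z) | s <- ss].
  rewrite (_ : (fun p => _) = fun p => Phi (a p.1) [seq s p | s <- ss']); last first.
    by apply/funext => p; rewrite /= -map_comp.
  apply: (IH _ _ (a \o fst)) => //=.
  - by move=> p [/WO].
  - split; last first.
      by rewrite all_prop_map; apply: all_prop_impl ssC => s sC; exact: fstC.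
    apply: (@Cr_comp _ _ _ _ _ _ (O `*` setT) L) => //.
    + exact: setXT_open.
    + by move=> p [/WO Oap _]; split.
    + by apply: Cr_pair => //; exact: Cr_derive.
  - by rewrite size_map -addSnnS.
(* The Leibniz sum is treated by induction on the remaining slots, for an arbitrary list of slots
   already passed. *)
have : all_prop (Cr r.+1 W) ([::] : seq (Z -> E)) by [].
have : (r.+1 + (size ([::] : seq (Z -> E)) + size ss) <= k)%N by [].
elim: ss [::] ssC {szk D G} => [|s rest IHs] pre ssC szk preC /=; first exact: Cr_cst.
case: ssC => sC restC.
apply: Cr_add => //; last first.
  apply: IHs => //; first by rewrite size_rcons (addSnnS (size pre)).
  by rewrite -cats1 all_prop_cat.
pose ss' := [seq f \o (fst : Z * Z -> Z) | f <- pre] ++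
  (fun p : Z * Z => 'D_(p.2) s p.1) :: [seq f \o (fst : Z * Z -> Z) | f <- rest].
rewrite (_ : (fun p => _) = fun p => Phi (a p.1) [seq f p | f <- ss']); last first.
  by apply/funext => p; rewrite map_cat /= -!map_comp.
apply: (IH _ _ (a \o fst)) => //=.
- by move=> p [/WO].
- rewrite all_prop_cat /= !all_prop_map; split.
    by apply: all_prop_impl preC => f; exact: fstC.
  split; first exact: Cr_derive.
  by apply: all_prop_impl restC => f; exact: fstC.
- by rewrite size_cat /= !size_map (leq_trans _ szk) // leq_add2r leqnSn.
Qed.

End MultilinearFamily.

(** * Equivalence of the two descriptions of C^k maps *)

Section CkCr.
Variables (R : realType) (E : normedModType R).

Lemma ptws_continuous (I : Type) (T : topologicalType) (g : T -> {ptws I -> E}) t :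
  (forall i, {for t, continuous (fun t => g t i)}) -> {for t, continuous g}.
Proof.
move=> gc; apply/cvg_sup => i.
rewrite cvg_image; last by rewrite eqEsubset; split=> v // _; exists (cst v).
move=> W /= /(gc i) gW; exists (@^~ i @^-1` W) => //.
by rewrite eqEsubset; split => [j [? + <-//]|j Wj]; exists (fun _ => j).
Qed.

Lemma iter_derive_rcons (Y : normedModType R) (f : E -> Y) hs h :
  iter_derive f (rcons hs h) = (fun x => 'D_h (iter_derive f hs) x).
Proof. by elim: hs f => //= h' hs IH f; rewrite IH. Qed.

Lemma iter_derive_cat (Y : normedModType R) (f : E -> Y) hs1 hs2 :
  iter_derive f (hs1 ++ hs2) = iter_derive (iter_derive f hs1) hs2.
Proof. by elim: hs1 f => //=. Qed.

Section CkOnCr.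
Variables (Y : normedModType R) (k : nat) (U : set E) (f : E -> Y).
Hypotheses (oU : open U) (fk : Ck_on k U f).

(** Reversed because the family theorem puts the newest direction first, whereas [iter_derive]
    differentiates last along the end of its list. *)
Let Phi (x : E) (hs : seq E) : Y := iter_derive f (rev hs) x.

Let Phi_continuous (T : topologicalType) (a : T -> E) (ss : seq (T -> E)) (t : T) :
  U (a t) -> (size ss <= k)%N -> {for t, continuous a} ->
  all_prop (fun s => {for t, continuous s}) ss ->
  {for t, continuous (fun t => Phi (a t) [seq s t | s <- ss])}.
Proof.
move=> Uat sk ac ssc.
pose g2 (t : T) : {ptws 'I_(size ss) -> E} :=
  fun i : 'I_(size ss) => nth (fun=> 0) (rev ss) i t.
pose g (t : T) : E * {ptws 'I_(size ss) -> E} := (a t, g2 t).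
have gc : {for t, continuous g}.
  suff g2c : {for t, continuous g2} by exact: cvg_pair ac g2c.
  apply: ptws_continuous => i.
  have nthc (l : seq (T -> E)) n : all_prop (fun s => {for t, continuous s}) l ->
      {for t, continuous (fun t => nth (fun=> 0) l n t)}.
    elim: l n => [|s l IH] [|n] /=; do ?by move=> _; exact: cvg_cst.
      by case.
    by move=> [_ /IH]; apply.
  apply: nthc; elim: ss ssc {sk g g2 i} => //= s l IH [sc /IH ?].
  by rewrite rev_cons -cats1 all_prop_cat.
have [_ /(_ _ sk (g t) Uat)] := fk.
move=> H.
rewrite (_ : (fun t => _) = (fun q : E * {ptws 'I_(size ss) -> E} =>
   iter_derive f [seq q.2 i | i <- enum 'I_(size ss)] q.1) \o g).
  exact: continuous_comp gc H.
apply/funext => t'; rewrite /g /g2 /Phi /=; congr (iter_derive _ _ _).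
rewrite -map_rev -[in LHS](mkseq_nth (fun=> 0) (rev ss)) -map_comp size_rev.
by rewrite /mkseq -val_enum_ord -!map_comp.
Qed.

Let Phi_derive x u zs : U x -> (size zs < k)%N ->
  is_derive x u (Phi^~ zs) (Phi x (u :: zs)).
Proof.
move=> Ux zk; rewrite /Phi rev_cons iter_derive_rcons; apply/derivableP.
by have [+ _] := fk; apply; rewrite ?size_rev.
Qed.

Let snd_Cr r : Cr r (U `*` setT) (snd : E * E -> E).
Proof. by apply: Cr_linear => p; exact: cvg_snd. Qed.

(** Differentiation runs along [l2], then along the slot in question, then along [l1]. After [l2]
    the map is still C^1, hence its derivative is linear in the direction; this identity holds on
    the open set [U] and may be differentiated along [l1]. *)
Let Phi_linear x l1 l2 (b : R) z w : U x -> (size l1 + size l2 < k)%N ->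
  Phi x (l1 ++ (b *: z + w) :: l2) =
  b *: Phi x (l1 ++ z :: l2) + Phi x (l1 ++ w :: l2).
Proof.
rewrite /Phi => Ux.
have E3 v : iter_derive f (rev (l1 ++ v :: l2)) =
    iter_derive (fun x => 'D_v (iter_derive f (rev l2)) x) (rev l1).
  by rewrite rev_cat rev_cons cat_rcons iter_derive_cat.
rewrite !E3 addnC => szk.
have l2k : (size l2 < k)%N by rewrite (leq_trans _ szk) // ltnS leq_addr.
have C1 := family_C1 oU Phi_continuous Phi_derive snd_Cr l2k.
pose g v x := 'D_v (iter_derive f (rev l2)) x.
have gl y : U y -> g (b *: z + w) y = b *: g z y + g w y.
  by move=> Uy; exact: (@C1_derive_linear _ _ _ _ _ oU C1 y b z w Uy).
have gd v hs y h : U y -> ((size l2 + size hs).+1 < k)%N ->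
  derivable (iter_derive (g v) hs) y h.
  move=> Uy hk; have [+ _] := fk => /(_ (rcons (rev l2) v ++ hs) h y).
  rewrite iter_derive_cat iter_derive_rcons; apply => //.
  by rewrite size_cat size_rcons size_rev.
rewrite -/(g _).
have : forall hs y, U y -> (size l2 + size hs < k)%N ->
    iter_derive (g (b *: z + w)) hs y =
    b *: iter_derive (g z) hs y + iter_derive (g w) hs y.
  elim/last_ind => [|hs h IH] y Uy; first by move=> _; exact: gl.
  rewrite size_rcons addnS => hk; rewrite !iter_derive_rcons.
  have D : is_derive y h (fun y => b *: iter_derive (g z) hs y + iter_derive (g w) hs y)
      (b *: 'D_h (iter_derive (g z) hs) y + 'D_h (iter_derive (g w) hs) y).
    apply: is_deriveD.
      by apply: is_deriveZ; apply/derivableP; exact: gd.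
    by apply/derivableP; exact: gd.
  suff fg : forall y', U y' -> b *: iter_derive (g z) hs y' +
      iter_derive (g w) hs y' = iter_derive (g (b *: z + w)) hs y'.
    by have [_] := is_derive_eq_open oU Uy fg D.
  by move=> y' Uy'; rewrite IH // ltnW.
by apply => //; rewrite size_rev.
Qed.

(** The family theorem with no slots, the identity as base point and [L = snd]. *)
Lemma Ck_on_Cr : Cr k U f.
Proof.
have := @multilinear_family_Cr R E E Y Phi U k snd oU Phi_continuous Phi_linear
  Phi_derive snd_Cr k E U id [::] oU (fun z Uz => Uz).
by apply; rewrite ?addn0 //; exact: Cr_id.
Qed.

End CkOnCr.
End CkCr.

Section CrCk.
Variables (R : realType) (Y : normedModType R).

Lemma shift_slice (E : normedModType R) (x u h : E) (t : R) :
  t *: (u, 0) + (x, h) = (t *: u + x, h) :> E * E.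
Proof. by congr pair => /=; rewrite scaler0 add0r. Qed.

(** The difference quotients coincide. With the total derivative as [G] and a frozen direction [h],
    iterated derivatives of [f] starting along [h] become derivatives of [G] in the directions
    [(u, 0)], which the recursion of [Cr] controls. *)
Lemma iter_derive_slice (E : normedModType R) (G : E * E -> Y) h hs x :
  iter_derive (fun x => G (x, h)) hs x =
  iter_derive G [seq (u, 0) | u <- hs] (x, h).
Proof.
elim/last_ind: hs x => //= hs u IH x.
rewrite map_rcons !iter_derive_rcons /derive.
apply: (congr1 (fun g : R -> Y => lim (g @ (0 : R)^'))); apply/funext => t.
by rewrite /= !IH shift_slice.
Qed.

Lemma Cr_iter_derivable k (E : normedModType R) (U : set E) (f : E -> Y) hs h x :
  Cr k U f -> (size hs < k)%N -> U x -> derivable (iter_derive f hs) x h.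
Proof.
elim: k E U f hs h x => // k IH E U f [|u hs] h x fC /=.
  by move=> _ Ux; exact: Cr_derivable fC Ux.
rewrite ltnS => hk Ux.
rewrite (_ : iter_derive _ _ = fun x =>
    iter_derive (fun p => 'D_(p.2) f p.1) [seq (u, 0) | u <- hs] (x, u)); last first.
  by apply/funext => y; rewrite -iter_derive_slice.
have := IH _ _ _ [seq (u, 0) | u <- hs] (h, 0) (x, u) (Cr_derive fC).
rewrite size_map => /(_ hk) H.
have {H} := H (conj Ux I); rewrite /derivable => H.
rewrite (_ : (fun t : R => _) = (fun t : R => t^-1 *: (
  (iter_derive (fun p : E * E => 'D_(p.2) f p.1) [seq (u, 0) | u <- hs] \o
     shift (x, u)) (t *: (h, 0)) -
  iter_derive (fun p : E * E => 'D_(p.2) f p.1) [seq (u, 0) | u <- hs] (x, u)))) //.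
by apply/funext => t; rewrite /= shift_slice.
Qed.

Lemma Cr_iter_continuous k (E : normedModType R) (U : set E) (f : E -> Y)
    (T : topologicalType) (a : T -> E) (ss : seq (T -> E)) (t : T) :
  Cr k U f -> (size ss <= k)%N -> U (a t) -> {for t, continuous a} ->
  all_prop (fun s => {for t, continuous s}) ss ->
  {for t, continuous (fun t => iter_derive f [seq s t | s <- ss] (a t))}.
Proof.
elim: k E U f a ss => [|k IH] E U f a [|s ss] fC //=.
- move=> _ Uat ac _; apply: (@continuous_comp _ _ _ a f) => //.
  exact: Cr_continuous fC Uat.
- move=> _ Uat ac _; apply: (@continuous_comp _ _ _ a f) => //.
  exact: Cr_continuous fC Uat.
rewrite ltnS => sk Uat ac [sc ssc].
pose G (p : E * E) := 'D_(p.2) f p.1.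
pose ss' := [seq (fun t => (s t, 0 : E)) | s <- ss].
have H := IH _ _ G (fun t => (a t, s t)) ss' (Cr_derive fC).
rewrite size_map all_prop_map in H.
rewrite (_ : (fun t => _) = fun t => iter_derive G [seq s t | s <- ss'] (a t, s t)).
  apply: H => //; first exact: cvg_pair ac sc.
  by apply: all_prop_impl ssc => r rc; exact: cvg_pair rc (cvg_cst _).
apply/funext => t'; rewrite -map_comp.
by rewrite (@iter_derive_slice _ G) -map_comp.
Qed.

Lemma Cr_Ck_on k (E : normedModType R) (U : set E) (f : E -> Y) :
  Cr k U f -> Ck_on k U f.
Proof.
move=> fC; split; first by move=> hs h x; exact: Cr_iter_derivable.
move=> j jk p Up.
have := @Cr_iter_continuous k E U f (E * {ptws 'I_j -> E})%type fst
  [seq (fun q : E * {ptws 'I_j -> E} => q.2 i) | i <- enum 'I_j] p fC.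
rewrite size_map size_enum_ord => /(_ jk Up cvg_fst) H.
have {}H := H _; rewrite all_prop_map in H.
rewrite (_ : (fun q => _) = fun q : E * {ptws 'I_j -> E} => iter_derive f
  [seq s q | s <- [seq (fun q : E * {ptws 'I_j -> E} => q.2 i) | i <- enum 'I_j]] q.1).
  apply: H; apply: all_prop_forall => i /=.
  apply: (@continuous_comp _ _ _ snd (fun g : {ptws 'I_j -> E} => g i)).
    exact: cvg_snd.
  exact: (@proj_continuous _ (fun=> E) i).
by apply/funext => q; rewrite -map_comp.
Qed.

End CrCk.

(** * Banach-Lie groups in charts *)

Section Charts.
Variables (R : realType) (E : completeNormedModType R).
Variable G : banachLieGroupType E.
Implicit Types (c d : chart G E) (r : nat).

Lemma chart_invK c a : chart_cod c a -> chart_map c (chart_inv c a) = a.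
Proof. by case=> x cx <-; rewrite chart_mapK // inE. Qed.

Lemma chart_inv_dom c a : chart_cod c a -> chart_dom c (chart_inv c a).
Proof. by case=> x cx <-; rewrite chart_mapK // inE. Qed.

Lemma chart_map_cod c x : chart_dom c x -> chart_cod c (chart_map c x).
Proof. by move=> cx; exists x. Qed.

Lemma chart_mapK_dom c x : chart_dom c x -> chart_inv c (chart_map c x) = x.
Proof. by move=> cx; rewrite chart_mapK // inE. Qed.

Lemma chart_inv_continuous_at c a : chart_cod c a ->
  {for a, continuous (chart_inv c)}.
Proof.
have := @chart_inv_continuous _ _ _ c.
rewrite continuous_open_subspace; last exact: chart_cod_open.
by move=> H cx; apply: H; rewrite inE.
Qed.

Lemma mulg_continuous_at (T : topologicalType) (f g : T -> G) t :
  {for t, continuous f} -> {for t, continuous g} ->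
  {for t, continuous (fun t => f t * g t)%g}.
Proof.
move=> fc gc; have fgc : {for t, continuous (fun t => (f t, g t))}.
  exact: cvg_pair fc gc.
exact: continuous_comp fgc (lie_mul_continuous _).
Qed.

Lemma invg_continuous_at (T : topologicalType) (f : T -> G) t :
  {for t, continuous f} -> {for t, continuous (fun t => (f t)^-1)%g}.
Proof. by move=> fc; exact: continuous_comp fc (lie_inv_continuous _). Qed.

(** Continuity is a separate clause because it makes the sets carrying the chart expressions
    open. *)
Definition Cr_to_group r (Z : normedModType R) (W : set Z) (f : Z -> G) :=
  (forall z, W z -> {for z, continuous f}) /\
  forall c, atlas c -> Cr r (W `&` f @^-1` chart_dom c) (chart_map c \o f).

Lemma open_preimage_in (Z T : topologicalType) (W : set Z) (f : Z -> T) (U : set T) :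
  open W -> open U -> (forall z, W z -> {for z, continuous f}) ->
  open (W `&` f @^-1` U).
Proof.
move=> oW oU fc; rewrite openE => z [Wz Ufz]; apply: filterI.
  exact: open_nbhs_nbhs.
by apply: (fc z Wz); exact: open_nbhs_nbhs.
Qed.

Section CrToGroup.
Variables (r : nat) (Z : normedModType R) (W : set Z).
Hypothesis oW : open W.

Lemma Cr_to_group_open f c : Cr_to_group r W f ->
  open (W `&` f @^-1` chart_dom c).
Proof. by case=> fc _; apply: open_preimage_in => //; exact: chart_dom_open. Qed.

Lemma Cr_to_group_mul f g : Cr_to_group r W f -> Cr_to_group r W g ->
  Cr_to_group r W (fun z => f z * g z)%g.
Proof.
move=> fC gC; have [fc fr] := fC; have [gc gr] := gC.
have fgc z : W z -> {for z, continuous (fun z => f z * g z)%g}.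
  by move=> Wz; apply: mulg_continuous_at; [exact: fc|exact: gc].
split=> // c hc; apply: Cr_local => z [Wz fgz].
have [c1 hc1 fz] := atlas_cover (f z).
have [c2 hc2 gz] := atlas_cover (g z).
have o1 := Cr_to_group_open c1 fC; have o2 := Cr_to_group_open c2 gC.
have o3 : open (W `&` (fun z => f z * g z)%g @^-1` chart_dom c).
  by apply: open_preimage_in => //; exact: chart_dom_open.
pose W' := (W `&` f @^-1` chart_dom c1) `&` (W `&` g @^-1` chart_dom c2) `&`
  (W `&` (fun z => f z * g z)%g @^-1` chart_dom c).
have oW' : open W' by apply: openI => //; exact: openI.
exists W' => //.
set M := [set p : E * E | [/\ chart_cod c1 p.1, chart_cod c2 p.2
         & chart_dom c (chart_inv c1 p.1 * chart_inv c2 p.2)%g]].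
have oM : open M.
  rewrite (_ : M = (chart_cod c1 `*` chart_cod c2) `&`
    (fun p : E * E => chart_inv c1 p.1 * chart_inv c2 p.2)%g @^-1` chart_dom c);
    last by apply/seteqP; split=> p; [case|case=> -[]].
  apply: open_preimage_in.
  - have -> : chart_cod c1 `*` chart_cod c2 =
        (chart_cod c1 `*` setT) `&` (snd @^-1` chart_cod c2).
      by apply/seteqP; split=> p; [case|case=> -[]].
    apply: open_preimage_in; [exact/setXT_open/chart_cod_open|exact: chart_cod_open|].
    by move=> p _; exact: cvg_snd.
  - exact: chart_dom_open.
  - move=> p [p1 p2]; apply: mulg_continuous_at.
      apply: (@continuous_comp _ _ _ fst (chart_inv c1)); first exact: cvg_fst.
      exact: chart_inv_continuous_at.
    apply: (@continuous_comp _ _ _ snd (chart_inv c2)); first exact: cvg_snd.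
    exact: chart_inv_continuous_at.
have mC := Ck_on_Cr oM (lie_mul_smooth c1 c2 c hc1 hc2 hc r).
pose h z := (chart_map c1 (f z), chart_map c2 (g z)).
have hC : Cr r W' h.
  apply: Cr_pair => //; [apply: Cr_subset (fr c1 hc1)|apply: Cr_subset (gr c2 hc2)].
    by move=> x [[]].
  by move=> x [[]].
have W'M z' : W' z' -> M (h z').
  case=> -[[_ f1] [_ g1]] [_ fg1]; split=> /=; try exact: chart_map_cod.
  by rewrite !chart_mapK_dom.
apply: eq_Cr (Cr_comp oW' oM W'M mC hC) => // z' [[[_ f1] [_ g1]] [_ fg1]] /=.
by rewrite !chart_mapK_dom.
Qed.

Lemma Cr_to_group_inv f : Cr_to_group r W f ->
  Cr_to_group r W (fun z => (f z)^-1)%g.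
Proof.
move=> fC; have [fc fr] := fC.
have fic z : W z -> {for z, continuous (fun z => (f z)^-1)%g}.
  by move=> Wz; apply: invg_continuous_at; exact: fc.
split=> // c hc; apply: Cr_local => z [Wz fiz].
have [c1 hc1 fz] := atlas_cover (f z).
have o1 := Cr_to_group_open c1 fC.
have o3 : open (W `&` (fun z => (f z)^-1)%g @^-1` chart_dom c).
  by apply: open_preimage_in => //; exact: chart_dom_open.
pose W' := (W `&` f @^-1` chart_dom c1) `&`
  (W `&` (fun z => (f z)^-1)%g @^-1` chart_dom c).
have oW' : open W' by exact: openI.
exists W' => //.
set M := [set a : E | chart_cod c1 a /\ chart_dom c ((chart_inv c1 a)^-1)%g].
have oM : open M.
  apply: (@open_preimage_in _ _ (chart_cod c1) (fun a => (chart_inv c1 a)^-1)%g).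
  - exact: chart_cod_open.
  - exact: chart_dom_open.
  - by move=> p p1; apply: invg_continuous_at; exact: chart_inv_continuous_at.
have mC := Ck_on_Cr oM (lie_inv_smooth c1 c hc1 hc r).
have W'M z' : W' z' -> M ((chart_map c1 \o f) z').
  case=> -[_ f1] [_ fi1]; split=> /=; first exact: chart_map_cod.
  by rewrite chart_mapK_dom.
have hC : Cr r W' (chart_map c1 \o f) by apply: Cr_subset (fr c1 hc1) => x [].
apply: eq_Cr (Cr_comp oW' oM W'M mC hC) => // z' [[_ f1] [_ fi1]] /=.
by rewrite chart_mapK_dom.
Qed.

End CrToGroup.

Lemma Cr_to_group_comp r (Z Z' : normedModType R) (W : set Z) (W' : set Z')
  (f : Z -> G) (g : Z' -> Z) : open W -> open W' -> (forall z, W' z -> W (g z)) ->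
  Cr_to_group r W f -> Cr r W' g -> Cr_to_group r W' (f \o g).
Proof.
move=> oW oW' W'W fC gC; have [fc fr] := fC.
have fgc z : W' z -> {for z, continuous (f \o g)}.
  move=> Wz; apply: continuous_comp; first exact: Cr_continuous gC Wz.
  by apply: fc; exact: W'W.
split=> // c hc.
have oW1 : open (W' `&` (f \o g) @^-1` chart_dom c).
  by apply: open_preimage_in => //; exact: chart_dom_open.
have sub : forall z, (W' `&` (f \o g) @^-1` chart_dom c) z ->
   (W `&` f @^-1` chart_dom c) (g z) by move=> z [/W'W].
apply: (Cr_comp oW1 (Cr_to_group_open oW c fC) sub (fr c hc)).
by apply: Cr_subset gC => z [].
Qed.

Lemma Cr_to_group_chart_inv r c : atlas c ->
  Cr_to_group r (chart_cod c) (chart_inv c).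
Proof.
move=> hc; split; first by move=> a; exact: chart_inv_continuous_at.
move=> d hd.
have -> : chart_cod c `&` chart_inv c @^-1` chart_dom d =
    chart_map c @` (chart_dom c `&` chart_dom d).
  apply/seteqP; split=> [a [ca da]|a [x [cx dx] <-]].
    by exists (chart_inv c a); [split=> //; exact: chart_inv_dom|exact: chart_invK].
  by split; [exact: chart_map_cod|rewrite /= chart_mapK_dom].
apply: Ck_on_Cr (atlas_compatible c d hc hd r).
have -> : chart_map c @` (chart_dom c `&` chart_dom d) =
  chart_cod c `&` chart_inv c @^-1` chart_dom d.
  apply/seteqP; split=> [a [x [cx dx] <-]|a [ca da]].
    by split; [exact: chart_map_cod|rewrite /= chart_mapK_dom].
  by exists (chart_inv c a); [split=> //; exact: chart_inv_dom|exact: chart_invK].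
apply: open_preimage_in; [exact: chart_cod_open|exact: chart_dom_open|].
by move=> a; exact: chart_inv_continuous_at.
Qed.

Lemma chart_cod_prod_open c1 c2 : open (chart_cod c1 `*` chart_cod c2).
Proof.
have -> : chart_cod c1 `*` chart_cod c2 =
    (chart_cod c1 `*` setT) `&` (snd @^-1` chart_cod c2).
  by apply/seteqP; split=> p; [case|case=> -[]].
apply: open_preimage_in; [exact/setXT_open/chart_cod_open|exact: chart_cod_open|].
by move=> p _; exact: cvg_snd.
Qed.

Lemma Cr_to_group_fst r c1 c2 : atlas c1 -> atlas c2 ->
  Cr_to_group r (chart_cod c1 `*` chart_cod c2) (fun p : E * E => chart_inv c1 p.1).
Proof.
move=> h1 h2.
apply: (@Cr_to_group_comp r _ _ (chart_cod c1) _ (chart_inv c1) fst).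
- exact: chart_cod_open.
- exact: chart_cod_prod_open.
- by move=> p [].
- exact: Cr_to_group_chart_inv.
- by apply: Cr_linear => p; exact: cvg_fst.
Qed.

Lemma Cr_to_group_snd r c1 c2 : atlas c1 -> atlas c2 ->
  Cr_to_group r (chart_cod c1 `*` chart_cod c2) (fun p : E * E => chart_inv c2 p.2).
Proof.
move=> h1 h2.
apply: (@Cr_to_group_comp r _ _ (chart_cod c2) _ (chart_inv c2) snd).
- exact: chart_cod_open.
- exact: chart_cod_prod_open.
- by move=> p [].
- exact: Cr_to_group_chart_inv.
- by apply: Cr_linear => p; exact: cvg_snd.
Qed.

Lemma Cr_to_group_chart_mul r c1 c2 : atlas c1 -> atlas c2 ->
  Cr_to_group r (chart_cod c1 `*` chart_cod c2)
    (fun p : E * E => chart_inv c1 p.1 * chart_inv c2 p.2)%g.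
Proof.
move=> h1 h2; apply: Cr_to_group_mul; first exact: chart_cod_prod_open.
  exact: Cr_to_group_fst.
exact: Cr_to_group_snd.
Qed.

Lemma Cr_to_group_chart_div r c1 c2 : atlas c1 -> atlas c2 ->
  Cr_to_group r (chart_cod c1 `*` chart_cod c2)
    (fun p : E * E => (chart_inv c1 p.1)^-1 * chart_inv c2 p.2)%g.
Proof.
move=> h1 h2; apply: Cr_to_group_mul; first exact: chart_cod_prod_open.
  by apply: Cr_to_group_inv; [exact: chart_cod_prod_open|exact: Cr_to_group_fst].
exact: Cr_to_group_snd.
Qed.

Lemma Ck_map_comp k (Y Z : normedModType R) (W : set Z) (F : G -> Y) (f : Z -> G) :
  open W -> Ck_map k F -> Cr_to_group k W f -> Cr k W (F \o f).
Proof.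
move=> oW FC fC; have [fc fr] := fC; apply: Cr_local => z Wz.
have [c hc cfz] := atlas_cover (f z).
exists (W `&` f @^-1` chart_dom c) => //.
have oW' := Cr_to_group_open oW c fC.
have FC' := Ck_on_Cr (@chart_cod_open _ _ _ c) (FC c hc).
have sub z' : (W `&` f @^-1` chart_dom c) z' -> chart_cod c ((chart_map c \o f) z').
  by case=> _ /chart_map_cod.
apply: eq_Cr (Cr_comp oW' (@chart_cod_open _ _ _ c) sub FC' (fr c hc)) => //.
by move=> z' [_ cz'] /=; rewrite chart_mapK_dom.
Qed.

End Charts.

(** * Remainder estimate for C^2 maps with vanishing derivative *)

Section Quadratic.
Variables (R : realType) (X Y : normedModType R).

(** The total derivative is C^1, hence Lipschitz near [(p0, 0)]. Comparing its values at [(x, k)]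
    and [(p0, k)], the latter being 0, bounds ['D_h f x] by a multiple of the product of the norms
    of [x - p0] and [h]; the mean value inequality does the rest. *)
Lemma C2_quadratic (U : set X) (f : X -> Y) p0 : open U -> Cr 2 U f -> U p0 ->
  (forall h, 'D_h f p0 = 0) ->
  exists2 d : R, 0 < d & exists2 C : R, 0 < C &
    (forall a, `|a - p0| < d -> U a) /\
    forall a b (s : R), s <= d -> `|a - p0| < s -> `|b - p0| < s ->
      `|f a - f b| <= C * s * `|a - b|.
Proof.
move=> oU fC Up0 Df0.
have [d1 d10 [C [C0 UC LC]]] := C1_lipschitz (y0 := (p0, 0))
  (setXT_open oU) (Cr_derive fC) (conj Up0 I).
have [d2 d20 H2] := open_delta oU Up0.
have near_pair (x h : X) : `|x - p0| < d1 -> `|h| < d1 -> `|(x, h) - (p0, 0)| < d1.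
  by move=> xd hd; rewrite prod_normE /= gt_max xd subr0.
have DC x h : `|x - p0| < d1 -> `|'D_h f x| <= 2 * (C * `|x - p0|) / d1 * `|h|.
  move=> xd; have Ux : U x.
    have [] // := UC (x, 0); apply: near_pair => //; by rewrite normr0.
  apply: (@homogeneous_bound R X Y (fun h => 'D_h f x) (C * `|x - p0|) d1) => // [a k|k kd].
    by rewrite deriveZdir //; exact: Cr_derivable fC Ux.
  have := LC (x, k) (p0, k) (near_pair _ _ xd kd) (near_pair _ _ _ kd).
  rewrite /= Df0 subr0 subrr normr0 => /(_ d10) /le_trans; apply.
  rewrite prod_normE /= subrr normr0 ler_wpM2l // ge_max lexx /=.
  exact: normr_ge0.
have d0 : 0 < Num.min d1 d2 by rewrite lt_min d10.
exists (Num.min d1 d2) => //; exists (2 * C / d1 + 1).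
  by rewrite ltr_wpDl // !mulr_ge0 // invr_ge0 ltW.
split; first by move=> a; rewrite lt_min => /andP[_ /H2].
move=> a b s sd as_ bs.
apply: (@mean_value_ball R X Y f (fun x => 'D_(a - b) f x)) => t t01.
  have := segment_near t01 bs as_.
  move=> /lt_le_trans /(_ sd); rewrite lt_min => /andP[_ /H2 Ut].
  exact: Cr_is_derive fC Ut.
have ts := segment_near t01 bs as_.
have td1 : `|t *: (a - b) + b - p0| < d1.
  by move: (lt_le_trans ts sd); rewrite lt_min => /andP[].
rewrite (le_trans (DC _ _ td1)) // ler_wpM2r //.
rewrite mulrA mulrAC; apply: ler_pM => //; last exact: ltW.
  by rewrite !mulr_ge0 // invr_ge0 ltW.
by rewrite lerDl.
Qed.

End Quadratic.

(** * The exponential function near 0 *)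

Section Exponential.
Variables (R : realType) (E : completeNormedModType R).
Variables (G : banachLieGroupType E) (c : chart G E) (e : E -> G).
Hypotheses (hc : atlas c) (hc1 : chart_dom c 1%g) (hexp : is_exponential c e).

Local Notation phi := (chart_map c).
Local Notation psi := (chart_inv c).
Local Notation p0 := (chart_map c 1%g).

Lemma cod_p0 : chart_cod c p0. Proof. exact: chart_map_cod. Qed.

Lemma psi_p0 : psi p0 = 1%g. Proof. exact: chart_mapK_dom. Qed.

Lemma expD (s t : R) x : e ((s + t) *: x) = (e (s *: x) * e (t *: x))%g.
Proof. by have [H _ _] := hexp x; exact: H. Qed.

Lemma exp0 : e 0 = 1%g.
Proof.
have := expD 0 0 0; rewrite addr0 scaler0 => H.
by apply: (mulgI (e 0)); rewrite -H mulg1.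
Qed.

Lemma expN x : e (- x) = ((e x)^-1)%g.
Proof.
have := expD (-1) 1 x; rewrite addNr scale0r exp0 scaleN1r scale1r => H.
by apply: (mulIg (e x)); rewrite -H mulVg.
Qed.

Lemma exp_double x : e (2 *: x) = (e x * e x)%g.
Proof. by have := expD 1 1 x; rewrite scale1r. Qed.

Lemma exp_line_continuous x t : {for t, continuous (fun t : R => e (t *: x))}.
Proof. by have [_ [H _] _] := hexp x; exact: H. Qed.

Lemma exp_line_derive x :
  is_derive (0 : R^o) (1 : R^o) (fun t : R => phi (e (t *: x))) x.
Proof. by have [_ _ H] := hexp x. Qed.

Definition mul_dom : set (E * E) := (chart_cod c `*` chart_cod c) `&`
  (fun p => psi p.1 * psi p.2)%g @^-1` chart_dom c.
Definition mulc (p : E * E) : E := phi (psi p.1 * psi p.2)%g.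

Lemma mul_dom_open : open mul_dom.
Proof. exact: (Cr_to_group_open (@chart_cod_prod_open _ _ _ c c)
  c (Cr_to_group_chart_mul 0 hc hc)). Qed.

Lemma mulc_Cr r : Cr r mul_dom mulc.
Proof. by have [_ /(_ c hc)] := Cr_to_group_chart_mul r hc hc. Qed.

Lemma mul_dom_p0 : mul_dom (p0, p0).
Proof. by split; rewrite /= ?psi_p0 ?mulg1 //; split; exact: cod_p0. Qed.

Lemma mulcp0 a : chart_cod c a -> mulc (a, p0) = a.
Proof. by move=> ca; rewrite /mulc /= psi_p0 mulg1 chart_invK. Qed.

Lemma mulp0c a : chart_cod c a -> mulc (p0, a) = a.
Proof. by move=> ca; rewrite /mulc /= psi_p0 mul1g chart_invK. Qed.

Lemma psi_mulc p : mul_dom p -> psi (mulc p) = (psi p.1 * psi p.2)%g.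
Proof. by case=> _ dp; rewrite chart_mapK_dom. Qed.

(** The unit laws determine the derivative along both axes, and linearity in the direction combines
    them: at the unit, multiplication is addition to first order. *)
Lemma mulc_derive h k : 'D_(h, k) mulc (p0, p0) = h + k.
Proof.
have C1 := mulc_Cr 1.
have near0 (x : E) : \forall t \near (0 : R), chart_cod c (t *: x + p0).
  apply: (@line_continuous R E p0 x); rewrite scale0r add0r.
  by apply: open_nbhs_nbhs; split; [exact: chart_cod_open|exact: cod_p0].
have Dl : 'D_(h, 0) mulc (p0, p0) = h.
  have [] // : is_derive ((p0, p0) : E * E) ((h, 0) : E * E) mulc h.
  apply: near_is_derive => eps eps0; near=> t.
  have -> : t *: ((h, 0) : E * E) + (p0, p0) = (t *: h + p0, p0).
    by congr pair => /=; rewrite scaler0 add0r.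
  rewrite !mulcp0; [|by near: t; exact: near0|exact: cod_p0].
  by rewrite addrK subrr normr0 mulr_ge0 // ltW.
have Dr : 'D_(0, k) mulc (p0, p0) = k.
  have [] // : is_derive ((p0, p0) : E * E) ((0, k) : E * E) mulc k.
  apply: near_is_derive => eps eps0; near=> t.
  have -> : t *: ((0, k) : E * E) + (p0, p0) = (p0, t *: k + p0).
    by congr pair => /=; rewrite scaler0 add0r.
  rewrite !mulp0c; [|by near: t; exact: near0|exact: cod_p0].
  by rewrite addrK subrr normr0 mulr_ge0 // ltW.
have -> : (h, k) = 1 *: ((h, 0) : E * E) + (0, k).
  by rewrite scale1r; congr pair => /=; rewrite ?addr0 ?add0r.
by rewrite (C1_derive_linear mul_dom_open C1 _ _ _ mul_dom_p0) Dl Dr scale1r.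
Unshelve. all: by end_near. Qed.

(** Squaring has derivative [h |-> 2 *: h] at [p0], so squaring minus doubling is a smooth map with
    vanishing derivative there, to which [C2_quadratic] applies. *)
Lemma square_remainder : exists2 d : R, 0 < d & exists2 C : R, 0 < C &
  (forall a, `|a - p0| < d -> mul_dom (a, a)) /\
  forall a b (s : R), s <= d -> `|a - p0| < s -> `|b - p0| < s ->
    `|mulc (a, a) - mulc (b, b) - 2 *: (a - b)| <= C * s * `|a - b|.
Proof.
pose diag (a : E) : E * E := (a, a).
pose U := diag @^-1` mul_dom.
have diagC r (W : set E) : open W -> Cr r W diag.
  by move=> oW; apply: Cr_pair => //; exact: Cr_id.
have oU : open U.
  apply: open_comp; last exact: mul_dom_open.
  by move=> a _; apply: cvg_pair; exact: cvg_id.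
have Up0 : U p0 by exact: mul_dom_p0.
pose f a := mulc (diag a) + (- 2) *: a.
have fC : Cr 2 U f.
  apply: Cr_add => //.
    apply: (Cr_comp oU mul_dom_open) => //; first exact: mulc_Cr.
    exact: diagC.
  apply: (@Cr_linear _ 2 E E U ( *:%R (-2 : R) : {linear E -> E})).
  exact: scaler_continuous.
have Df h : 'D_h f p0 = 0.
  have D1 : is_derive p0 h (fun a : E => mulc (diag a)) (h + h).
    have := @C1_chain R _ _ mul_dom mulc mul_dom_open (mulc_Cr 1) E diag p0 h (h, h).
    rewrite -mulc_derive; apply => //.
    by apply: is_derive_pair; exact: is_derive_id.
  have D2 : is_derive p0 h (fun a : E => (- 2 : R) *: a) ((- 2 : R) *: h).
    by apply: is_deriveZ; exact: is_derive_id.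
  have [_ ->] : is_derive p0 h f (h + h + (-2) *: h) by exact: is_deriveD.
  by lmod.
have [d d0 [C C0 [Ud H]]] := C2_quadratic oU fC Up0 Df.
exists d => //; exists C => //; split; first by move=> a /Ud.
move=> a b s sd ad bd; rewrite (le_trans _ (H a b s sd ad bd)) //.
rewrite le_eqVlt /f /diag; apply/orP; left; apply/eqP; congr (Num.norm _).
by set u := mulc (a, a); set v := mulc (b, b); lmod.
Qed.

Let a_ x := phi (e x) - p0.

(* Since [e (2 x) = e x * e x], doubling the scale doubles the deviation of [e]
   from the identity up to a quadratic remainder, so that the relative error
   grows by a geometric series. *)
Lemma exp_estimate_step (rho C d : R) : 0 < rho -> 0 < C -> rho <= d -> C * rho <= 1 / 8 ->
  (forall a, `|a - p0| < d -> mul_dom (a, a)) ->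
  (forall a b (s : R), s <= d -> `|a - p0| < s -> `|b - p0| < s ->
    `|mulc (a, a) - mulc (b, b) - 2 *: (a - b)| <= C * s * `|a - b|) ->
  forall x y (s : R), 0 < s -> s <= 1 / 2 ->
  chart_dom c (e (s *: x)) -> chart_dom c (e (s *: y)) ->
  `|a_ (s *: x)| < 2 * rho * s -> `|a_ (s *: y)| < 2 * rho * s ->
  `|a_ (s *: x) - a_ (s *: y) - s *: (x - y)| <= s * (1 / 4 + s / 4) * `|x - y| ->
  [/\ chart_dom c (e ((2 * s) *: x)), chart_dom c (e ((2 * s) *: y)) &
   `|a_ ((2 * s) *: x) - a_ ((2 * s) *: y) - (2 * s) *: (x - y)| <=
      (2 * s) * (1 / 4 + (2 * s) / 4) * `|x - y|].
Proof.
move=> rho0 C0 rhod Crho Hdom Hrem x y s s0 s12 dx dy ax ay axy.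
have rd : 2 * rho * s <= d.
  by rewrite (le_trans _ rhod) //; nra.
have double z : chart_dom c (e (s *: z)) -> `|a_ (s *: z)| < 2 * rho * s ->
    chart_dom c (e ((2 * s) *: z)) /\
    phi (e ((2 * s) *: z)) = mulc (phi (e (s *: z)), phi (e (s *: z))).
  move=> dz az; have [_] : mul_dom (phi (e (s *: z)), phi (e (s *: z))).
    by apply: Hdom; exact: lt_le_trans az rd.
  by rewrite /mulc /= chart_mapK_dom // -exp_double scalerA.
have [d2x ex] := double x dx ax; have [d2y ey] := double y dy ay.
split=> //; rewrite /a_ ex ey.
set u := phi (e (s *: x)); set v := phi (e (s *: y)).
have H := Hrem u v _ rd ax ay.
have {}axy : `|u - v - s *: (x - y)| <= s * (1 / 4 + s / 4) * `|x - y|.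
  by move: axy; rewrite /a_ -/u -/v; congr (`|_| <= _); lmod.
rewrite (_ : _ - (2 * s) *: (x - y) =
  (mulc (u, u) - mulc (v, v) - 2 *: (u - v)) + 2 *: (u - v - s *: (x - y)));
  last by lmod.
rewrite (le_trans (ler_normD _ _)) // normrZ (ger0_norm (ler0n _ 2)).
have uv : `|u - v| <= 2 * s * `|x - y|.
  rewrite (_ : u - v = (u - v - s *: (x - y)) + s *: (x - y)); last by lmod.
  rewrite (le_trans (ler_normD _ _)) // normrZ (gtr0_norm s0).
  apply: (le_trans (lerD axy (lexx _))).
  have xy0 : 0 <= s * `|x - y| by rewrite mulr_ge0 // ltW.
  by nra.
have H2 : `|mulc (u, u) - mulc (v, v) - 2 *: (u - v)| <=
    C * (2 * rho * s) * (2 * s * `|x - y|).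
  rewrite (le_trans H) // ler_wpM2l // !mulr_ge0 // ltW //.
apply: (le_trans (lerD H2 (ler_wpM2l (ler0n _ 2) axy))).
have xy0 : 0 <= s * s * `|x - y| by rewrite !mulr_ge0 // ltW.
by nra.
Qed.

Lemma exp_near_scale x (eps : R) : 0 < eps ->
  \forall t \near (0 : R), chart_dom c (e (t *: x)) /\
    `|a_ (t *: x) - t *: x| <= eps * `|t|.
Proof.
move=> eps0; near=> t; split.
  near: t; apply: (@exp_line_continuous x 0); rewrite scale0r exp0.
  by apply: open_nbhs_nbhs; split => //; exact: chart_dom_open.
near: t; have := is_derive_near (exp_line_derive x) eps0.
apply: filterS => t /=.
have -> : t *: (1 : R^o) = t :> R by exact: mulr1.
by rewrite addr0 scale0r exp0.
Unshelve. all: by end_near. Qed.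

(** The argument starts at a scale [2^-N] depending on [x] and [y], where differentiability of the
    two one-parameter groups at 0 is enough, and doubles up to scale 1; [rho] depends only on the
    remainder of squaring. Passing from [s] to [2 s] adds at most [C (2 rho s) (2 s) <= s^2 / 2]
    times the distance of [x] and [y], which is why [C * rho <= 1 / 8] is imposed: the tolerance
    [s (1 / 4 + s / 4)] has room for exactly that. At [s = 1] it equals [1 / 2]. *)
Lemma exp_estimate : exists2 rho : R, 0 < rho &
  (forall x, `|x| < rho -> chart_dom c (e x)) /\
  (forall x y, `|x| < rho -> `|y| < rho ->
   `|phi (e x) - phi (e y) - (x - y)| <= 1 / 2 * `|x - y|).
Proof.
have [d d0 [C C0 [Hdom Hrem]]] := square_remainder.
have C80 : 0 < 1 / (8 * C) by rewrite divr_gt0 // mulr_gt0.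
pose rho := Num.min d (1 / (8 * C)).
have rho0 : 0 < rho by rewrite lt_min d0.
have rhod : rho <= d by rewrite ge_min lexx.
have Crho : C * rho <= 1 / 8.
  have : rho <= 1 / (8 * C) by rewrite ge_min lexx orbT.
  rewrite ler_pdivlMr ?mulr_gt0 //; lra.
exists rho => //.
have a0 s : a_ (s *: 0) = 0 by rewrite scaler0 /a_ exp0 subrr.
(* Comparison with the point 0 shows that the orbit stays in the region where the remainder of
   squaring is controlled; hence the two comparisons with 0 in [Inv]. *)
have Bsmall x s : 0 < s -> s <= 1 -> `|x| < rho ->
    `|a_ (s *: x) - a_ (s *: 0) - s *: (x - 0)| <= s * (1 / 4 + s / 4) * `|x - 0| ->
    `|a_ (s *: x)| < 2 * rho * s.
  rewrite a0 !subr0 => s0 s1 xr H.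
  rewrite (_ : a_ _ = (a_ (s *: x) - s *: x) + s *: x); last by lmod.
  rewrite (le_lt_trans (ler_normD _ _)) // normrZ (gtr0_norm s0).
  have := normr_ge0 x.
  have : s * `|x| < s * rho by rewrite ltr_pM2l.
  have : s * s * `|x| <= s * `|x| by rewrite ler_wpM2r // ler_piMl // ltW.
  by nra.
pose B s x y := `|a_ (s *: x) - a_ (s *: y) - s *: (x - y)| <=
  s * (1 / 4 + s / 4) * `|x - y|.
pose Inv s x y := [/\ chart_dom c (e (s *: x)) , chart_dom c (e (s *: y)),
  B s x 0, B s y 0 & B s x y].
have step x y s : `|x| < rho -> `|y| < rho -> 0 < s -> s <= 1 / 2 ->
    Inv s x y -> Inv (2 * s) x y.
  move=> xr yr s0 s12 [dx dy Bx By Bxy].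
  have s1 : s <= 1 by lra.
  have ax := Bsmall _ _ s0 s1 xr Bx; have ay := Bsmall _ _ s0 s1 yr By.
  have d00 : chart_dom c (e (s *: 0)) by rewrite scaler0 exp0.
  have ax0 : `|a_ (s *: 0)| < 2 * rho * s by rewrite a0 normr0 !mulr_gt0.
  have S := exp_estimate_step rho0 C0 rhod Crho Hdom Hrem s0 s12.
  have [d2x d2y B2] := S x y dx dy ax ay Bxy.
  have [_ _ B2x] := S x 0 dx d00 ax ax0 Bx.
  by have [_ _ B2y] := S y 0 dy d00 ay ax0 By.
have base x y : exists N, Inv (2^-1 ^+ N) x y.
  have pos (z w : E) : z != w -> 0 < `|z - w| / 8.
    by rewrite -subr_eq0 => zw; rewrite divr_gt0 // normr_gt0.
  (* Each of the two points contributes one eighth of the distance, together the [1 / 4] in [B].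
     Equal points are set apart since their tolerance would be 0. *)
  have key z w : \forall t \near (0 : R), 0 < t -> B t z w.
    have [->|zw] := eqVneq z w.
      by near=> t => t0; rewrite /B !subrr scaler0 subr0 !normr0 mulr0.
    near=> t => t0; rewrite /B.
    have [_ Hz] : chart_dom c (e (t *: z)) /\
        `|a_ (t *: z) - t *: z| <= (`|z - w| / 8) * `|t|.
      by near: t; apply: exp_near_scale; exact: pos.
    have [_ Hw] : chart_dom c (e (t *: w)) /\
        `|a_ (t *: w) - t *: w| <= (`|z - w| / 8) * `|t|.
      by near: t; apply: exp_near_scale; exact: pos.
    rewrite (_ : _ - _ = (a_ (t *: z) - t *: z) - (a_ (t *: w) - t *: w));
      last by lmod.
    rewrite (le_trans (ler_normB _ _)) // (le_trans (lerD Hz Hw)) //.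
    rewrite (gtr0_norm t0).
    have : 0 <= t * `|z - w| by rewrite mulr_ge0 // ltW.
    have : 0 <= t * t * `|z - w| by rewrite !mulr_ge0 // ltW.
    by nra.
  have : \forall t \near (0 : R), 0 < t -> Inv t x y.
    near=> t => t0; split.
    - by have [] : chart_dom c (e (t *: x)) /\ `|a_ (t *: x) - t *: x| <= 1 * `|t|
        by near: t; exact: exp_near_scale.
    - by have [] : chart_dom c (e (t *: y)) /\ `|a_ (t *: y) - t *: y| <= 1 * `|t|
        by near: t; exact: exp_near_scale.
    - by move: t0; near: t; exact: key.
    - by move: t0; near: t; exact: key.
    - by move: t0; near: t; exact: key.
  move=> /nbhs_ballP[r /= r0 Hr].
  have /cvgrPdist_lt/(_ _ r0)[N _ HN] : (fun n => (2^-1 : R) ^+ n) @ \oo --> (0 : R).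
    by apply: cvg_expr; rewrite ger0_norm ?invr_ge0 //; lra.
  exists N; apply: Hr; last by rewrite exprn_gt0.
  by have := HN N (leqnn N); rewrite /ball /=.
have all_scales x y : `|x| < rho -> `|y| < rho -> Inv 1 x y.
  move=> xr yr; have [N] := base x y.
  elim: N => [|N IH]; first by rewrite expr0.
  rewrite exprS => HN; apply: IH.
  have h0 : 0 < (2^-1 : R) ^+ N by rewrite exprn_gt0.
  have h1 : (2^-1 : R) ^+ N <= 1 by rewrite exprn_ile1 ?invr_ge0 //; lra.
  rewrite (_ : 2^-1 ^+ N = 2 * (2^-1 * 2^-1 ^+ N)); last by rewrite mulrA divff // mul1r.
  by apply: step => //; lra.
split=> [x xr|x y xr yr].
  by have [+ _ _ _ _] := all_scales x x xr xr; rewrite scale1r.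
have [_ _ _ _] := all_scales x y xr yr; rewrite /B !scale1r => H.
rewrite (_ : _ - (x - y) = a_ x - a_ y - (x - y)); last by rewrite /a_; lmod.
by apply: (le_trans H); rewrite ler_wpM2r //; lra.
Unshelve. all: by end_near. Qed.

End Exponential.

Section ExponentialLocal.
Variables (R : realType) (E : completeNormedModType R).
Variables (G : banachLieGroupType E) (c : chart G E) (e : E -> G).
Hypotheses (hc : atlas c) (hc1 : chart_dom c 1%g) (hexp : is_exponential c e).

Local Notation phi := (chart_map c).
Local Notation psi := (chart_inv c).
Local Notation p0 := (chart_map c 1%g).

(** The local estimate gives continuity on a ball around 0, and writing [e z] as the square of
    [e (2^-1 *: z)] doubles the radius as often as required. *)
Lemma exp_continuous x : {for x, continuous e}.
Proof.
have [rho rho0 [dom_e est]] := exp_estimate hc hc1 hexp.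
have near0 y : `|y| < rho -> {for y, continuous e}.
  move=> yr.
  have nr : \forall z \near y, `|z| < rho.
    apply: (@cvgr_norm_lt _ _ _ _ _ id y) => //; exact: cvg_id.
  apply: (@near_eq_continuous _ _ (psi \o (phi \o e))).
    by apply: filterS nr => z zr /=; rewrite chart_mapK_dom //; exact: dom_e.
  apply: continuous_comp; last first.
    by apply: chart_inv_continuous_at; apply: chart_map_cod; exact: dom_e.
  apply/cvgrPdist_le => eps eps0; near=> z.
  have zr : `|z| < rho by near: z.
  have H := est y z yr zr.
  rewrite /= (_ : _ - _ = (phi (e y) - phi (e z) - (y - z)) + (y - z)); last by lmod.
  rewrite (le_trans (ler_normD _ _)) // (le_trans (lerD H (lexx _))) //.
  have : `|y - z| <= eps / 2.
    by near: z; apply: cvgr_dist_le; [exact: cvg_id|exact: divr_gt0].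
  have := normr_ge0 (y - z); by nra.
have all_n n y : `|y| < 2 ^+ n * rho -> {for y, continuous e}.
  elim: n y => [|n IH] y; first by rewrite expr0 mul1r; exact: near0.
  move=> yr.
  have -> : e = (fun z => e (2^-1 *: z) * e (2^-1 *: z))%g.
    apply/funext => z; rewrite -(exp_double hexp) scalerA divff ?scale1r //.
  have hy : {for y, continuous (fun z => e (2^-1 *: z))}.
    apply: (@continuous_comp _ _ _ (fun z : E => 2^-1 *: z) e).
      exact: scaler_continuous.
    apply: IH; rewrite normrZ ger0_norm ?invr_ge0 // mulrC ltr_pdivrMr //.
    by rewrite mulrC mulrA -exprS.
  exact: mulg_continuous_at.
have [n xn] : exists n, `|x| / rho < 2 ^+ n.
  exists (Num.truncn (`|x| / rho)).+1.
  apply: (@lt_trans _ _ (Num.truncn (`|x| / rho)).+1%:R); first exact: truncnS_gt.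
  by rewrite -natrX ltr_nat ltn_expl.
by apply: (all_n n); rewrite -ltr_pdivrMr.
Unshelve. all: by end_near. Qed.

(** Banach's fixed point theorem for [T x = x - (phi (e x) - q)], which contracts by [1 / 2] because
    exp is a perturbation of the identity with that constant. As [T] moves [x0] by [r / 2], it
    preserves the closed ball of radius [r] around [x0]. The solution near a prescribed [x0] is what
    the Lipschitz estimate for orbits uses. *)
Lemma exp_surjective : exists2 rho : R, 0 < rho &
  (forall x, `|x| < rho -> chart_dom c (e x)) /\
  forall x0 q, `|x0| + 2 * `|q - phi (e x0)| < rho ->
  exists2 x, `|x - x0| <= 2 * `|q - phi (e x0)| & `|x| < rho /\ phi (e x) = q.
Proof.
have [rho rho0 [dom_e est]] := exp_estimate hc hc1 hexp.
exists rho => //; split=> // x0 q hq.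
set r := 2 * `|q - phi (e x0)| in hq *.
have x0r : `|x0| < rho by rewrite (le_lt_trans _ hq) // lerDl mulr_ge0.
pose B := [set x | `|x - x0| <= r].
have Brho x : B x -> `|x| < rho.
  move=> Bx; rewrite (_ : x = x0 + (x - x0)); last by lmod.
  by rewrite (le_lt_trans (ler_normD _ _)) // (le_lt_trans _ hq) // lerD2l.
pose T x := x - (phi (e x) - q).
have TB x y : B x -> B y -> `|T x - T y| <= 1 / 2 * `|x - y|.
  move=> /Brho xr /Brho yr; rewrite -normrN.
  rewrite (_ : - _ = phi (e x) - phi (e y) - (x - y)); last by rewrite /T; lmod.
  exact: est.
have Bx0 : B x0 by rewrite /B /= subrr normr0 mulr_ge0.
have Tmap : set_fun B B T.
  move=> x Bx; rewrite /B /=.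
  rewrite (_ : T x - x0 = (T x - T x0) + (q - phi (e x0))); last by rewrite /T; lmod.
  rewrite (le_trans (ler_normD _ _)) // (le_trans (lerD (TB _ _ Bx Bx0) (lexx _))) //.
  by have : `|x - x0| <= r := Bx; rewrite /r; lra.
pose T' : {fun B >-> B} := HB.pack T (isFun.Build _ _ B B T Tmap).
have cB : closed B.
  rewrite (_ : B = (fun x => `|x - x0|) @^-1` [set y | y <= r]) //.
  apply: preimage_closed; last exact: closed_le.
  by move=> x _; apply: cvg_norm; apply: cvgB; [exact: cvg_id|exact: cvg_cst].
have half1 : (1 / 2 : R) < 1 by lra.
have half0 : 0 <= (1 / 2 : R) by lra.
have ctr : is_contraction T'.
  exists (NngNum half0); split => //=.
  by move=> [x y] [/= Bx By]; exact: TB.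
have [x Bx Tx] := banach_fixed_point ctr cB (ex_intro _ x0 Bx0).
exists x => //; split; first exact: Brho.
have Tx' : x = T x := Tx.
apply/eqP; rewrite -subr_eq0; apply/eqP.
have -> : phi (e x) - q = x - T x by rewrite /T; lmod.
by rewrite -Tx' subrr.
Qed.

End ExponentialLocal.

(** * Representations *)

Section OrbitLipschitz.
Variables (R : realType) (E V : completeNormedModType R).
Variables (G : banachLieGroupType E) (c : chart G E) (e : E -> G).
Hypotheses (hc : atlas c) (hc1 : chart_dom c 1%g) (hexp : is_exponential c e).
Variable pi : G -> {linear V -> V}.
Hypothesis hpi : continuous_representation pi.

Local Notation phi := (chart_map c).
Local Notation psi := (chart_inv c).
Local Notation p0 := (chart_map c 1%g).

Lemma rep1 v : pi 1%g v = v. Proof. by case: hpi. Qed.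

Lemma repM x y v : pi (x * y)%g v = pi x (pi y v). Proof. by case: hpi. Qed.

Lemma rep_continuous_at (T : topologicalType) (f : T -> G) (w : T -> V) t :
  {for t, continuous f} -> {for t, continuous w} ->
  {for t, continuous (fun t => pi (f t) (w t))}.
Proof.
move=> fc wc; have fwc : {for t, continuous (fun t => (f t, w t))}.
  exact: cvg_pair fc wc.
by case: hpi => _ _ pc; exact: continuous_comp fwc (pc _).
Qed.

(** Homogeneity turns joint continuity of the action at [(1, 0)] into an operator bound uniform in
    the group element. *)
Lemma rep_bounded_near : exists2 d : R, 0 < d & exists2 M : R, 0 < M &
  forall a, `|a - p0| < d -> chart_cod c a /\ forall v, `|pi (psi a) v| <= M * `|v|.
Proof.
have cont : {for (p0, 0 : V), continuous (fun p : E * V => pi (psi p.1) p.2)}.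
  apply: rep_continuous_at; last exact: cvg_snd.
  apply: (@continuous_comp _ _ _ fst psi); first exact: cvg_fst.
  by apply: chart_inv_continuous_at; exact: cod_p0.
have [d1 d10 H1] := continuous_for_delta2 cont ltr01.
have [d2 d20 H2] := open_delta (@chart_cod_open _ _ _ c) (cod_p0 hc1).
exists (Num.min d1 d2); first by rewrite lt_min d10.
exists (2 * 1 / d1); first by rewrite divr_gt0.
move=> a; rewrite lt_min => /andP[a1 a2]; split; first exact: H2.
apply: homogeneous_bound => //; first by move=> b h; rewrite linearZ.
move=> h hd; have := H1 a h a1; rewrite subr0 => /(_ hd) /=.
by rewrite linear0 subr0 => /ltW.
Qed.

Lemma exp_chart_bound : exists2 rho : R, 0 < rho &
  forall x, `|x| < rho -> chart_dom c (e x) /\ `|phi (e x) - p0| <= 2 * `|x|.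
Proof.
have [rho rho0 [dom_e est]] := exp_estimate hc hc1 hexp.
exists rho => // x xr; split; first exact: dom_e.
have := est x 0 xr; rewrite normr0 (exp0 hexp) subr0 => /(_ rho0) H.
rewrite (_ : phi (e x) - p0 = (phi (e x) - p0 - x) + x); last by lmod.
rewrite (le_trans (ler_normD _ _)) // (le_trans (lerD H (lexx _))) //.
by have := normr_ge0 x; lra.
Qed.

Lemma orbit_exp_bounded x v : dpi_dom e pi x v ->
  exists C : R, forall m : nat, m.+1%:R * `|pi (e (m.+1%:R^-1 *: x)) v - v| <= C.
Proof.
move=> /derivableP/is_deriveP H.
pose u (m : nat) := m.+1%:R *: (pi (e (m.+1%:R^-1 *: x)) v - v).
have ucv : u @ \oo --> 'D_1 (orbit_curve e pi x v) 0.
  apply/cvgrPdist_le => eps eps0.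
  have /cvgrPdist_le/(_ _ eps0)/nbhs_ballP[d /= d0 Hd] := H.
  near=> m; have := Hd (m.+1%:R^-1); rewrite /orbit_curve invrK.
  have -> : m.+1%:R^-1 *: (1 : R^o) + 0 = m.+1%:R^-1 :> R.
    by rewrite addr0; exact: mulr1.
  rewrite scale0r (exp0 hexp) rep1; apply; last by rewrite invr_eq0 pnatr_eq0.
  by near: m; exact: (cvg_harmonic (nbhsx_ballx _ _ d0)).
have [C [_ HC]] := cvg_seq_bounded (cvgP _ ucv).
exists (C + 1) => m; have := HC (C + 1); rewrite ltrDl ltr01 => /(_ isT m I).
by rewrite /u /= normrZ ger0_norm.
Unshelve. all: by end_near. Qed.

(** Baire's theorem for the sets [A n]: they are closed because exp and the action are continuous,
    and they cover the space because convergent difference quotients are bounded. The centre [x1] is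
    whatever point the theorem provides. *)
Lemma orbit_exp_uniform v : Dg e pi v ->
  exists x1 : E, exists2 eps : R, 0 < eps & exists2 N : R, 0 < N &
  forall x, `|x - x1| < eps -> forall m : nat,
    m.+1%:R * `|pi (e (m.+1%:R^-1 *: x)) v - v| <= N.
Proof.
move=> Dv.
pose A (n : nat) := [set x | forall m : nat,
  m.+1%:R * `|pi (e (m.+1%:R^-1 *: x)) v - v| <= n%:R].
have cA n : closed (A n).
  rewrite (_ : A n = \bigcap_(m in [set: nat]) [set x |
    m.+1%:R * `|pi (e (m.+1%:R^-1 *: x)) v - v| <= n%:R]); last first.
    by apply/seteqP; split=> [x Ax m _|x Ax m]; [exact: Ax|exact: (Ax m I)].
  apply: closed_bigI => m _.
  apply: (@preimage_closed _ _ (fun x => m.+1%:R * `|pi (e (m.+1%:R^-1 *: x)) v - v|)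
    [set y | y <= n%:R]); last exact: closed_le.
  move=> x _; apply: cvgM; first exact: cvg_cst.
  apply: cvg_norm; apply: cvgB; last exact: cvg_cst.
  apply: rep_continuous_at; last exact: cvg_cst.
  apply: (@continuous_comp _ _ _ (fun x : E => m.+1%:R^-1 *: x) e).
    exact: scaler_continuous.
  exact: exp_continuous hc hc1 hexp _.
have nd : ~ dense (\bigcap_n ~` A n).
  move=> /(_ setT); rewrite setTI => H.
  have [x Hx] : (\bigcap_n ~` A n) !=set0 by apply: H; [exists 0|exact: openT].
  have [C HC] := orbit_exp_bounded (Dv x I).
  apply: (Hx (Num.truncn C).+1 I) => m; rewrite (le_trans (HC m)) //.
  by rewrite ltW // truncnS_gt.
have [n /not_implyP[_ nn]] : exists n, ~ (True -> dense (~` A n)).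
  apply/existsNP => H; apply: nd; apply: Baire => n; split.
    by rewrite openC; exact: cA.
  exact: H.
have [D [D0 [oD DA]]] : exists D, D !=set0 /\ open D /\ D `<=` A n.
  move: nn => /existsNP[D] /not_implyP[D0] /not_implyP[oD] /set0P/negP/negPn/eqP DA.
  exists D; split=> //; split=> // x Dx; apply: contrapT => nA.
  by suff : (D `&` ~` A n) x by rewrite DA.
have [x1 Dx1] := D0.
have [eps eps0 He] := open_delta oD Dx1.
exists x1; exists eps => //; exists n.+1%:R => // x xe m.
by rewrite (le_trans (DA x (He x xe) m)) // ler_nat.
Qed.

(* Write [psi q = e (- x1 / m) * e (x / m)] with [x] close to [x1] and
   [m] of the order of [1 / `|q - p0|]; the uniform bound near [x1] controls
   both factors. *)
Lemma orbit_lipschitz v : Dg e pi v ->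
  exists2 d : R, 0 < d & exists2 K : R, 0 <= K &
  forall q, `|q - p0| < d -> chart_cod c q /\ `|pi (psi q) v - v| <= K * `|q - p0|.
Proof.
move=> Dv.
have [x1 [eps eps0 [N N0 HN]]] := orbit_exp_uniform Dv.
have [d1 d10 [M M0 HM]] := rep_bounded_near.
have [r1 r10 Hb] := exp_chart_bound.
have [r2 r20 [He Hs]] := exp_surjective hc hc1 hexp.
have [d2 d20 [C [C0 UC LC]]] := C1_lipschitz (mul_dom_open hc)
  (mulc_Cr hc 1) (mul_dom_p0 hc1).
pose C' := C + 1.
have C'0 : 0 < C' by rewrite ltr_wpDl.
(* The point [tau *: x1] chosen below will have norm less than [sg], where all local estimates
   apply; [B] converts this requirement into one on the distance of [q] from [p0]. *)
pose sg := Num.min (Num.min r1 (r2 / 2)) (Num.min (d1 / 2) (d2 / 2)).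
have sg0 : 0 < sg by rewrite !lt_min r10 !divr_gt0.
pose B := 8 * C' / eps * (`|x1| + 1).
have x11 : 0 < `|x1| + 1 by rewrite ltr_wpDl.
have B0 : 0 < B by rewrite mulr_gt0 // divr_gt0 // mulr_gt0.
pose d := Num.min (Num.min (eps / (4 * C')) (sg / B))
  (Num.min (r2 / (4 * C')) (Num.min d1 d2)).
have C40 : 0 < 4 * C' by rewrite mulr_gt0.
have d0 : 0 < d by rewrite !lt_min d10 d20 !divr_gt0.
exists d => //; exists (16 * M * N * C' / eps).
  by rewrite divr_ge0 ?(ltW eps0) // !mulr_ge0 // ltW.
move=> q; rewrite !lt_min => /andP[/andP[q1 q2] /andP[q3 /andP[q4 q5]]].
split; first by have [] := HM q q4.
have [->|qp0] := eqVneq q p0.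
  by rewrite (psi_p0 hc1) rep1 !subrr !normr0 mulr0.
set del := `|q - p0| in q1 q2 q3 q4 q5 *.
have del0 : 0 < del by rewrite normr_gt0 subr_eq0.
have Cd0 : 0 < 4 * C' * del by rewrite mulr_gt0.
(* Let [m.+1] be the integer part of [z], positive since [1 <= z], and [tau] its inverse. Then
   [4 C' del <= eps tau] puts [m.+1 *: x] within [eps] of [x1], and [tau <= 8 C' del / eps] makes
   the bound [N tau] linear in [del]; its two occurrences turn 8 into 16. *)
pose z := eps / (4 * C' * del).
have z1 : 1 <= z.
  by rewrite /z ler_pdivlMr // mul1r mulrC -ler_pdivlMr // ltW.
have z0 : 0 <= z by lra.
have mz : (Num.truncn z)%:R <= z by rewrite truncn_le.
have zm : z < (Num.truncn z).+1%:R by exact: truncnS_gt.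
have [m em] : exists m, Num.truncn z = m.+1.
  exists (Num.truncn z).-1; rewrite prednK // -(ltr_nat R).
  by rewrite -(ltrD2r 1) !natr1 (le_lt_trans z1).
rewrite em in mz zm.
pose tau : R := m.+1%:R^-1.
have tau0 : 0 < tau by rewrite invr_gt0.
have mtau : m.+1%:R * tau = 1 by rewrite divff // pnatr_eq0.
have H1 : 4 * C' * del <= eps * tau.
  by move: mz; rewrite /z ler_pdivlMr // mulrC -ler_pdivlMr.
have H2 : tau <= 8 * C' * del / eps.
  rewrite ler_pdivlMr // mulrC -ler_pdivlMr ?invr_gt0 // invrK.
  have : z * (4 * C' * del) = eps by rewrite divfK // gt_eqF.
  have m1 : 1 <= m.+1%:R :> R by rewrite ler1n.
  rewrite -natr1 in zm; have z2 : z <= 2 * m.+1%:R by lra.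
  by have := ler_wpM2r (ltW Cd0) z2; lra.
have x0s : `|tau *: x1| < sg.
  rewrite normrZ gtr0_norm //.
  move: q2; rewrite ltr_pdivlMr // => /(le_lt_trans _); apply.
  rewrite (_ : del * B = (8 * C' * del / eps) * (`|x1| + 1)); last by rewrite /B; ring.
  by rewrite ler_pM // ?ltW // ltrDl.
set x0 := tau *: x1 in x0s.
move: (x0s); rewrite !lt_min => /andP[/andP[x0r1 x0r2] /andP[x0d1 x0d2]].
have [dx0 bx0] := Hb x0 x0r1.
have nx0 : `|- x0| < r1 by rewrite normrN.
have [dnx0 bnx0] := Hb (- x0) nx0.
pose a0 := phi (e x0).
have near2 : `|(a0, q) - (p0, p0)| < d2.
  by rewrite prod_normE /= gt_max q5 andbT (le_lt_trans bx0) //; lra.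
have near2' : `|(a0, p0) - (p0, p0)| < d2.
  by rewrite prod_normE /= gt_max subrr normr0 d20 andbT (le_lt_trans bx0) //; lra.
have L : `|mulc c (a0, q) - a0| <= C' * del.
  have := LC (a0, q) (a0, p0) near2 near2'.
  rewrite (mulcp0 hc1); last exact: chart_map_cod.
  rewrite prod_normE /= subrr normr0 (max_r (normr_ge0 _)) => /le_trans; apply.
  by rewrite ler_wpM2r // lerDl.
have [x xx0 [xr2 ex]] : exists2 x, `|x - x0| <= 2 * `|mulc c (a0, q) - a0| &
    `|x| < r2 /\ phi (e x) = mulc c (a0, q).
  apply: Hs; apply: (@lt_le_trans _ _ (r2 / 2 + r2 / 2)); last by lra.
  apply: ltr_leD => //; rewrite (le_trans (ler_wpM2l _ L)) //.
  by move: q3; rewrite ltr_pdivlMr // => ?; nra.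
have Ex : e x = (e x0 * psi q)%g.
  rewrite -(chart_mapK_dom (He x xr2)) ex psi_mulc; last exact: UC near2.
  by rewrite /= chart_mapK_dom.
have Eq : psi q = (e (- x0) * e x)%g by rewrite Ex (expN hexp) mulKg.
have Hx : `|pi (e x) v - v| <= N * tau.
  have := HN (m.+1%:R *: x) _ m; rewrite scalerA mulVf ?pnatr_eq0 // scale1r.
  move=> H; rewrite -(ler_pM2l (ltr0Sn R m)) (mulrC N) mulrA mtau mul1r; apply: H.
  rewrite (_ : _ - x1 = m.+1%:R *: (x - x0)); last first.
    by rewrite scalerBr /x0 scalerA mtau scale1r.
  rewrite normrZ gtr0_norm // -ltr_pdivlMl // -/tau.
  apply: (le_lt_trans xx0); apply: (@le_lt_trans _ _ (2 * (C' * del))).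
    by rewrite ler_wpM2l.
  by have := mulr_gt0 C'0 del0; nra.
have Hx0 : `|pi (e x0) v - v| <= N * tau.
  have := HN x1 _ m; rewrite -/tau -/x0 subrr normr0 => /(_ eps0) H.
  by rewrite -(ler_pM2l (ltr0Sn R m)) (mulrC N) mulrA mtau mul1r.
have Mb w : `|pi (e (- x0)) w| <= M * `|w|.
  have [] := HM (phi (e (- x0))); last by rewrite chart_mapK_dom // => _; apply.
  by rewrite (le_lt_trans bnx0) // normrN; lra.
have -> : pi (psi q) v - v =
    pi (e (- x0)) (pi (e x) v - v) - pi (e (- x0)) (pi (e x0) v - v).
  rewrite Eq repM !linearB /= -(repM (e (- x0)) (e x0)) (expN hexp) mulVg rep1.
  by lmod.
rewrite (le_trans (ler_normB _ _)) //.
apply: (le_trans (lerD (Mb _) (Mb _))).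
apply: (@le_trans _ _ (2 * (M * (N * tau)))).
  by have := ler_wpM2l (ltW M0) Hx; have := ler_wpM2l (ltW M0) Hx0; lra.
rewrite (_ : 16 * M * N * C' / eps * del = 2 * (M * (N * (8 * C' * del / eps))));
  last by ring.
by rewrite ler_pM2l // ler_pM2l // ler_pM2l.
Qed.

End OrbitLipschitz.

(** * Derivatives of orbits along curves and linearity in the Lie algebra *)

Section OrbitDerivative.
Variables (R : realType) (E V : completeNormedModType R).
Variables (G : banachLieGroupType E) (c : chart G E) (e : E -> G).
Hypotheses (hc : atlas c) (hc1 : chart_dom c 1%g) (hexp : is_exponential c e).
Variable pi : G -> {linear V -> V}.
Hypothesis hpi : continuous_representation pi.

Local Notation phi := (chart_map c).
Local Notation psi := (chart_inv c).
Local Notation p0 := (chart_map c 1%g).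

Lemma dpi_cvg x v : dpi_dom e pi x v ->
  (fun t : R => t^-1 *: (pi (e (t *: x)) v - v)) @ (0 : R)^' --> dpi e pi x v.
Proof.
move=> /derivableP/is_deriveP H; apply: cvg_trans H.
apply: near_eq_cvg; near=> t; rewrite /orbit_curve.
have -> : t *: (1 : R^o) + 0 = t :> R by rewrite addr0; exact: mulr1.
by rewrite scale0r (exp0 hexp) (rep1 hpi).
Unshelve. all: by end_near. Qed.

Lemma cvg_dpi x v w :
  (fun t : R => t^-1 *: (pi (e (t *: x)) v - v)) @ (0 : R)^' --> w ->
  dpi_dom e pi x v /\ dpi e pi x v = w.
Proof.
move=> H; have [] // : is_derive (0 : R^o) (1 : R^o) (orbit_curve e pi x v) w.
apply/is_deriveP; apply: cvg_trans H.
apply: near_eq_cvg; near=> t; rewrite /orbit_curve.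
have -> : t *: (1 : R^o) + 0 = t :> R by rewrite addr0; exact: mulr1.
by rewrite scale0r (exp0 hexp) (rep1 hpi).
Unshelve. all: by end_near. Qed.

Lemma quotient_cvg (W : normedModType R) (gamma : R -> W) (q x : W) :
  (fun t : R => t^-1 *: (gamma t - q)) @ (0 : R)^' --> x ->
  gamma @ (0 : R)^' --> q.
Proof.
move=> H.
have H2 : (fun t : R => t *: (t^-1 *: (gamma t - q)) + q) @ (0 : R)^' --> 0 *: x + q.
  by apply: cvgD; [apply: cvgZ => //; exact: dnbhs0_cvg0|exact: cvg_cst].
rewrite scale0r add0r in H2; apply: cvg_trans H2; apply: near_eq_cvg; near=> t.
have t0 : t != 0 by near: t; exact: dnbhs0_neq0.
by rewrite scalerA divff // scale1r subrK.
Unshelve. all: by end_near. Qed.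

(** The pair of difference quotients is a direction converging to [(x, y)], and the derivative of
    multiplication at the unit adds the two components. *)
Lemma mulc_quotient_cvg (a b : R -> E) x y :
  (fun t : R => t^-1 *: (a t - p0)) @ (0 : R)^' --> x ->
  (fun t : R => t^-1 *: (b t - p0)) @ (0 : R)^' --> y ->
  (fun t : R => t^-1 *: (mulc c (a t, b t) - p0)) @ (0 : R)^' --> x + y.
Proof.
move=> ax bx; rewrite -(mulc_derive hc hc1).
have H : (fun t : R => t^-1 *: (mulc c (t *: (t^-1 *: (a t - p0), t^-1 *: (b t - p0))
   + (p0, p0)) - mulc c (p0, p0))) @ (0 : R)^' --> 'D_(x, y) (mulc c) (p0, p0).
  apply: (C1_cvg (mul_dom_open hc) (mulc_Cr hc 1) (y := fun=> (p0, p0))) => //.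
  - exact: mul_dom_p0.
  - exact: cvg_cst.
  - exact: cvg_pair ax bx.
  - exact: dnbhs0_cvg0.
  - exact: dnbhs0_neq0.
apply: cvg_trans H; apply: near_eq_cvg; near=> t.
have t0 : t != 0 by near: t; exact: dnbhs0_neq0.
rewrite (mulcp0 hc1); last exact: cod_p0.
congr (_ *: (mulc c _ - _)); congr pair => /=; by rewrite scalerA divff // scale1r subrK.
Unshelve. all: by end_near. Qed.

Lemma mul_dom_near (a b : R -> E) : a @ (0 : R)^' --> p0 -> b @ (0 : R)^' --> p0 ->
  \forall t \near (0 : R)^', mul_dom c (a t, b t).
Proof.
move=> ac bc; have abc : (fun t => (a t, b t)) @ (0 : R)^' --> (p0, p0).
  exact: cvg_pair ac bc.
apply: (abc (mul_dom c)); apply: open_nbhs_nbhs; split.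
  exact: mul_dom_open.
exact: mul_dom_p0.
Qed.

Lemma psi_cvg1 (a : R -> E) : a @ (0 : R)^' --> p0 ->
  (fun t => psi (a t)) @ (0 : R)^' --> (1%g : G).
Proof.
move=> ac; rewrite -(psi_p0 hc1).
by apply: cvg_comp ac _; apply: chart_inv_continuous_at; exact: cod_p0.
Qed.

Lemma rep_cvg (T : Type) (F : set_system T) {FF : Filter F} (f : T -> G) (w : T -> V) g u :
  f @ F --> g -> w @ F --> u -> (fun t => pi (f t) (w t)) @ F --> pi g u.
Proof.
move=> fg wu; case: hpi => _ _ pc.
exact: cvg_comp (cvg_pair fg wu) (pc (g, u)).
Qed.

Lemma exp_quotient_cvg x :
  (fun t : R => t^-1 *: (phi (e (t *: x)) - p0)) @ (0 : R)^' --> x.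
Proof.
have /is_deriveP H := exp_line_derive hexp x; apply: cvg_trans H.
apply: near_eq_cvg; near=> t.
have -> : t *: (1 : R^o) + 0 = t :> R by rewrite addr0; exact: mulr1.
by rewrite scale0r (exp0 hexp).
Unshelve. all: by end_near. Qed.

Lemma exp_dom_near x : \forall t \near (0 : R)^', chart_dom c (e (t *: x)).
Proof.
apply: cvg_within_filter (@exp_line_continuous _ _ _ _ _ hexp x 0) _ _.
rewrite scale0r (exp0 hexp).
by apply: open_nbhs_nbhs; split => //; exact: chart_dom_open.
Qed.

(* Only the velocity of a curve through 1 matters: two such curves differ by
   a curve with velocity 0, which the Lipschitz estimate kills. *)
Lemma orbit_derive_curve v (gamma : R -> E) x : Dg e pi v ->
  (fun t : R => t^-1 *: (gamma t - p0)) @ (0 : R)^' --> x ->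
  (fun t : R => t^-1 *: (pi (psi (gamma t)) v - v)) @ (0 : R)^' --> dpi e pi x v.
Proof.
move=> Dv gx.
have [d d0 [K K0 HK]] := orbit_lipschitz hc hc1 hexp hpi Dv.
pose a (t : R) := phi (e (t *: (- x))).
have aq := @exp_quotient_cvg (- x).
have ac : a @ (0 : R)^' --> p0 := quotient_cvg aq.
have gc := quotient_cvg gx.
pose w t := mulc c (a t, gamma t).
have wq := mulc_quotient_cvg aq gx; rewrite addNr in wq.
have wc : w @ (0 : R)^' --> p0 := quotient_cvg wq.
have H1 : (fun t : R => t^-1 *: (pi (psi (w t)) v - v)) @ (0 : R)^' --> (0 : V).
  apply/cvgr0Pnorm_le => eps eps0; near=> t.
  have wd : `|w t - p0| < d by rewrite distrC; near: t; exact: cvgr_dist_lt.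
  have [_ L] := HK _ wd; rewrite normrZ.
  apply: (le_trans (ler_wpM2l _ L)) => //; rewrite mulrCA -normrZ.
  have : `|t^-1 *: (w t - p0)| <= eps / (K + 1).
    near: t; apply: cvgr0_norm_le => //; rewrite divr_gt0 // ltr_wpDl //.
  rewrite ler_pdivlMr ?ltr_wpDl // => ?.
  by have := normr_ge0 (t^-1 *: (w t - p0)); nra.
have ex1 : (fun t : R => e (t *: x)) @ (0 : R)^' --> (1%g : G).
  have := @exp_line_continuous _ _ _ _ _ hexp x 0.
  rewrite /prop_for /continuous_at scale0r (exp0 hexp) => H.
  exact: cvg_within_filter H.
have H2 : (fun t : R => pi (e (t *: x)) (t^-1 *: (pi (psi (w t)) v - v)))
    @ (0 : R)^' --> (0 : V).
  by rewrite -(linear0 (pi 1%g)); exact: rep_cvg.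
have H3 : (fun t : R => pi (e (t *: x)) (t^-1 *: (pi (psi (w t)) v - v)) +
   t^-1 *: (pi (e (t *: x)) v - v)) @ (0 : R)^' --> 0 + dpi e pi x v.
  exact: cvgD H2 (dpi_cvg (Dv x I)).
rewrite add0r in H3; apply: cvg_trans H3; apply: near_eq_cvg; near=> t.
have wdom : mul_dom c (a t, gamma t) by near: t; exact: mul_dom_near.
have edom : chart_dom c (e (t *: (- x))) by near: t; exact: exp_dom_near.
have -> : psi (w t) = ((e (t *: x))^-1 * psi (gamma t))%g.
  by rewrite psi_mulc //= chart_mapK_dom // scalerN (expN hexp).
rewrite linearZ /= linearB /= -(repM hpi) mulVKg -scalerDr.
by congr (_ *: _); rewrite addrA subrK.
Unshelve. all: by end_near. Qed.

Lemma line_quotient_cvg x :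
  (fun t : R => t^-1 *: ((t *: x + p0) - p0)) @ (0 : R)^' --> x.
Proof.
apply: cvg_near_cst; near=> t.
have t0 : t != 0 by near: t; exact: dnbhs0_neq0.
by rewrite addrK scalerA mulVf // scale1r.
Unshelve. all: by end_near. Qed.

(** The product of the chart lines with velocities [x] and [y] has velocity [x + y], so its orbit
    derivative is the left side. Writing [pi (g h) v - v] as [pi g (pi h v - v) + (pi g v - v)]
    evaluates the same limit as the right side. *)
Lemma dpi_add v x y : Dg e pi v -> dpi e pi (x + y) v = dpi e pi x v + dpi e pi y v.
Proof.
move=> Dv.
have qx := @line_quotient_cvg x; have qy := @line_quotient_cvg y.
have cx := quotient_cvg qx; have cy := quotient_cvg qy.
have H1 := orbit_derive_curve Dv (mulc_quotient_cvg qx qy).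
have H2 : (fun t : R => pi (psi (t *: x + p0)) (t^-1 *: (pi (psi (t *: y + p0)) v - v)) +
    t^-1 *: (pi (psi (t *: x + p0)) v - v)) @ (0 : R)^' -->
    pi 1%g (dpi e pi y v) + dpi e pi x v.
  apply: cvgD; last exact: orbit_derive_curve.
  by apply: rep_cvg; [exact: psi_cvg1|exact: orbit_derive_curve].
rewrite (rep1 hpi) addrC in H2.
apply: (cvg_unique (@norm_hausdorff _ _) H1).
apply: cvg_trans H2; apply: near_eq_cvg; near=> t.
have dom : mul_dom c (t *: x + p0, t *: y + p0) by near: t; exact: mul_dom_near.
rewrite psi_mulc // (repM hpi) linearZ /= linearB /= -scalerDr.
by congr (_ *: _); rewrite addrA subrK.
Unshelve. all: by end_near. Qed.

Lemma dpi_scale v x (b : R) : dpi_dom e pi x v ->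
  dpi e pi (b *: x) v = b *: dpi e pi x v.
Proof.
move=> /derivableP D; have := is_derive_dir b D.
rewrite -/(dpi e pi x v) => /is_deriveP H.
have [//|_ ->//] := @cvg_dpi (b *: x) v (b *: dpi e pi x v).
apply: cvg_trans H; apply: near_eq_cvg; near=> t; rewrite /orbit_curve.
have -> : t *: (b *: (1 : R^o)) + 0 = t * b :> R.
  by rewrite addr0; congr (t * _); exact: mulr1.
by rewrite scale0r (exp0 hexp) (rep1 hpi) scalerA.
Unshelve. all: by end_near. Qed.

Lemma dpi_linear_l v (b : R) x y : Dg e pi v ->
  dpi e pi (b *: x + y) v = b *: dpi e pi x v + dpi e pi y v.
Proof. by move=> Dv; rewrite dpi_add // dpi_scale //; exact: Dv. Qed.

Lemma dpi_linear_r x (b : R) v w : dpi_dom e pi x v -> dpi_dom e pi x w ->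
  dpi_dom e pi x (b *: v + w) /\
  dpi e pi x (b *: v + w) = b *: dpi e pi x v + dpi e pi x w.
Proof.
move=> /dpi_cvg Hv /dpi_cvg Hw; apply: cvg_dpi.
have H : (fun t : R => b *: (t^-1 *: (pi (e (t *: x)) v - v)) +
  t^-1 *: (pi (e (t *: x)) w - w)) @ (0 : R)^' --> b *: dpi e pi x v + dpi e pi x w.
  by apply: cvgD => //; exact: cvgZl_tmp.
apply: cvg_trans H; apply: near_eq_cvg; near=> t.
by rewrite (linearP (pi (e (t *: x)))) /=; lmod.
Unshelve. all: by end_near. Qed.

(** The Lipschitz constant of the orbit bounds its difference quotients along the chart line with
    velocity [x], hence their limit. *)
Lemma dpi_bounded v : Dg e pi v -> exists2 K : R, 0 <= K &
  forall x, `|dpi e pi x v| <= K * `|x|.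
Proof.
move=> Dv; have [d d0 [K K0 HK]] := orbit_lipschitz hc hc1 hexp hpi Dv.
exists K => // x; have qx := @line_quotient_cvg x.
have H := orbit_derive_curve Dv qx.
apply: (cvgr_to_le (cvg_norm H)); near=> t.
have td : `|(t *: x + p0) - p0| < d.
  by rewrite distrC; near: t; apply: cvgr_dist_lt => //; exact: quotient_cvg qx.
have [_] := HK _ td; rewrite addrK normrZ => L.
have t0 : t != 0 by near: t; exact: dnbhs0_neq0.
rewrite normrZ normfV mulrC ler_pdivrMr ?normr_gt0 //.
by rewrite (le_trans L) // mulrA mulrAC.
Unshelve. all: by end_near. Qed.

End OrbitDerivative.

(** * Products of the operators [dpi x]: multilinearity, bounds, closedness *)

Section Words.
Variables (R : realType) (E V : completeNormedModType R).
Variables (G : banachLieGroupType E) (c : chart G E) (e : E -> G).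
Hypotheses (hc : atlas c) (hc1 : chart_dom c 1%g) (hexp : is_exponential c e).
Variable pi : G -> {linear V -> V}.
Hypothesis hpi : continuous_representation pi.

Local Notation dpi := (dpi e pi).
Local Notation Dspace := (Dspace e pi).
Local Notation Dg := (Dg e pi).
Local Notation word ys v := (foldr dpi v ys).
Local Notation unit_word := (all_prop (fun y : E => is_true (`|y| <= 1))).

Lemma Dspace_Dg n v : Dspace n.+1 v -> Dg v. Proof. by case. Qed.

Lemma Dspace_dpi n v x : Dspace n.+1 v -> Dspace n (dpi x v).
Proof. by case=> _; apply. Qed.

Lemma DspaceW n v : Dspace n.+1 v -> Dspace n v.
Proof.
elim: n v => // n IH v [Dv H]; split=> // x; apply: IH; exact: H.
Qed.

Lemma Dspace_le m n v : (m <= n)%N -> Dspace n v -> Dspace m v.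
Proof.
elim: n => [|n IH]; first by rewrite leqn0 => /eqP ->.
by rewrite leq_eqVlt ltnS => /orP[/eqP->//|/IH H /DspaceW].
Qed.

Lemma dpi0 x : dpi_dom e pi x 0 /\ dpi x 0 = 0.
Proof.
apply: (cvg_dpi hexp hpi); apply: cvg_near_cst; near=> t.
by rewrite linear0 subrr scaler0.
Unshelve. all: by end_near. Qed.

Lemma Dspace0 n : Dspace n 0.
Proof.
elim: n => // n IH; split; first by move=> x _; have [] := dpi0 x.
by move=> x; have [_ ->] := dpi0 x.
Qed.

Lemma Dspace_linear n (b : R) u v : Dspace n u -> Dspace n v ->
  Dspace n (b *: u + v).
Proof.
elim: n u v => // n IH u v [Du Hu] [Dv Hv]; split.
  by move=> x _; have [] := dpi_linear_r hexp hpi b (Du x I) (Dv x I).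
move=> x; have [_ ->] := dpi_linear_r hexp hpi b (Du x I) (Dv x I).
by apply: IH; [exact: Hu|exact: Hv].
Qed.

Lemma Dspace_sub n u v : Dspace n u -> Dspace n v -> Dspace n (u - v).
Proof. by move=> Du Dv; rewrite addrC -scaleN1r; exact: Dspace_linear. Qed.

Lemma word_Dspace n ys v : Dspace (n + size ys) v -> Dspace n (word ys v).
Proof.
elim: ys n => [|y ys IH] n /=; first by rewrite addn0.
by rewrite addnS -addSn => /IH; exact: Dspace_dpi.
Qed.

Lemma word_Dg ys v : Dspace (size ys).+1 v -> Dg (word ys v).
Proof. by rewrite -add1n => /word_Dspace; exact: Dspace_Dg. Qed.

Lemma word_linear ys (b : R) u v : Dspace (size ys) u -> Dspace (size ys) v ->
  word ys (b *: u + v) = b *: word ys u + word ys v.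
Proof.
elim: ys => //= y ys IH Du Dv; rewrite IH; [|exact: DspaceW..].
by have [_ ->] := dpi_linear_r hexp hpi b (@word_Dg ys u Du y I) (@word_Dg ys v Dv y I).
Qed.

Lemma word_sub ys u v : Dspace (size ys) u -> Dspace (size ys) v ->
  word ys (u - v) = word ys u - word ys v.
Proof. by move=> Du Dv; rewrite addrC -scaleN1r word_linear // scaleN1r addrC. Qed.

Lemma word_slot_linear l1 l2 (b : R) z w v : Dspace (size l1 + size l2).+1 v ->
  word (l1 ++ (b *: z + w) :: l2) v =
  b *: word (l1 ++ z :: l2) v + word (l1 ++ w :: l2) v.
Proof.
move=> Dv; rewrite !foldr_cat /= (dpi_linear_l hc hc1 hexp hpi); last first.
  by apply: word_Dg; apply: Dspace_le Dv; rewrite ltnS leq_addl.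
have D y : Dspace (size l1) (dpi y (word l2 v)).
  by apply: Dspace_dpi; apply: word_Dspace; rewrite addSn.
by rewrite word_linear.
Qed.

Lemma word_slot_scale l1 l2 (b : R) z v : Dspace (size l1 + size l2).+1 v ->
  word (l1 ++ (b *: z) :: l2) v = b *: word (l1 ++ z :: l2) v.
Proof.
move=> Dv; have := word_slot_linear b z 0 Dv; rewrite addr0 => ->.
have := word_slot_linear 0 0 0 Dv; rewrite !scale0r !addr0 add0r => H.
by have := word_slot_linear 1 0 0 Dv;
  rewrite !scale1r addr0 -{1}[word (l1 ++ 0 :: l2) v]addr0 => /addrI <-; rewrite addr0.
Qed.

Lemma word_unit_bound n (C : R) v : 0 <= C -> Dspace n v ->
  (forall ys, size ys = n -> unit_word ys -> `|word ys v| <= C) ->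
  forall ys, size ys = n -> `|word ys v| <= C * \prod_(y <- ys) `|y|.
Proof.
move=> C0 Dv HC ys szn.
suff H l2 l1 : size (l1 ++ l2) = n -> unit_word l1 ->
    `|word (l1 ++ l2) v| <= C * \prod_(y <- l2) `|y| by exact: (H ys [::]).
elim: l2 l1 => [|y l2 IH] l1 szl ul1.
  by rewrite big_nil mulr1; apply: HC => //; rewrite cats0.
have Dv' : Dspace (size l1 + size l2).+1 v by rewrite -addnS -(size_cat l1 (y :: l2)) szl.
rewrite big_cons; have [->|y0] := eqVneq y 0.
  by rewrite -(scale0r 0) word_slot_scale // scale0r normr0 scale0r normr0 mul0r mulr0.
have y0' : `|y| != 0 by rewrite normr_eq0.
have ey : y = `|y| *: (`|y|^-1 *: y) by rewrite scalerA divff // scale1r.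
rewrite {1}ey word_slot_scale //.
rewrite normrZ normr_id mulrCA ler_wpM2l //.
rewrite -cat_rcons.
apply: IH.
  by rewrite cat_rcons size_cat /= -szl size_cat.
rewrite -cats1 all_prop_cat; split=> //; split=> //.
by rewrite normrZ normfV normr_id mulVf.
Qed.

Definition bounded_linear (T : E -> V) : Prop :=
  (forall (b : R) x y, T (b *: x + y) = b *: T x + T y) /\
  exists K : R, forall x, `|T x| <= K * `|x|.

Lemma bounded_linear_scale T (b : R) x : bounded_linear T -> T (b *: x) = b *: T x.
Proof.
case=> TL _; have T0 : T 0 = 0.
  by apply: (addrI (T 0)); rewrite -{1}(scale1r (T 0)) -TL scaler0 !addr0.
by rewrite -[b *: x]addr0 TL T0 addr0.
Qed.

Lemma uniform_bound (F : set (E -> V)) : (forall f, F f -> bounded_linear f) ->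
  (forall x, exists M : R, forall f, F f -> `|f x| <= M) ->
  exists2 K : R, 0 <= K & forall f, F f -> forall x, `|f x| <= K * `|x|.
Proof.
move=> FL Fp.
have FL' f : F f -> bounded_fun_norm f /\ linear f.
  move=> /FL[fL [K HK]]; split=> // r; exists (Num.max K 0 * r) => x xr.
  rewrite (le_trans (HK x)) //.
  apply: (@le_trans _ _ (Num.max K 0 * `|x|)); first by rewrite ler_wpM2r // le_max lexx.
  by rewrite ler_wpM2l // le_max lexx orbT.
have [M HM] := Banach_Steinhauss FL' Fp 1.
exists (2 * Num.max M 0 / 1).
  by rewrite divr1 mulr_ge0 // le_max lexx orbT.
move=> f Ff; apply: homogeneous_bound => // [b h|h hr].
  by apply: bounded_linear_scale; exact: FL.
by rewrite (le_trans (HM f Ff h (ltW hr))) // le_max lexx.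
Qed.

Lemma rep_bounded g : exists2 K : R, 0 <= K & forall v, `|pi g v| <= K * `|v|.
Proof.
have pc : {for 0, continuous (fun v : V => pi g v)}.
  by apply: (rep_continuous_at hpi); [exact: cvg_cst|exact: cvg_id].
have [d d0 Hd] := continuous_for_delta pc ltr01.
exists (2 * 1 / d); first by rewrite divr_ge0 // ltW.
apply: homogeneous_bound => // [b h|h hd]; first by rewrite linearZ.
by have := Hd h; rewrite subr0 linear0 subr0 => /(_ hd) /ltW.
Qed.

(** On the range of [T] the operator [dpi x], in general unbounded, is a pointwise limit of bounded
    difference quotients. Being pointwise bounded, these satisfy a common bound by the
    Banach-Steinhaus theorem, and the limit inherits it. *)
Lemma dpi_comp_bounded_linear x T : bounded_linear T ->
  (forall y, dpi_dom e pi x (T y)) -> bounded_linear (fun y => dpi x (T y)).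
Proof.
move=> TB TD; have [TL [K HK]] := TB.
pose f (m : nat) y := m.+1%:R *: (pi (e (m.+1%:R^-1 *: x)) (T y) - T y).
have [M M0 HM] : exists2 M : R, 0 <= M &
    forall g, [set f m | m in [set: nat]] g -> forall y, `|g y| <= M * `|y|.
  apply: uniform_bound => [_ [m _ <-]|y].
    split; first by move=> b y z; rewrite /f TL (linearP (pi _)) /=; lmod.
    have [Kg Kg0 HKg] := rep_bounded (e (m.+1%:R^-1 *: x)).
    exists (m.+1%:R * (Kg * K + K)) => y; rewrite /f normrZ ger0_norm //.
    rewrite -mulrA ler_wpM2l // (le_trans (ler_normB _ _)) // mulrDl lerD //.
    by rewrite (le_trans (HKg _)) // -mulrA ler_wpM2l.
  have [C HC] := orbit_exp_bounded hexp hpi (TD y).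
  by exists C => _ [m _ <-]; rewrite /f normrZ ger0_norm.
split.
  by move=> b y z; rewrite TL; have [_ ->] := dpi_linear_r hexp hpi b (TD y) (TD z).
exists M => y.
have H := dpi_cvg hexp hpi (TD y).
apply/ler_addgt0Pr => eps eps0.
have /cvgrPdist_le/(_ _ eps0)/nbhs_ballP[d /= d0 Hd] := H.
have [m _ Hm] := cvg_harmonic (nbhsx_ballx (0 : R) _ d0).
have := Hd (m.+1%:R^-1) (Hm m (leqnn m)); rewrite invrK invr_eq0 pnatr_eq0 => /(_ isT).
have := HM (f m) (ex_intro2 _ _ m I erefl) y.
rewrite /f; set a := m.+1%:R *: _ => Ha Hb.
rewrite (_ : dpi x (T y) = a + (dpi x (T y) - a)); last by lmod.
by rewrite (le_trans (ler_normD _ _)) // lerD.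
Qed.

Lemma word_comp_bounded_linear ys T : bounded_linear T ->
  (forall y, Dspace (size ys) (T y)) -> bounded_linear (fun y => word ys (T y)).
Proof.
move=> TB; elim: ys => //= x ys IH TD.
apply: dpi_comp_bounded_linear; first by apply: IH => y; exact: DspaceW.
by move=> y; exact: word_Dg.
Qed.

(** Banach-Steinhaus for the family of all words of length [n.+1] with letters in the unit ball.
    Boundedness at a fixed [x] is the induction hypothesis for the bounded linear map
    [y |-> dpi y (T x)], where [y] is the last letter, the one applied first; hence the induction
    over all [T]. *)
Lemma word_comp_unit_bound n T : bounded_linear T ->
  (forall x, Dspace n (T x)) ->
  exists2 C : R, 0 <= C & forall ys, size ys = n -> unit_word ys ->
    forall x, `|word ys (T x)| <= C * `|x|.
Proof.
elim: n T => [|n IH] T TB TD.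
  have [_ [K HK]] := TB; exists (Num.max K 0); first by rewrite le_max lexx orbT.
  move=> [|//] _ _ x /=; rewrite (le_trans (HK x)) // ler_wpM2r //.
  by rewrite le_max lexx.
have [C C0 HC] : exists2 C : R, 0 <= C & forall f,
   [set (fun x => word ys (T x)) | ys in [set ys | size ys = n.+1 /\ unit_word ys]] f ->
   forall x, `|f x| <= C * `|x|.
  apply: uniform_bound => [_ [ys [szn uy] <-]|x].
    by apply: word_comp_bounded_linear => // y; rewrite szn.
  have [K K0 HK] := dpi_bounded hc hc1 hexp hpi (Dspace_Dg (TD x)).
  have T'B : bounded_linear (fun y => dpi y (T x)).
    split; last by exists K.
    by move=> b y z; rewrite (dpi_linear_l hc hc1 hexp hpi) //; exact: Dspace_Dg (TD x).
  have [C C0 HC] := IH _ T'B (fun y => Dspace_dpi y (TD x)).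
  exists C => _ [ys [szn uy] <-].
  case/lastP: ys szn uy => // ys y; rewrite size_rcons => -[szn].
  rewrite -cats1 all_prop_cat /= foldr_cat /= => -[uy [y1 _]].
  by rewrite (le_trans (HC ys szn uy y)) // ler_piMr.
by exists C => // ys szn uy x; apply: (HC (fun x => word ys (T x))); exists ys.
Qed.

(** The last letter of a word is the variable of the bounded linear map [y |-> dpi y v]; the
    remaining letters are handled by [word_comp_unit_bound]. *)
Lemma word_bounded n v : Dspace n v -> exists2 C : R, 0 <= C &
  forall ys, size ys = n -> unit_word ys -> `|word ys v| <= C.
Proof.
case: n => [|n] Dv; first by exists `|v| => // -[].
have [K K0 HK] := dpi_bounded hc hc1 hexp hpi (Dspace_Dg Dv).
have TB : bounded_linear (fun y => dpi y v).
  split; last by exists K.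
  by move=> b y z; rewrite (dpi_linear_l hc hc1 hexp hpi) //; exact: Dspace_Dg Dv.
have [C C0 HC] := word_comp_unit_bound TB (fun y => Dspace_dpi y Dv).
exists C => // ys; case/lastP: ys => // ys y; rewrite size_rcons => -[szn].
rewrite -cats1 all_prop_cat /= foldr_cat /= => -[uy [y1 _]].
by rewrite (le_trans (HC ys szn uy y)) // ler_piMr.
Qed.

Lemma orbit_derive_at x v (tau : R) : dpi_dom e pi x v ->
  is_derive (tau : R^o) (1 : R^o) (fun t : R => pi (e (t *: x)) v)
    (pi (e (tau *: x)) (dpi x v)).
Proof.
move=> Dv; apply/is_deriveP.
have H : (fun t : R => pi (e (tau *: x)) (t^-1 *: (pi (e (t *: x)) v - v)))
    @ (0 : R)^' --> pi (e (tau *: x)) (dpi x v).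
  by apply: (rep_cvg hpi) (cvg_cst _) _; exact: (dpi_cvg hexp hpi).
apply: cvg_trans H; apply: near_eq_cvg; near=> t.
have -> : t *: (1 : R^o) = t :> R by exact: mulr1.
by rewrite (addrC t) (expD hexp) (repM hpi) linearZ linearB.
Unshelve. all: by end_near. Qed.

(** By the mean value inequality, [pi (e (t *: x)) (u n) - u n] differs from [t *: z] by at most
    [eps] times the absolute value of [t]: the derivative along the segment is
    [t *: pi (e ((s * t) *: x)) (dpi x (u n))], and joint continuity at [(0, z)] keeps it near
    [t *: z]. The range of [t] does not depend on [n], so the estimate passes to the limit. *)
Lemma dpi_closed x (u : nat -> V) w z : (forall n, dpi_dom e pi x (u n)) ->
  u @ \oo --> w -> (fun n => dpi x (u n)) @ \oo --> z ->
  dpi_dom e pi x w /\ dpi x w = z.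
Proof.
move=> uD uw uz; apply: (cvg_dpi hexp hpi).
have key (eps : R) : 0 < eps -> \forall t \near (0 : R),
    `|pi (e (t *: x)) w - w - t *: z| <= eps * `|t|.
  move=> eps0.
  have cont : {for (0 : R, z), continuous (fun p : R * V => pi (e (p.1 *: x)) p.2)}.
    apply: (rep_continuous_at hpi); last exact: cvg_snd.
    apply: (@continuous_comp _ _ _ fst (fun t : R => e (t *: x))); first exact: cvg_fst.
    exact: (exp_line_continuous hexp).
  have [d d0 Hd] := continuous_for_delta2 cont eps0.
  apply/nbhs_ballP; exists d => // t; rewrite /ball /= sub0r normrN => td.
  have est n : `|dpi x (u n) - z| < d ->
      `|pi (e (t *: x)) (u n) - u n - t *: z| <= eps * `|t|.
    move=> nd.
    have := @mean_value_affine R R^o V (fun s : R => pi (e (s *: x)) (u n)) (t : R^o) 0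
      (fun s : R => t *: pi (e ((s * t) *: x)) (dpi x (u n))) (t *: z) (eps * `|t|).
    rewrite addr0 scale0r (exp0 hexp) (rep1 hpi); apply=> s /andP[s0 s1].
      rewrite addr0; have := is_derive_dir t (orbit_derive_at (s * t) (uD n)).
      by have -> : t *: (1 : R^o) = t :> R by exact: mulr1.
    rewrite -scalerBr normrZ mulrC ler_wpM2r //.
    have st : `|s * t - 0| < d.
      by rewrite subr0 normrM (ger0_norm s0) (le_lt_trans _ td) // ler_piMl.
    have := Hd _ _ st nd; rewrite /= scale0r (exp0 hexp) (rep1 hpi) => /ltW.
    by [].
  have lim : (fun n => pi (e (t *: x)) (u n) - u n - t *: z) @ \oo -->
      pi (e (t *: x)) w - w - t *: z.
    apply: cvgB; last exact: cvg_cst.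
    by apply: cvgB => //; apply: (rep_cvg hpi) (cvg_cst _) _.
  apply: (cvgr_to_le (cvg_norm lim)); near=> n; apply: est.
  by rewrite distrC; near: n; exact: cvgr_dist_lt.
have /is_deriveP H : is_derive (0 : R^o) (1 : R^o) (fun t : R => pi (e (t *: x)) w) z.
  apply: near_is_derive => eps eps0; near=> t.
  have -> : t *: (1 : R^o) + 0 = t :> R by rewrite addr0; exact: mulr1.
  by rewrite scale0r (exp0 hexp) (rep1 hpi); near: t; exact: key.
apply: cvg_trans H; apply: near_eq_cvg; near=> t.
have -> : t *: (1 : R^o) + 0 = t :> R by rewrite addr0; exact: mulr1.
by rewrite scale0r (exp0 hexp) (rep1 hpi).
Unshelve. all: by end_near. Qed.

End Words.

(** * The norms on the spaces [Dspace k], completeness and continuity of the bilinear map *)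

Section DspaceNorm.
Variables (R : realType) (E V : completeNormedModType R).
Variables (G : banachLieGroupType E) (c : chart G E) (e : E -> G).
Hypotheses (hc : atlas c) (hc1 : chart_dom c 1%g) (hexp : is_exponential c e).
Variable pi : G -> {linear V -> V}.
Hypothesis hpi : continuous_representation pi.

Local Notation dpi := (dpi e pi).
Local Notation Dspace := (Dspace e pi).
Local Notation word ys v := (foldr dpi v ys).
Local Notation unit_word := (all_prop (fun y : E => is_true (`|y| <= 1))).
Local Notation omega_norm := (omega_norm e pi).
Local Notation Dnorm := (Dnorm e pi).

Lemma omega_norm_ge n v ys : size ys = n -> unit_word ys ->
  (`|word ys v|%:E <= omega_norm n v)%E.
Proof.
move=> szn uy; apply: ereal_sup_ubound; exists (fun i : 'I_n => nth 0 ys i).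
  move=> i /=; move: (nat_of_ord i) => {i szn}; elim: ys uy => [|y ys IH] /=.
    by move=> _ m; rewrite nth_nil normr0.
  by move=> [y1 /IH H] [|m] //=; exact: H.
rewrite /omega; congr (`|foldr _ _ _|%:E).
by rewrite -[RHS](mkseq_nth 0) szn /mkseq -val_enum_ord -map_comp.
Qed.

Lemma omega_norm_le n v (C : R) :
  (forall ys, size ys = n -> unit_word ys -> `|word ys v| <= C) ->
  (omega_norm n v <= C%:E)%E.
Proof.
move=> HC; apply: ge_ereal_sup => _ [xs xs1 <-]; rewrite lee_fin; apply: HC.
  by rewrite size_map size_enum_ord.
by rewrite all_prop_map; apply: all_prop_forall => i; exact: xs1.
Qed.

Lemma unit_word_nseq0 n : unit_word (nseq n 0).
Proof. by elim: n => //= n IH; split=> //; rewrite normr0. Qed.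

Lemma omega_norm_ge0 n v : (0 <= omega_norm n v)%E.
Proof.
apply: le_trans (omega_norm_ge v (size_nseq n 0) (unit_word_nseq0 n)).
by rewrite lee_fin.
Qed.

Definition omega_bound n v : R := fine (omega_norm n v).

Lemma omega_normE n v : Dspace n v -> omega_norm n v = (omega_bound n v)%:E.
Proof.
move=> Dv; have [C C0 HC] := word_bounded hc hc1 hexp hpi Dv.
rewrite fineK // ge0_fin_numE; last exact: omega_norm_ge0.
exact: le_lt_trans (omega_norm_le HC) (ltry _).
Qed.

Lemma omega_bound_ge n v ys : Dspace n v -> size ys = n -> unit_word ys ->
  `|word ys v| <= omega_bound n v.
Proof. by move=> Dv szn uy; rewrite -lee_fin -omega_normE //; exact: omega_norm_ge. Qed.

Lemma omega_bound_le n v C : Dspace n v ->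
  (forall ys, size ys = n -> unit_word ys -> `|word ys v| <= C) ->
  omega_bound n v <= C.
Proof. by move=> Dv HC; rewrite -lee_fin -omega_normE //; exact: omega_norm_le. Qed.

Lemma omega_bound_ge0 n v : 0 <= omega_bound n v.
Proof. by apply: fine_ge0; exact: omega_norm_ge0. Qed.

Lemma word_scale ys (b : R) v : Dspace (size ys) v -> word ys (b *: v) = b *: word ys v.
Proof.
move=> Dv; have D0 := Dspace0 hexp hpi (size ys).
have w0 : word ys 0 = 0.
  by have := word_sub hexp hpi D0 D0; rewrite !subrr.
by rewrite -[b *: v]addr0 (word_linear hexp hpi) // w0 addr0.
Qed.

Lemma Dspace_scale n (b : R) v : Dspace n v -> Dspace n (b *: v).
Proof.
by move=> Dv; rewrite -[b *: v]addr0; apply: Dspace_linear => //; exact: Dspace0.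
Qed.

Lemma Dspace_add n u v : Dspace n u -> Dspace n v -> Dspace n (u + v).
Proof. by move=> Du Dv; rewrite -[u]scale1r; exact: Dspace_linear. Qed.

Lemma omega_bound_add n u v : Dspace n u -> Dspace n v ->
  omega_bound n (u + v) <= omega_bound n u + omega_bound n v.
Proof.
move=> Du Dv; apply: omega_bound_le => [|ys szn uy]; first exact: Dspace_add.
rewrite -[u]scale1r (word_linear hexp hpi) ?szn // !scale1r.
by rewrite (le_trans (ler_normD _ _)) // lerD //; exact: omega_bound_ge.
Qed.

Lemma omega_bound_scale n (b : R) v : Dspace n v ->
  omega_bound n (b *: v) = `|b| * omega_bound n v.
Proof.
move=> Dv.
have scale_le (a : R) w : Dspace n w -> omega_bound n (a *: w) <= `|a| * omega_bound n w.
  move=> Dw; apply: omega_bound_le => [|ys szn uy]; first exact: Dspace_scale.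
  by rewrite word_scale ?szn // normrZ ler_wpM2l //; exact: omega_bound_ge.
apply/eqP; rewrite eq_le scale_le //=.
have [->|b0] := eqVneq b 0; first by rewrite normr0 mul0r omega_bound_ge0.
have := scale_le b^-1 (b *: v) (Dspace_scale b Dv).
rewrite scalerA mulVf // scale1r normfV => H.
by rewrite -ler_pdivlMl ?normr_gt0.
Qed.

Definition Drnorm k v : R := `|v| + \sum_(1 <= j < k.+1) omega_bound j v.

Lemma DnormE k v : Dspace k v -> Dnorm k v = (Drnorm k v)%:E.
Proof.
move=> Dv; rewrite /Dnorm /Drnorm EFinD -sumEFin; congr (_ + _)%E.
apply: eq_big_nat => j /andP[_ jk]; apply: omega_normE.
exact: Dspace_le Dv.
Qed.

Lemma Drnorm_ge k v ys : Dspace k v -> (size ys <= k)%N -> unit_word ys ->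
  `|word ys v| <= Drnorm k v.
Proof.
move=> Dv yk uy; rewrite /Drnorm; case: (posnP (size ys)) => [/size0nil ->|y0] /=.
  by rewrite lerDl sumr_ge0 // => j _; exact: omega_bound_ge0.
rewrite ler_wpDl // (bigD1_seq (size ys)) ?mem_index_iota ?iota_uniq ?y0 //=.
rewrite ler_wpDr ?sumr_ge0 // => [j _|]; first exact: omega_bound_ge0.
by apply: omega_bound_ge => //; exact: Dspace_le Dv.
Qed.

(** The factor [k.+1] counts the summands, the empty word giving the norm of [v] itself. *)
Lemma Drnorm_le k v C : Dspace k v ->
  (forall ys, (size ys <= k)%N -> unit_word ys -> `|word ys v| <= C) ->
  Drnorm k v <= k.+1%:R * C.
Proof.
move=> Dv HC; rewrite /Drnorm -(natr1 k) mulrDl mul1r addrC lerD //; last exact: (HC [::]).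
have : \sum_(1 <= j < k.+1) omega_bound j v <= \sum_(1 <= j < k.+1) C.
  apply: ler_sum_nat => j /andP[_ jk]; apply: omega_bound_le.
    exact: Dspace_le Dv.
  by move=> ys szj uy; apply: HC => //; rewrite szj.
by rewrite sumr_const_nat subn1 /= mulr_natl.
Qed.

Lemma Drnorm_ge0 k v : 0 <= Drnorm k v.
Proof. by rewrite addr_ge0 // sumr_ge0 // => j _; exact: omega_bound_ge0. Qed.

(** For a Cauchy sequence, each word of length at most [k] applied to it converges, to [L ys] say.
    Closedness gives [dpi x (L ys) = L (x :: ys)], so that [L [::]] lies in the space and its words
    are the limits [L ys]. *)
Lemma Dspace_banach k : banach_subspace (Dspace k) (Dnorm k).
Proof.
split.
- by split; [exact: Dspace0|move=> b u v; exact: Dspace_linear].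
- split.
  + by move=> v Dv; rewrite DnormE.
  + move=> v Dv; rewrite DnormE // => -[v0].
    have := @Drnorm_ge k v [::] Dv (leq0n _) I; rewrite v0 /= normr_le0.
    by move/eqP.
  + move=> b v Dv; rewrite DnormE; last exact: Dspace_scale.
    rewrite DnormE // -EFinM; congr _%:E; rewrite /Drnorm normrZ mulrDr mulr_sumr.
    congr (_ + _); apply: eq_big_nat => j /andP[_ jk].
    by apply: omega_bound_scale; exact: Dspace_le Dv.
  + move=> u v Du Dv; rewrite !DnormE //; last exact: Dspace_add.
    rewrite -EFinD lee_fin /Drnorm addrACA lerD //; first exact: ler_normD.
    rewrite -big_split /=; apply: ler_sum_nat => j /andP[_ jk].
    by apply: omega_bound_add; [exact: Dspace_le Du|exact: Dspace_le Dv].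
move=> u Du Hu.
have uS m n := Dspace_sub hexp hpi (Du m) (Du n).
have Hu' (eps : R) : 0 < eps -> exists n0 : nat, forall m n : nat,
    (n0 <= m)%N -> (n0 <= n)%N -> Drnorm k (u m - u n) < eps.
  move=> /Hu[n0 H]; exists n0 => m n mn nn; rewrite -lte_fin -DnormE //.
  exact: H.
have ucvg ys : (size ys <= k)%N -> cvg ((fun n => word ys (u n)) @ \oo).
  move=> yk; apply/cauchy_cvgP/cauchy_exP => eps eps0.
  have P0 : 0 <= \prod_(y <- ys) `|y| by exact: prodr_ge0.
  have P1 : 0 < \prod_(y <- ys) `|y| + 1 by rewrite ltr_wpDl.
  have [n0 Hn] := Hu' _ (divr_gt0 eps0 P1).
  exists (word ys (u n0)); exists n0 => // m /= n0m.
  rewrite -ball_normE /= -(word_sub hexp hpi);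
    [|exact: Dspace_le (Du n0)|exact: Dspace_le (Du m)].
  have Dys : Dspace (size ys) (u n0 - u m) by exact: Dspace_le (uS _ _).
  have unit_bound ys' : size ys' = size ys -> unit_word ys' ->
      `|word ys' (u n0 - u m)| <= Drnorm k (u n0 - u m).
    by move=> szy; apply: Drnorm_ge => //; rewrite szy.
  have := word_unit_bound hc hc1 hexp hpi (Drnorm_ge0 _ _) Dys unit_bound erefl.
  move=> /le_lt_trans; apply.
  have := Hn n0 m (leqnn _) n0m; rewrite ltr_pdivlMr // => H.
  apply: le_lt_trans H; rewrite ler_wpM2l ?Drnorm_ge0 // lerDl //.
pose L ys := lim ((fun n => word ys (u n)) @ \oo).
have Lcvg ys : (size ys <= k)%N -> (fun n => word ys (u n)) @ \oo --> L ys.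
  exact: ucvg.
pose v := L [::].
have LS ys x : (size ys < k)%N -> dpi_dom e pi x (L ys) /\ dpi x (L ys) = L (x :: ys).
  move=> yk; apply: (dpi_closed hexp hpi (u := fun n => word ys (u n))).
  - by move=> n; apply: (word_Dg (G := G)) => //; exact: Dspace_le (Du n).
  - by apply: Lcvg; exact: ltnW.
  - exact: (Lcvg (x :: ys)).
have Lv ys : (size ys <= k)%N -> L ys = word ys v.
  elim: ys => //= x ys IH yk; rewrite -IH; last exact: ltnW.
  by have [_ ->] := LS ys x yk.
have Dv : Dspace k v.
  (* All the limits are treated together, since applying [dpi x] to one of them leads to the limit
     of a longer word. *)
  suff H j ys : (j + size ys <= k)%N -> Dspace j (L ys) by apply: H; rewrite addn0.
  elim: j ys => // j IH ys jk.
  have yk : (size ys < k)%N by rewrite (leq_trans _ jk) // ltnS leq_addl.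
  split; first by move=> x _; have [] := LS ys x yk.
  by move=> x; have [_ ->] := LS ys x yk; apply: IH; rewrite /= addnS.
exists v => // eps eps0.
(* [k.+1] compensates the factor of [Drnorm_le]; the [2] restores a strict inequality after the
   limit in [m], taken with [n] fixed. *)
have k0 : 0 < 2 * k.+1%:R :> R by rewrite mulr_gt0.
have [n0 Hn] := Hu' (eps / (2 * k.+1%:R)) (divr_gt0 eps0 k0).
exists n0 => n nn; rewrite DnormE; last exact: Dspace_sub.
rewrite lte_fin; apply: (@le_lt_trans _ _ (k.+1%:R * (eps / (2 * k.+1%:R)))).
  apply: Drnorm_le => [|ys yk uy]; first exact: Dspace_sub.
  rewrite (word_sub hexp hpi); [|exact: Dspace_le (Du n)|exact: Dspace_le Dv].
  rewrite -Lv //.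
  have H : (fun m => word ys (u n) - word ys (u m)) @ \oo --> word ys (u n) - L ys.
    by apply: cvgB; [exact: cvg_cst|exact: Lcvg].
  apply: (cvgr_to_le (cvg_norm H)); near=> m.
  rewrite -(word_sub hexp hpi); [|exact: Dspace_le (Du n)|exact: Dspace_le (Du m)].
  apply: le_trans (Drnorm_ge (uS n m) yk uy) (ltW _); apply: Hn => //.
  by near: m; exact: nbhs_infty_ge.
have kn : k.+1%:R != 0 :> R by rewrite pnatr_eq0.
move: kn; set K := k.+1%:R => kn.
rewrite (_ : K * _ = eps / 2); last by field.
by lra.
Unshelve. all: by end_near. Qed.

Lemma dpi_bilinear k : bilinear_map_on (Dspace k.+1) (Dspace k) dpi.
Proof.
split.
- by move=> x v; exact: Dspace_dpi.
- by move=> b x y v /Dspace_Dg Dv; exact: (dpi_linear_l hc hc1 hexp hpi).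
- move=> b x u v /Dspace_Dg Du /Dspace_Dg Dv.
  by have [_] := dpi_linear_r hexp hpi b (Du x I) (Dv x I).
Qed.

(** [x] becomes the last letter of a word of length at most [k.+1], from which its norm is factored
    out. *)
Lemma word_dpi_bound k v x ys : Dspace k.+1 v -> (size ys <= k)%N -> unit_word ys ->
  `|word ys (dpi x v)| <= `|x| * Drnorm k.+1 v.
Proof.
move=> Dv yk uy.
have D (z : E) : word ys (dpi z v) = word (rcons ys z) v by rewrite -cats1 foldr_cat.
have Dy : Dspace (size ys + size ([::] : seq E)).+1 v by rewrite addn0; exact: Dspace_le Dv.
rewrite D -cats1; have [->|x0] := eqVneq x 0.
  rewrite -{1}(scale0r 0) (word_slot_scale hc hc1 hexp hpi) //.
  by rewrite scale0r !normr0 mul0r.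
have x0' : `|x| != 0 by rewrite normr_eq0.
have ex : x = `|x| *: (`|x|^-1 *: x) by rewrite scalerA divff // scale1r.
rewrite {1}ex (word_slot_scale hc hc1 hexp hpi) // normrZ normr_id ler_wpM2l //.
apply: Drnorm_ge => //; first by rewrite size_cat addn1.
rewrite all_prop_cat; split=> //; split=> //.
by rewrite normrZ normfV normr_id mulVf.
Qed.

Lemma dpi_continuous_map k :
  continuous_map_on (Dspace k.+1) (Dnorm k.+1) (Dnorm k) dpi.
Proof.
move=> x0 v0 Dv0 eps eps0.
(* In the splitting [dpi x (v - v0) + dpi (x - x0) v0], the norm of [x] is at most that of [x0] plus
   1, which is what the [1] in the minimum is for; the norm of [v0] covers the second term, and
   [k.+1] comes from [Drnorm_le]. *)
pose S := k.+1%:R * (`|x0| + 1 + Drnorm k.+1 v0).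
have S0 : 0 < S by rewrite mulr_gt0 // addrAC ltr_wpDl // addr_ge0 // Drnorm_ge0.
have d0 : 0 < Num.min 1 (eps / (2 * S)).
  by rewrite lt_min ltr01 divr_gt0 // mulr_gt0.
exists (Num.min 1 (eps / (2 * S))) => // x v Dv; set d := Num.min _ _ in d0 *.
have Dvv := Dspace_sub hexp hpi Dv Dv0.
move=> xd; rewrite DnormE // lte_fin => vd.
have d1 : d <= 1 by rewrite ge_min lexx.
have dS : d * S <= eps / 2.
  rewrite -ler_pdivlMr // -mulrA -invfM; first by rewrite ge_min lexx orbT.
have Dd : Dspace k (dpi x v - dpi x0 v0).
  by apply: Dspace_sub => //; exact: Dspace_dpi.
rewrite DnormE // lte_fin.
apply: (@le_lt_trans _ _ (k.+1%:R * (d * (`|x0| + 1 + Drnorm k.+1 v0)))); last first.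
  by rewrite mulrCA; apply: (le_lt_trans dS); lra.
apply: Drnorm_le => // ys yk uy.
have -> : dpi x v - dpi x0 v0 = dpi x (v - v0) + dpi (x - x0) v0.
  have [_ L1 L2] := dpi_bilinear k.
  have -> : v - v0 = (-1) *: v0 + v by rewrite scaleN1r addrC.
  have -> : x - x0 = (-1) *: x0 + x by rewrite scaleN1r addrC.
  by rewrite L1 // L2 //; lmod.
rewrite -[dpi x (v - v0)]scale1r (word_linear hexp hpi) ?scale1r; first last.
- by apply: Dspace_le (Dspace_dpi _ Dv0).
- by apply: Dspace_le (Dspace_dpi _ Dvv).
rewrite (le_trans (ler_normD _ _)) //.
have H1 := word_dpi_bound x Dvv yk uy.
have H2 := word_dpi_bound (x - x0) Dv0 yk uy.
apply: (le_trans (lerD H1 H2)).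
have xx0 : `|x| <= `|x0| + 1.
  rewrite (_ : x = x0 + (x - x0)); last by lmod.
  by rewrite (le_trans (ler_normD _ _)) // lerD2l (le_trans (ltW xd)).
have := Drnorm_ge0 k.+1 v0.
have := Drnorm_ge0 k.+1 (v - v0).
have := normr_ge0 x; have := normr_ge0 (x - x0).
move=> a1 a2 a3 a4.
have h1 : `|x| * Drnorm k.+1 (v - v0) <= d * (`|x0| + 1).
  by rewrite mulrC; apply: ler_pM => //; exact: ltW.
have h2 : `|x - x0| * Drnorm k.+1 v0 <= d * Drnorm k.+1 v0.
  by rewrite ler_wpM2r // ltW.
by lra.
Qed.

End DspaceNorm.

(** * Comparison with the C^k-vectors *)

Section CkVectors.
Variables (R : realType) (E V : completeNormedModType R).
Variables (G : banachLieGroupType E) (c : chart G E) (e : E -> G).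
Hypotheses (hc : atlas c) (hc1 : chart_dom c 1%g) (hexp : is_exponential c e).
Variable pi : G -> {linear V -> V}.
Hypothesis hpi : continuous_representation pi.

Local Notation dpi := (dpi e pi).
Local Notation Dspace := (Dspace e pi).
Local Notation word ys v := (foldr dpi v ys).
Local Notation psi := (chart_inv c).
Local Notation p0 := (chart_map c 1%g).

Lemma exp_line_Cr r x : Cr_to_group r (setT : set R^o) (fun t : R^o => e (t *: x)).
Proof.
have [_ [ec es] _] := hexp x; split; first by move=> t _; exact: ec.
move=> d hd; rewrite setTI; apply: Ck_on_Cr (es d hd r).
apply: open_comp; last exact: chart_dom_open.
by move=> t _; exact: ec.
Qed.

Lemma Ck_vectors_Dg k v : Ck_vectors pi k.+1 v -> Dg e pi v.
Proof.
move=> vk x _; have := Ck_map_comp openT vk (exp_line_Cr k.+1 x).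
by move=> /Cr_derivable; apply.
Qed.

Lemma Ck_vectors_dpi k v x : Ck_vectors pi k.+1 v -> Ck_vectors pi k (dpi x v).
Proof.
move=> vk d hd; apply: Cr_Ck_on.
have Dv := Ck_vectors_Dg vk.
have oW := @chart_cod_prod_open _ _ _ d c.
pose W := chart_cod d `*` chart_cod c.
have FC := Ck_map_comp oW vk (Cr_to_group_chart_mul k.+1 hd hc).
set F := (_ \o _) in FC.
(* Composed with [j], the total derivative of [F] is its partial derivative in the second factor, at
   the unit and in the direction [x]. *)
pose j (q : E) : (E * E) * (E * E) := ((q, p0), (0, x)).
have jC : Cr k (chart_cod d) j.
  apply: Cr_pair; [exact: chart_cod_open| |exact: Cr_cst].
  by apply: Cr_pair; [exact: chart_cod_open|exact: Cr_id|exact: Cr_cst].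
have jW q : chart_cod d q -> (W `*` setT) (j q).
  by move=> dq; split=> //; split=> //=; exact: cod_p0.
apply: eq_Cr (Cr_comp (@chart_cod_open _ _ _ d) (setXT_open oW) jW (Cr_derive FC) jC).
  exact: chart_cod_open.
move=> q dq /=.
have [_ //] : is_derive (q, p0) (0, x) F (pi (chart_inv d q) (dpi x v)).
apply/is_deriveP.
have H : (fun t : R => pi (chart_inv d q) (t^-1 *: (pi (psi (t *: x + p0)) v - v)))
    @ (0 : R)^' --> pi (chart_inv d q) (dpi x v).
  apply: (rep_cvg hpi) (cvg_cst _) _.
  exact: (orbit_derive_curve hc hc1 hexp hpi Dv (@line_quotient_cvg _ _ _ c x)).
apply: cvg_trans H; apply: near_eq_cvg; near=> t.
have -> : t *: ((0, x) : E * E) + (q, p0) = (q, t *: x + p0).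
  by congr pair => /=; rewrite scaler0 add0r.
rewrite /F /= linearZ linearB /= (psi_p0 hc1) mulg1; congr (_ *: (_ - _)).
by rewrite (repM hpi).
Unshelve. all: by end_near. Qed.

Lemma Ck_vectors_Dspace k v : Ck_vectors pi k v -> Dspace k v.
Proof.
elim: k v => // k IH v vk; split; first exact: Ck_vectors_Dg vk.
by move=> x; apply: IH; exact: Ck_vectors_dpi.
Qed.

Lemma prod_norm_continuous (T : topologicalType) (ss : seq (T -> E)) t :
  all_prop (fun s => {for t, continuous s}) ss ->
  {for t, continuous (fun t => \prod_(y <- [seq s t | s <- ss]) `|y|)}.
Proof.
elim: ss => [|s ss IH] /=.
  rewrite (_ : (fun t => _) = fun=> 1); first by move=> _; exact: cvg_cst.
  by apply/funext => t'; rewrite big_nil.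
move=> [sc /IH ssc].
rewrite (_ : (fun t => _) = fun t => `|s t| * \prod_(y <- [seq s t | s <- ss]) `|y|).
  by apply: cvgM => //; exact: cvg_norm.
by apply/funext => t'; rewrite big_cons.
Qed.

(** Telescoping over the letters: changing one of them leaves a word with the letter [s t' - s t],
    and the multilinear bound makes it tend to 0, since the other letters have convergent norms. *)
Lemma word_continuous (T : topologicalType) (ss : seq (T -> E)) t v :
  Dspace (size ss) v -> all_prop (fun s => {for t, continuous s}) ss ->
  {for t, continuous (fun t => word [seq s t | s <- ss] v)}.
Proof.
move=> Dv ssc.
have [C C0 HC] := word_bounded hc hc1 hexp hpi Dv.
have HC' := word_unit_bound hc hc1 hexp hpi C0 Dv HC.
suff H rest pre : size (pre ++ rest) = size ss ->
    all_prop (fun s : T -> E => {for t, continuous s}) pre ->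
    all_prop (fun s : T -> E => {for t, continuous s}) rest ->
    (fun t' => word ([seq s t' | s <- pre] ++ [seq s t' | s <- rest]) v -
       word ([seq s t' | s <- pre] ++ [seq s t | s <- rest]) v) @ t --> (0 : V).
  have {}H := H ss [::] erefl I ssc.
  rewrite /prop_for /continuous_at -[X in _ --> X]add0r.
  have H2 : (fun t' => (word [seq s t' | s <- ss] v - word [seq s t | s <- ss] v) +
      word [seq s t | s <- ss] v) @ t --> 0 + word [seq s t | s <- ss] v.
    by apply: cvgD => //; exact: cvg_cst.
  apply: cvg_trans H2; apply: near_eq_cvg; near=> t'.
  by rewrite subrK.
elim: rest pre => [|s r IH] pre szp prec /=.
  move=> _; apply: cvg_near_cst; near=> t'.
  by rewrite subrr.
move=> [sc rc].
have H1 : (fun t' => word ([seq f t' | f <- rcons pre s] ++ [seq f t' | f <- r]) v -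
    word ([seq f t' | f <- rcons pre s] ++ [seq f t | f <- r]) v) @ t --> (0 : V).
  apply: IH => //; first by rewrite cat_rcons.
  by rewrite -cats1 all_prop_cat.
have H2 : (fun t' => word ([seq f t' | f <- pre] ++ (s t' - s t) :: [seq f t | f <- r]) v)
    @ t --> (0 : V).
  pose ss' := pre ++ (fun t' => s t' - s t) :: [seq (fun=> f t) | f <- r].
  have ss'c : all_prop (fun s : T -> E => {for t, continuous s}) ss'.
    rewrite all_prop_cat /=; split=> //; split.
      by apply: cvgB => //; exact: cvg_cst.
    by rewrite all_prop_map; apply: all_prop_forall => f /=; exact: cvg_cst.
  have := prod_norm_continuous ss'c.
  have val : \prod_(y <- [seq f t | f <- ss']) `|y| = 0.
    by rewrite map_cat big_cat /= big_cons subrr normr0 mul0r mulr0.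
  rewrite /prop_for /continuous_at val => H.
  have {}H : (fun t' => C * \prod_(y <- [seq f t' | f <- ss']) `|y|) @ t --> C * 0.
    by apply: cvgM => //; exact: cvg_cst.
  rewrite mulr0 in H; apply/cvgr0Pnorm_le => eps eps0; near=> t'.
  have szw : size ([seq f t' | f <- pre] ++ (s t' - s t) :: [seq f t | f <- r]) = size ss.
    by rewrite -szp !size_cat /= !size_map.
  apply: (le_trans (HC' _ szw)).
  have : `|C * \prod_(y <- [seq f t' | f <- ss']) `|y| | <= eps.
    by near: t'; apply: (@cvgr0_norm_le _ R^o).
  rewrite map_cat /= -map_comp; apply: le_trans; exact: ler_norm.
have H3 : (fun t' => (word ([seq f t' | f <- rcons pre s] ++ [seq f t' | f <- r]) v -
    word ([seq f t' | f <- rcons pre s] ++ [seq f t | f <- r]) v) +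
    word ([seq f t' | f <- pre] ++ (s t' - s t) :: [seq f t | f <- r]) v) @ t
    --> (0 : V) + 0 by exact: cvgD.
rewrite addr0 in H3; apply: cvg_trans H3; apply: near_eq_cvg; near=> t'.
have Dv' : Dspace (size [seq f t' | f <- pre] + size [seq f t | f <- r]).+1 v.
  by rewrite !size_map -addnS -(size_cat pre (s :: r)) szp.
have -> : s t' - s t = (-1) *: s t + s t' by rewrite scaleN1r addrC.
rewrite (word_slot_linear hc hc1 hexp hpi) // !map_rcons !cat_rcons scaleN1r.
by rewrite (addrC (- _)) subrKA.
Unshelve. all: by end_near. Qed.

(** The family theorem with no slots, [Phi q [::]] being the orbit map of [v] in the chart [d]. Each
    derivative adds a letter, and the words stay admissible up to length [k]. *)
Lemma Dspace_Ck_vectors k v : Dspace k v -> Ck_vectors pi k v.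
Proof.
move=> Dv d hd; apply: Cr_Ck_on.
have oU := @chart_cod_open _ _ _ d.
pose dv (p : E * E) := ((chart_inv d p.1)^-1 * chart_inv d p.2)%g.
pose nu (p : E * E) := chart_map c (dv p).
pose M := (chart_cod d `*` chart_cod d) `&` dv @^-1` chart_dom c.
have oM : open M.
  exact: (Cr_to_group_open (@chart_cod_prod_open _ _ _ d d) c
    (Cr_to_group_chart_div 0 hd hd)).
have nuC r : Cr r M nu by have [_ /(_ c hc)] := Cr_to_group_chart_div r hd hd.
have Mdiag q : chart_cod d q -> M (q, q) by move=> dq; split=> //=; rewrite /dv /= mulVg.
have nudiag q : nu (q, q) = p0 by rewrite /nu /dv /= mulVg.
(* The left Maurer-Cartan form in charts: the velocity at [t = 0] of the curve obtained by
   translating [t |-> chart_inv d (t *: u + q)] on the left to the unit. *)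
pose L (p : E * E) := 'D_(0, p.2) nu (p.1, p.1).
pose Phi (q : E) (zs : seq E) := pi (chart_inv d q) (word zs v).
have := @multilinear_family_Cr R E E V Phi (chart_cod d) k L oU _ _ _ _ k E
  (chart_cod d) id [::] oU (fun q dq => dq) _ I.
rewrite addn0; apply => //.
- move=> T a ss t dat sk ac ssc; apply: (rep_continuous_at hpi).
    apply: (@continuous_comp _ _ _ a (chart_inv d)) => //.
    exact: chart_inv_continuous_at.
  by apply: word_continuous => //; exact: Dspace_le Dv.
- move=> q l1 l2 b z w dq szk; rewrite /Phi (word_slot_linear hc hc1 hexp hpi).
    by rewrite linearP.
  exact: Dspace_le Dv.
- move=> q u zs dq szk; apply/is_deriveP.
  have Dw : Dg e pi (word zs v) by apply: word_Dg; exact: Dspace_le Dv.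
  have Muq : \forall t \near (0 : R)^', M (q, t *: u + q).
    have : (fun t : R => (q, t *: u + q)) @ (0 : R)^' --> (q, q).
      apply: cvg_pair; first exact: cvg_cst.
      by apply: (quotient_cvg (x := u)); apply: cvg_near_cst; near=> t;
        have t0 : t != 0 by [near: t; exact: dnbhs0_neq0];
        rewrite addrK scalerA mulVf // scale1r.
    move=> /(_ M); apply; apply: open_nbhs_nbhs; split=> //; exact: Mdiag.
  have gq : (fun t : R => t^-1 *: (nu (q, t *: u + q) - p0)) @ (0 : R)^' --> L (q, u).
    have /is_deriveP H := Cr_is_derive (0, u) (nuC 1) (Mdiag q dq).
    apply: cvg_trans H; apply: near_eq_cvg; near=> t.
    rewrite nudiag; congr (_ *: (nu _ - _)).
    by congr pair => /=; rewrite scaler0 add0r.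
  (* For a curve [g_t] in the group, [pi(g_t) w - pi(g_0) w] equals [pi(g_0)] applied to
     [pi(g_0^-1 g_t) w - w], which reduces the derivative to one at the unit. *)
  have H : (fun t : R => pi (chart_inv d q)
      (t^-1 *: (pi (psi (nu (q, t *: u + q))) (word zs v) - word zs v)))
      @ (0 : R)^' --> pi (chart_inv d q) (dpi (L (q, u)) (word zs v)).
    apply: (rep_cvg hpi) (cvg_cst _) _.
    exact: (orbit_derive_curve hc hc1 hexp hpi Dw gq).
  apply: cvg_trans H; apply: near_eq_cvg; near=> t.
  have [_ Mt] : M (q, t *: u + q) by near: t; exact: Muq.
  rewrite chart_mapK_dom // /Phi linearZ linearB /= -(repM hpi) /dv /=.
  by rewrite mulVKg.
- move=> r; pose j (p : E * E) : (E * E) * (E * E) := ((p.1, p.1), (0, p.2)).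
  have oU' := setXT_open (X' := E) oU.
  have fstC : Cr r (chart_cod d `*` setT) (fst : E * E -> E).
    by apply: Cr_linear => p; exact: cvg_fst.
  have sndC : Cr r (chart_cod d `*` setT) (snd : E * E -> E).
    by apply: Cr_linear => p; exact: cvg_snd.
  have jC : Cr r (chart_cod d `*` setT) j.
    apply: Cr_pair => //; first exact: Cr_pair.
    by apply: Cr_pair => //; exact: Cr_cst.
  apply: (@Cr_comp _ r _ _ _ _ (M `*` setT) (fun p => 'D_(p.2) nu p.1) j) => //.
  + exact: setXT_open.
  + by move=> [q h] [/= dq _]; split=> //; exact: Mdiag.
  + exact: Cr_derive.
- exact: Cr_id.
Unshelve. all: by end_near. Qed.

End CkVectors.

Theorem theorem9p4 (R : realType) (g V : completeNormedModType R)
  (G : banachLieGroupType g) (c : chart G g) (hc : atlas c)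
  (hc1 : chart_dom c 1%g) (expG : g -> G) (hexp : is_exponential c expG)
  (pi : G -> {linear V -> V}) (hpi : continuous_representation pi) (k : nat) :
  [/\ Dspace expG pi k = Ck_vectors pi k,
      banach_subspace (Dspace expG pi k) (Dnorm expG pi k),
      bilinear_map_on (Dspace expG pi k.+1) (Dspace expG pi k) (dpi expG pi)
    & continuous_map_on (Dspace expG pi k.+1)
        (Dnorm expG pi k.+1) (Dnorm expG pi k) (dpi expG pi)].
Proof.
split.
- apply/seteqP; split=> v.
    exact: (Dspace_Ck_vectors hc hc1 hexp hpi).
  exact: (Ck_vectors_Dspace hc hc1 hexp hpi).
- exact: (Dspace_banach hc hc1 hexp hpi k).
- exact: (dpi_bilinear hc hc1 hexp hpi k).
- exact: (dpi_continuous_map hc hc1 hexp hpi (k := k)).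
Qed.
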